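(* Let $\phi(z)\,dz^2$ be a meromorphic quadratic differential on the Riemann sphere $\widehat{\mathbb C}$. (a) If $\phi(z)=S_f(z)$ for some rational map $f$, then all poles of the quadratic differential $\phi(z)\,dz^2$ are of order two, and around each critical point $c\in\mathbb C$ of $f$ with local degree $d_c\ge 2$, the local Laurent series expansion of $\phi(z)$ has the form $$(\ast)\qquad (z-c)^2\phi(z)=\frac{1-d_c^2}{2}+a_1(z-c)+a_2(z-c)^2+\cdots,\quad\text{with } a_{d_c}=Y_{d_c}(a_1,a_2,\dots,a_{d_c-1}).$$ The same relation also holds at $\infty$ (if it is a critical point of $f$) after the change of coordinates by $1/z$. (b) Conversely, assume that $\phi(z)\,dz^2$ is a meromorphic quadratic differential on $\widehat{\mathbb C}$ such that at each pole $c$, except possibly one, it takes the local expression $(\ast)$ for some integer $d_c\ge 2$, and furthermore the exceptional pole (if any) has order $2$. Then $\phi(z)\,dz^2$ is the Schwarzian derivative of some rational function $f$, and it has the local expression $(\ast)$ (for some integer $d_c\ge 2$) at every pole. The critical points of $f$ are precisely the poles of $\phi(z)\,dz^2$, with the integer $d_c$ being the local degree of $f$ at $c$.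
   Context: For a non-constant meromorphic function $f$, the Schwarzian derivative is $S_f=\frac{f'''}{f'}-\frac32\left(\frac{f''}{f'}\right)^2$ where $f\neq\infty$, and $S_f(z)=\lim_{w\to z}S_f(w)$ where $f(z)=\infty$. It is regarded as the quadratic differential $S_f(z)\,dz^2$. The local expression of a quadratic differential $\phi(z)\,dz^2$ at $\infty$ is that of $\Phi(w)=\phi(1/w)w^{-4}$ at $w=0$, where $w=1/z$; orders of poles at $\infty$ and the expression $(\ast)$ at a pole $c=\infty$ are understood in this coordinate. The polynomials $Y_d$: $Y_1=0$, and for every integer $d\ge 2$, $Y_d(x_1,\dots,x_{d-1})$ is the polynomial such that $$\left|\begin{matrix} x_1 & 2\cdot 1\cdot(1-d) & 0 & \cdots & 0\\ x_2 & x_1 & 2\cdot 2\cdot(2-d) & \cdots & 0\\ \vdots & \vdots & \vdots & & \vdots\\ x_{d-1} & x_{d-2} & x_{d-3} & \cdots & 2(d-1)(-1)\\ x_d & x_{d-1} & x_{d-2} & \cdots & x_1\end{matrix}\right| = N\cdot\bigl(x_d-Y_d(x_1,\dots,x_{d-1})\bigr)$$ for some constant $N\neq 0$. Here the $d\times d$ matrix has $(i,j)$ entry $x_{i-j+1}$ for $i\ge j$, entry $2i(i-d)$ for $j=i+1$, and $0$ for $j>i+1$. *)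

(* Defs.v *)
From HB Require Import structures.
From mathcomp Require Import all_boot all_order all_algebra.
From mathcomp Require Import complex.
From mathcomp Require Import mathcomp_extra boolp classical_sets reals.
From mathcomp Require Import topology normedtype sequences derive.
From mathcomp.multinomials Require mpoly.
(* the notations of mpoly clash with those of mathcomp-analysis *)
Import -(notations) mathcomp.multinomials.mpoly.

Set Implicit Arguments.
Unset Strict Implicit.
Unset Printing Implicit Defensive.

Import Order.TTheory GRing.Theory Num.Theory.
Import numFieldNormedType.Exports.

Local Open Scope classical_set_scope.
Local Open Scope ring_scope.

(* The field of complex numbers, as a numClosedFieldType because the norm
   topology is inferred there while it is not on the bare type R[i]. *)
Definition CC (R : realType) : numClosedFieldType := R[i].

(* None is the point at infinity. *)
Definition sphere (C : numClosedFieldType) : Type := option C.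

(* g w = w ^ m * (a 0 + a 1 * w + a 2 * w ^+ 2 + ...) around w = 0. *)
Definition laurent (C : numClosedFieldType) (g : C -> C) (m : int)
    (a : nat -> C) : Prop :=
  \forall w \near (0 : C)^',
    series (fun n => a n * w ^+ n) @ \oo --> w ^ (- m) * g w.

Definition meromorphic_at0 (C : numClosedFieldType) (g : C -> C) : Prop :=
  exists (m : int) (a : nat -> C), laurent g m a.

Definition order_at0 (C : numClosedFieldType) (g : C -> C) (m : int) : Prop :=
  exists2 a : nat -> C, laurent g m a & a 0%N != 0.

(* A quadratic differential on the sphere is given by its coefficient phi in
   the coordinate z of the plane; the value of phi at a pole is irrelevant.
   [qd_local phi p] is its coefficient in the coordinate w centred at p, that
   is z = c + w if p = c is finite and z = 1 / w if p = oo. *)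
Definition qd_local (C : numClosedFieldType) (phi : C -> C) (p : sphere C) :
    C -> C :=
  match p with
  | Some c => fun w => phi (c + w)
  | None => fun w => phi w^-1 * w ^- 4
  end.

Definition pole_of_order (C : numClosedFieldType) (phi : C -> C)
    (p : sphere C) (k : nat) : Prop :=
  (0 < k)%N /\ order_at0 (qd_local phi p) (- k%:Z).

Definition is_pole (C : numClosedFieldType) (phi : C -> C) (p : sphere C) :
    Prop :=
  exists k, pole_of_order phi p k.

Definition holomorphic_at (C : numClosedFieldType) (phi : C -> C) (c : C) :
    Prop :=
  exists a : nat -> C, \forall w \near (0 : C),
    series (fun n => a n * w ^+ n) @ \oo --> phi (c + w).

Definition meromorphic_quad_diff (C : numClosedFieldType) (phi : C -> C) :
    Prop :=
  (forall c, holomorphic_at phi c \/ is_pole phi (Some c)) /\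
  meromorphic_at0 (qd_local phi None).

(* With n the degree of the map P / Q in lowest terms, the value at infinity
   is the ratio of the coefficients of degree n. *)
Definition ratmap (C : numClosedFieldType) (P Q : {poly C}) (p : sphere C) :
    sphere C :=
  let n := (maxn (size P) (size Q)).-1 in
  match p with
  | Some z => if Q.[z] == 0 then None else Some (P.[z] / Q.[z])
  | None => if Q`_n == 0 then None else Some (P`_n / Q`_n)
  end.

Definition rational_map (C : numClosedFieldType) (f : sphere C -> sphere C) :
    Prop :=
  exists P Q : {poly C}, coprimep P Q /\ forall p, f p = ratmap P Q p.

Definition constant_map (C : numClosedFieldType) (f : sphere C -> sphere C) :
    Prop :=
  exists v, forall p, f p = v.

Definition point_at (C : numClosedFieldType) (p : sphere C) (w : C) :
    sphere C :=
  match p with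
  | Some c => Some (c + w)
  | None => if w == 0 then None else Some w^-1
  end.

(* The coordinate centred at q of the point v; the default value 0 for
   q != oo = v is only reached away from a neighbourhood of q. *)
Definition coord_at (C : numClosedFieldType) (q v : sphere C) : C :=
  match q, v with
  | Some b, Some y => y - b
  | Some _, None => 0
  | None, Some y => y^-1
  | None, None => 0
  end.

Definition local_degree (C : numClosedFieldType) (f : sphere C -> sphere C)
    (p : sphere C) (d : nat) : Prop :=
  (0 < d)%N /\ order_at0 (fun w => coord_at (f p) (f (point_at p w))) d%:Z.

Definition critical_point (C : numClosedFieldType) (f : sphere C -> sphere C)
    (p : sphere C) : Prop :=
  exists2 d, (2 <= d)%N & local_degree f p d.

Definition finite_part (C : numClosedFieldType) (f : sphere C -> sphere C)
    (z : C) : C :=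
  if f (Some z) is Some v then v else 0.

Definition schwarzian (C : numClosedFieldType) (f : sphere C -> sphere C)
    (z : C) : C :=
  let g := finite_part f in
  let S w := (g^`(3))%classic w / (g^`())%classic w
    - 3%:R / 2%:R * ((g^`(2))%classic w / (g^`())%classic w) ^+ 2 in
  if f (Some z) is None then lim (S w @[w --> z^']) else S z.

Definition is_schwarzian (C : numClosedFieldType) (phi : C -> C)
    (f : sphere C -> sphere C) : Prop :=
  forall z, ~ is_pole phi (Some z) -> phi z = schwarzian f z.

(* The matrix indices i and j start at 0 and the variables x 1, x 2, ... at 1. *)
Definition Ymx (A : comNzRingType) (d : nat) (x : nat -> A) : 'M[A]_d :=
  \matrix_(i < d, j < d)
    if (j <= i)%N then x (i - j).+1
    else if (j == i.+1 :> nat)%N then 2%:R * i.+1%:R * (i.+1%:R - d%:R)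
    else 0.

(* Evaluation at (x 1, ..., x d.-1). *)
Definition eval1 (C : numClosedFieldType) (d : nat) (y : mpoly d.-1 C)
    (x : nat -> C) : C :=
  meval (fun i : 'I_d.-1 => x i.+1) y.

Definition Y_spec (C : numClosedFieldType) (d : nat) (y : mpoly d.-1 C) :
    Prop :=
  exists2 N : C, N != 0 &
    forall x : nat -> C, \det (Ymx d x) = N * (x d - eval1 y x).

Definition Y (C : numClosedFieldType) (d : nat) : mpoly d.-1 C :=
  if (d <= 1)%N then 0 else xget 0 [set y | Y_spec y].

Lemma det_Ymx_last (C : numClosedFieldType) (d : nat) :
  exists2 N : C, N != 0 &
    forall x : nat -> C,
      \det (Ymx d.+1 x) =
      N * x d.+1 + \det (Ymx d.+1 (fun k => if k == d.+1 then 0 else x k)).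
Proof.
have bumpE (i : 'I_d) : bump d i = i by rewrite /bump leqNgt ltn_ord.
pose M (x : nat -> C) : 'M_d := row' ord_max (col' ord0 (Ymx d.+1 x)).
have ME x i j : M x i j = if (j < i)%N then x (i - j.+1).+1
    else if j == i then 2%:R * i.+1%:R * (i.+1%:R - d.+1%:R) else 0.
  by rewrite !mxE /= bumpE /bump /= add1n eqSS.
have detM x :
    \det (M x) = \prod_(i < d) (2%:R * i.+1%:R * (i.+1%:R - d.+1%:R)).
  rewrite det_trig; last first.
    by apply/is_trig_mxP => i j ij; rewrite ME ltnNge (ltnW ij) -val_eqE /= gtn_eqF.
  by apply: eq_bigr => i _; rewrite ME ltnn eqxx.
exists ((-1) ^+ d * \prod_(i < d) (2%:R * i.+1%:R * (i.+1%:R - d.+1%:R)) : C).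
  rewrite mulf_neq0 ?signr_eq0//; apply/prodf_neq0 => i _.
  rewrite !mulf_neq0 ?pnatr_eq0// subr_eq0 eqr_nat eqSS.
  by rewrite ltn_eqF.
move=> x; pose x' k := if k == d.+1 then 0 else x k.
rewrite -/x' !(expand_det_row _ ord_max) !big_ord_recl.
have cofE j : cofactor (Ymx d.+1 x) ord_max j = cofactor (Ymx d.+1 x') ord_max j.
  rewrite /cofactor; congr (_ * \det _); apply/matrixP => i k; rewrite !mxE.
  case: ifP => // ki; rewrite /x' ifN//= eqSS ltn_eqF//.
  apply: leq_ltn_trans (leq_subr _ _) _.
  by rewrite bumpE.
rewrite addrA; congr (_ + _); last first.
  apply: eq_bigr => j _; rewrite cofE; congr (_ * _); rewrite !mxE /=.
  rewrite /bump add1n ltn_ord /x' ifN// eqSS ltn_eqF//.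
  by rewrite ltn_subrL/= (leq_ltn_trans _ (ltn_ord j)).
rewrite -cofE !mxE /= subn0 /x' eqxx mul0r addr0.
by rewrite /cofactor addn0 detM mulrC.
Qed.

Lemma Y_spec_ex (C : numClosedFieldType) (d : nat) :
  (0 < d)%N -> exists y : mpoly d.-1 C, Y_spec y.
Proof.
case: d => [|d] // _; have [N N0 detE] := det_Ymx_last C d.
pose X k : mpoly d C :=
  if insub k.-1 is Some i then mpolyX C (mnm1 i) else 0.
exists (- N^-1 *: \det (Ymx d.+1 X)); exists N => // x.
rewrite detE mulrBr; congr (_ + _).
rewrite /eval1 mevalZ mulrA mulrN mulfV// mulN1r opprK -det_map_mx.
congr (\det _); apply/matrixP => i j; rewrite !mxE.
case: ifP => [ji|_]; last first.
  case: ifP => _; last by rewrite raddf0.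
  by rewrite !rmorphM rmorphB !rmorph_nat.
rewrite /X /= eqSS; case: insubP => [k kd kE|].
  by rewrite mevalXU kE ltn_eqF.
rewrite -leqNgt raddf0 => le_d; rewrite ifT// eqn_leq le_d andbT.
by rewrite (leq_trans (leq_subr _ _)) -1?ltnS.
Qed.

Lemma Y_spec_inj (C : numClosedFieldType) (d : nat) (y1 y2 : mpoly d.-1 C) :
  (0 < d)%N -> Y_spec y1 -> Y_spec y2 -> eval1 y1 =1 eval1 y2.
Proof.
case: d y1 y2 => [|d] // y1 y2 _ [N1 N10 H1] [N2 N20 H2] x.
pose x' c k := if k == d.+1 then c else x k.
have ev y c : eval1 y (x' c) = eval1 (d := d.+1) y x.
  by apply: meval_eq => i /=; rewrite /x' eqSS ltn_eqF.
have e c : N1 * (c - eval1 y1 x) = N2 * (c - eval1 y2 x).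
  by have := H2 (x' c); rewrite H1 !ev /x' eqxx.
have := e (eval1 y1 x); rewrite subrr mulr0 => /esym/eqP.
by rewrite mulf_eq0 (negPf N20) subr_eq0 => /eqP.
Qed.

Lemma Y_specP (C : numClosedFieldType) (d : nat) : (1 < d)%N -> Y_spec (Y C d).
Proof.
move=> d1; rewrite /Y leqNgt d1; case: xgetP => [y _ //|none].
by have [y /none] := Y_spec_ex C (ltnW d1).
Qed.

(* w ^+ 2 * phi = (1 - d ^+ 2) / 2 + a 1 * w + a 2 * w ^+ 2 + ... with
   a d = Y_d (a 1, ..., a d.-1), in the coordinate w at p. *)
Definition star (C : numClosedFieldType) (phi : C -> C) (p : sphere C)
    (d : nat) : Prop :=
  exists a : nat -> C,
    [/\ laurent (qd_local phi p) (- 2%:Z) a,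
        a 0%N = (1 - d%:R ^+ 2) / 2%:R
      & a d = eval1 (Y C d) a].

(* Main.v *)
Require Import Defs.
From HB Require Import structures.
From mathcomp Require Import all_boot all_order all_algebra.
From mathcomp Require Import boolp classical_sets reals.
From mathcomp Require Import topology normedtype.
From mathcomp Require Import complex sequences derive.
From mathcomp.multinomials Require mpoly.
Import -(notations) mathcomp.multinomials.mpoly.
From mathcomp Require Import zify ring lra.

Set Implicit Arguments.
Unset Strict Implicit.
Unset Printing Implicit Defensive.
Import Order.TTheory GRing.Theory Num.Theory.
Import numFieldNormedType.Exports.
Local Open Scope classical_set_scope.
Local Open Scope ring_scope.

(** At a point where phi has leading coefficient (1 - d ^ 2) / 2 and at most a
    double pole, the equation u'' + (phi / 2) u = 0 has the exponents (1 - d) / 2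
    and (1 + d) / 2. They differ by the integer d, so a solution of the smaller
    exponent involves a logarithm unless the recurrence for its coefficients can
    be solved at step d. The equations up to that step form a linear system
    whose matrix is the one in the definition of [Y_d]; therefore
    a_d = Y_d (a_1, ..., a_(d-1)) says precisely that there is no logarithm
    ([det_Ymx_eq0]). On the other hand f has Schwarzian derivative phi exactly
    when f is a quotient of two solutions, and without logarithms such a
    quotient is meromorphic of local degree d.

    Direction (a). For f = P / Q with Wronskian W, the Schwarzian derivative is
    a polynomial [schw P Q] divided by 2 W ^ 2, and Q / sqrt W is a solution of
    the equation. At a point sent to 0 with multiplicity d, W is the (d - 1)-st
    power of the coordinate times a unit, hence this solution has the exponent
    (1 - d) / 2 and no logarithm ([schw_expansion]). Other values of f are moved
    to 0 by a Moebius map and infinity is treated by reversing polynomials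
    ([schwarz_local]).

    Direction (b). By compactness and a maximum principle
    ([vanishing_at_infinity]) phi = A / beta ^ 2, where beta has the poles as
    simple roots and A is a polynomial ([rational_form]). Multiplication by a
    product of powers of the z - c, with the exponents (1 - d_c) / 2, turns the
    equation into one with polynomial coefficients, [gop]. It maps polynomials
    of degree at most m to polynomials of degree at most m + 2 N - 2, where N is
    the number of finite poles. Each pole imposes two linear conditions on the
    image: the exponent is a root of the indicial equation ([fuchs_coef0]), and
    the residue pairing with a log-free local solution vanishes, because the
    equation is self-adjoint ([fuchs_residue]). The conditions are independent
    for large m, so there are two independent polynomial solutions
    ([two_polynomial_solutions]), and their quotient has Schwarzian phi
    ([gop_schw]). No condition is available at an exceptional pole in the plane;
    there the exponent is adjusted so that infinity, which is either a good
    pole or regular, supplies the two missing conditions. Finally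
    [schwarz_local], applied to the quotient, yields the form of phi at every
    pole, the exceptional one included, and identifies local degrees. *)

(** * Formal power series *)

Section PowerSeries.
Variable F : numFieldType.

Record fps := Fps { fcoef : nat -> F }.
HB.instance Definition _ := [isNew for fcoef].
HB.instance Definition _ := [Equality of fps by <:].
HB.instance Definition _ := [Choice of fps by <:].

Lemma fpsP (f g : fps) : (forall n, fcoef f n = fcoef g n) -> f = g.
Proof. by case: f g => [f] [g] /= fg; congr Fps; apply/funext. Qed.

Definition fadd (f g : fps) := Fps (fun n => fcoef f n + fcoef g n).
Definition fopp (f : fps) := Fps (fun n => - fcoef f n).
Definition fzero := Fps (fun=> 0).
Definition fone := Fps (fun n => (n == 0%N)%:R).
Definition fmul (f g : fps) :=
  Fps (fun n => \sum_(i < n.+1) fcoef f i * fcoef g (n - i)).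

Fact faddA : associative fadd.
Proof. by move=> f g h; apply: fpsP => n /=; rewrite addrA. Qed.
Fact faddC : commutative fadd.
Proof. by move=> f g; apply: fpsP => n /=; rewrite addrC. Qed.
Fact fadd0 : left_id fzero fadd.
Proof. by move=> f; apply: fpsP => n /=; rewrite add0r. Qed.
Fact faddN : left_inverse fzero fopp fadd.
Proof. by move=> f; apply: fpsP => n /=; rewrite addNr. Qed.

HB.instance Definition _ := GRing.isZmodule.Build fps faddA faddC fadd0 faddN.

Definition ftrunc n (f : fps) : {poly F} := \poly_(i < n) fcoef f i.

Lemma coef_ftrunc n (f : fps) i : (i < n)%N -> (ftrunc n f)`_i = fcoef f i.
Proof. by move=> i_n; rewrite coef_poly i_n. Qed.

(** Reduces the ring laws of power series to those of polynomials. *)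
Lemma fmul_trunc n i (f g : fps) :
  (i < n)%N -> fcoef (fmul f g) i = (ftrunc n f * ftrunc n g)`_i.
Proof.
move=> i_n; rewrite coefM /=; apply: eq_bigr => j _.
rewrite !coef_ftrunc //; first exact: leq_ltn_trans (leq_subr _ _) i_n.
by apply: leq_ltn_trans i_n; rewrite -ltnS.
Qed.

Fact fmulC : commutative fmul.
Proof.
move=> f g; apply: fpsP => n; rewrite (@fmul_trunc n.+1) //.
by rewrite (@fmul_trunc n.+1 n g) // mulrC.
Qed.
Fact fmulA : associative fmul.
Proof.
have E f g n : fcoef (fmul f g) n = \sum_(i < n.+1) fcoef f i * fcoef g (n - i).
  by [].
move=> f g h; apply: fpsP => n.
transitivity ((ftrunc n.+1 f * (ftrunc n.+1 g * ftrunc n.+1 h))`_n).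
  rewrite E coefM; apply: eq_bigr => j _.
  by rewrite coef_ftrunc // (@fmul_trunc n.+1) // ltnS leq_subr.
rewrite mulrA E coefM; apply: eq_bigr => j _.
by rewrite [X in _ * X]coef_ftrunc ?ltnS ?leq_subr // (@fmul_trunc n.+1).
Qed.
Fact fmul1 : left_id fone fmul.
Proof.
move=> f; apply: fpsP => n /=; rewrite big_ord_recl /= subn0 mul1r.
by rewrite big1 ?addr0 // => i _; rewrite mul0r.
Qed.
Fact fmulD : left_distributive fmul fadd.
Proof.
move=> f g h; apply: fpsP => n /=; rewrite -big_split /=.
by apply: eq_bigr => i _; rewrite mulrDl.
Qed.
Fact fone_neq0 : fone != fzero.
Proof.
apply/eqP => /(congr1 (fun f => fcoef f 0%N)) /= /eqP.
by rewrite oner_eq0.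
Qed.

HB.instance Definition _ :=
  GRing.Zmodule_isComNzRing.Build fps fmulA fmulC fmul1 fmulD fone_neq0.

Lemma fcoefD (f g : fps) n : fcoef (f + g) n = fcoef f n + fcoef g n.
Proof. by []. Qed.
Lemma fcoefN (f : fps) n : fcoef (- f) n = - fcoef f n.
Proof. by []. Qed.
Lemma fcoefB (f g : fps) n : fcoef (f - g) n = fcoef f n - fcoef g n.
Proof. by []. Qed.
Lemma fcoefM (f g : fps) n :
  fcoef (f * g) n = \sum_(i < n.+1) fcoef f i * fcoef g (n - i).
Proof. by []. Qed.
Lemma fcoefMn (f : fps) k n : fcoef (f *+ k) n = fcoef f n *+ k.
Proof. by elim: k => [|k IH] //; rewrite !mulrS fcoefD IH. Qed.
Lemma fcoefM0 (f g : fps) : fcoef (f * g) 0%N = fcoef f 0%N * fcoef g 0%N.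
Proof. by rewrite fcoefM big_ord1. Qed.

Definition fpoly (p : {poly F}) : fps := Fps (fun n => p`_n).

Fact fpoly_is_additive : additive fpoly.
Proof. by move=> p q; apply: fpsP => n; rewrite /= coefB. Qed.
Fact fpoly_is_monoid : monoid_morphism fpoly.
Proof.
split=> [|p q]; first by apply: fpsP => n; rewrite /= coef1.
by apply: fpsP => n; rewrite /= coefM.
Qed.
HB.instance Definition _ :=
  GRing.isAdditive.Build {poly F} fps fpoly fpoly_is_additive.
HB.instance Definition _ :=
  GRing.isMonoidMorphism.Build {poly F} fps fpoly fpoly_is_monoid.

Lemma fcoef_poly p n : fcoef (fpoly p) n = p`_n. Proof. by []. Qed.

Lemma fpoly_inj : injective fpoly.
Proof.
move=> p q pq; apply/polyP => i.
exact: (congr1 (fun f => fcoef f i) pq).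
Qed.

Definition fvar := fpoly 'X.
Definition fconst c := fpoly c%:P.

Lemma fcoef_const c n : fcoef (fconst c) n = if n == 0%N then c else 0.
Proof. by rewrite /= coefC. Qed.

Lemma fcoefCM c f n : fcoef (fconst c * f) n = c * fcoef f n.
Proof.
rewrite fcoefM big_ord_recl /= coefC eqxx subn0 big1 ?addr0 // => i _.
by rewrite coefC /= mul0r.
Qed.

Lemma fcoefXM f n : fcoef (fvar * f) n = if n is n'.+1 then fcoef f n' else 0.
Proof.
rewrite fcoefM; case: n => [|n]; first by rewrite big_ord1 /= coefX mul0r.
rewrite 2!big_ord_recl /= !coefX /= mul0r add0r mul1r subSS subn0.
by rewrite big1 ?addr0 // => i _; rewrite coefX /= mul0r.
Qed.

Lemma fcoefXnM f k n :
  fcoef (fvar ^+ k * f) n = if (n < k)%N then 0 else fcoef f (n - k).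
Proof.
elim: k n => [|k IH] n; first by rewrite mul1r subn0.
by rewrite exprS -mulrA fcoefXM; case: n => [|n]; rewrite // IH ltnS subSS.
Qed.

Lemma fvarXn_inj k : injective (fun f : fps => fvar ^+ k * f).
Proof.
move=> f g fg; apply: fpsP => n.
have := congr1 (fun f => fcoef f (n + k)) fg.
by rewrite !fcoefXnM ltnNge leq_addl /= addnK.
Qed.

Definition fD (f : fps) : fps := Fps (fun n => fcoef f n.+1 *+ n.+1).

Lemma fcoef_D f n : fcoef (fD f) n = fcoef f n.+1 *+ n.+1. Proof. by []. Qed.

Lemma fD_poly p : fD (fpoly p) = fpoly p^`().
Proof. by apply: fpsP => n; rewrite fcoef_D !fcoef_poly coef_deriv. Qed.

Lemma fD_add f g : fD (f + g) = fD f + fD g.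
Proof. by apply: fpsP => n; rewrite !(fcoef_D, fcoefD) mulrnDl. Qed.

Lemma fD_opp f : fD (- f) = - fD f.
Proof. by apply: fpsP => n; rewrite !(fcoef_D, fcoefN) mulNrn. Qed.

Lemma fD_mul f g : fD (f * g) = fD f * g + f * fD g.
Proof.
apply: fpsP => n; pose N := n.+2.
have E (u : fps) i : (i <= n)%N -> fcoef (fD u) i = ((ftrunc N u)^`())`_i.
  by move=> i_n; rewrite coef_deriv coef_ftrunc.
rewrite fcoef_D (@fmul_trunc N) // -coef_deriv derivM coefD fcoefD.
rewrite !fcoefM !coefM; congr (_ + _); apply: eq_bigr => i _.
  rewrite (E f) ?leq_ord // coef_ftrunc //.
  exact: leq_ltn_trans (leq_subr _ _) (ltnW _).
rewrite (E g) ?leq_subr // coef_ftrunc //.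
exact: leq_trans (ltn_ord i) (leqnSn _).
Qed.

Lemma fD_const c : fD (fconst c) = 0.
Proof. by rewrite fD_poly derivC raddf0. Qed.
Lemma fD_var : fD fvar = 1.
Proof. by rewrite fD_poly derivX rmorph1. Qed.
Lemma fD_nat n : fD n%:R = 0.
Proof. by rewrite -(rmorph_nat fpoly) fD_poly -polyC_natr derivC raddf0. Qed.

Lemma rec_seq (Phi : nat -> (nat -> F) -> F) :
  (forall n u v, (forall k, (k < n)%N -> u k = v k) -> Phi n u = Phi n v) ->
  exists a : nat -> F, forall n, a n = Phi n a.
Proof.
move=> loc.
pose B := fix B n := if n is n'.+1 then rcons (B n') (Phi n' (nth 0 (B n')))
                     else [::].
have sB n : size (B n) = n by elim: n => //= n IH; rewrite size_rcons IH.
pose a n := Phi n (nth 0 (B n)).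
exists a => n; apply: loc; elim: n => [|n IH] k //.
rewrite ltnS leq_eqVlt => /predU1P[->|k_n] /=; rewrite nth_rcons sB.
  by rewrite ltnn eqxx.
by rewrite k_n; exact: IH.
Qed.

Lemma finv_ex f : fcoef f 0%N != 0 -> exists g, f * g = 1.
Proof.
move=> f0.
have [|a aE] := @rec_seq (fun n u => (fcoef f 0%N)^-1 *
  ((n == 0%N)%:R - \sum_(i < n) fcoef f i.+1 * u (n - i.+1)%N)).
  move=> n u v uv; congr (_ * (_ - _)); apply: eq_bigr => i _.
  by rewrite uv //; have := ltn_ord i; lia.
exists (Fps a); apply: fpsP => n; rewrite fcoefM big_ord_recl /= subn0 aE.
by rewrite mulVKf // subrK.
Qed.

Lemma finv0 f g : f * g = 1 -> fcoef (g ^+ 2) 0%N != 0.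
Proof.
move=> fg; have := congr1 (fun u => fcoef u 0%N) fg.
rewrite fcoefM0 expr2 fcoefM0 => fg0; apply/eqP => /eqP; rewrite mulf_eq0 orbb.
by move=> /eqP g0; move: fg0 => /eqP; rewrite g0 mulr0 eq_sym oner_eq0.
Qed.

(** [h] is the exponential of a primitive of [p]; it is the integrating factor
    that removes the regular part of a first-order coefficient. *)
Lemma exp_ode p : exists2 h, fcoef h 0%N = 1 & fD h = p * h.
Proof.
have [|a aE] := @rec_seq (fun n u => if n is n'.+1 then
  n%:R^-1 * \sum_(i < n) fcoef p i * u (n' - i)%N else 1).
  move=> [|n] u v uv //; congr (_ * _); apply: eq_bigr => i _.
  by rewrite uv //; lia.
exists (Fps a); first exact: (aE 0%N).
apply: fpsP => n; rewrite fcoef_D /= aE -[LHS]mulr_natl mulVKf //.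
by rewrite pnatr_eq0.
Qed.

End PowerSeries.
Arguments fD {F} f : simpl never.
Arguments fpoly {F} p : simpl never.
Arguments fvar F : simpl never.
Arguments fconst {F} c : simpl never.

(** * The Fuchsian operator at a singular point *)

Lemma fconst_indicial (F : numFieldType) (c : F) :
  2%:R * fconst c * (1 - fconst c) = fconst (2%:R * c * (1 - c)).
Proof.
by rewrite /fconst !(polyCM, polyCB, rmorphM, rmorphB, rmorph1, rmorph_nat).
Qed.

Section Indicial.
Variables (F : numFieldType) (d : nat).
Local Notation t := (fvar F).
Local Notation D := (@fD F).

(** The smaller of the two exponents of u'' + (phi / 2) u = 0 at a point where
    phi has leading coefficient (1 - d ^ 2) / 2; the larger one is [hexp + d]. *)
Definition hexp : F := (1 - d%:R) / 2%:R.
Local Notation e := (fconst hexp).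

Lemma hexpE : 2%:R * hexp = 1 - d%:R.
Proof. by rewrite mulrC divfK // pnatr_eq0. Qed.

(** For phi = a / t ^ 2 and u = t ^ hexp * V, this is the series W such that
    2 t ^ 2 (u'' + (phi / 2) u) = t ^ hexp * W. *)
Definition fuchs (a V : fps F) : fps F :=
  2%:R * t ^+ 2 * D (D V) + 4%:R * e * t * D V + (a - 2%:R * e * (1 - e)) * V.

Lemma fcoef_nat n (f : fps F) k : fcoef (n%:R * f) k = n%:R * fcoef f k.
Proof. by rewrite mulr_natl fcoefMn mulr_natl. Qed.

Lemma fcoef_fuchs (a V : fps F) k :
  fcoef a 0%N = (1 - d%:R ^+ 2) / 2%:R ->
  fcoef (fuchs a V) k = 2%:R * k%:R * (k%:R - d%:R) * fcoef V k
    + \sum_(i < k) fcoef a i.+1 * fcoef V (k - i.+1).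
Proof.
move=> a0; have aV : fcoef (a * V) k = (1 - d%:R ^+ 2) / 2%:R * fcoef V k
    + \sum_(i < k) fcoef a i.+1 * fcoef V (k - i.+1).
  by rewrite fcoefM big_ord_recl subn0 a0.
have eE := fconst_indicial hexp.
have t2E : fcoef (2%:R * t ^+ 2 * D (D V)) k
    = 2%:R * (k%:R * (k%:R - 1) * fcoef V k).
  rewrite -mulrA fcoef_nat fcoefXnM; congr (_ * _).
  case: k {aV} => [|[|k]] /=; rewrite ?mul0r ?subrr ?mulr0 ?mul0r //.
  by rewrite subn2 /= -mulrnA -[LHS]mulr_natl natrM -[X in X - 1]natr1 addrK.
have t1E : fcoef (4%:R * e * t * D V) k = 4%:R * (hexp * (k%:R * fcoef V k)).
  rewrite -(mulrA (4%:R * e)) -(mulrA 4%:R) fcoef_nat fcoefCM fcoefXM.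
  congr (_ * (_ * _)); case: k {aV t2E} => [|k]; first by rewrite mul0r.
  by rewrite fcoef_D mulr_natl.
rewrite /fuchs !fcoefD t2E t1E mulrBl fcoefB aV eE fcoefCM {t2E t1E aV eE}.
set S := \sum_(i < k) _.
have -> : d%:R = 1 - 2%:R * hexp :> F by rewrite hexpE; ring.
have n2 : (2%:R : F) != 0 by rewrite pnatr_eq0.
by field.
Qed.

(** The recurrence [fcoef_fuchs] multiplies the coefficient [V_k] by
    2 k (k - d), so [V_d] drops out of the equation of order [d]. The equations
    of orders 1, ..., d are thus a square system in [V_0, ..., V_(d-1)], and its
    matrix is the one that defines [Y_d]. *)
Lemma Ymx_row (a V : fps F) (i : 'I_d) :
  fcoef a 0%N = (1 - d%:R ^+ 2) / 2%:R ->
  \sum_(j < d) Ymx d (fcoef a) i j * fcoef V j = fcoef (fuchs a V) i.+1.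
Proof.
move=> a0; rewrite fcoef_fuchs //.
have -> : \sum_(j < i.+1) fcoef a j.+1 * fcoef V (i.+1 - j.+1) =
    \sum_(j < d | (j <= i)%N) fcoef a (i - j).+1 * fcoef V j.
  rewrite [RHS](eq_bigl (fun j : 'I_d => (j < i.+1)%N)); last first.
    by move=> j; rewrite ltnS.
  rewrite -(big_ord_widen d (fun j => fcoef a (i - j).+1 * fcoef V j)) //.
  rewrite (reindex_inj rev_ord_inj); apply: eq_bigr => j _ /=.
  by congr (fcoef a _ * fcoef V _); have := ltn_ord j; lia.
rewrite (bigID (fun j : 'I_d => (j <= i)%N)) /= addrC; congr (_ + _); last first.
  by apply: eq_bigr => j ji; rewrite mxE ji.
have [id|id] := ltnP i.+1 d; last first.
  have -> : i.+1 = d by have := ltn_ord i; lia.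
  rewrite subrr mulr0 mul0r big1 // => j ji.
  by have := ltn_ord j; lia.
rewrite (bigD1 (Ordinal id)) /= ?ltnn // mxE /= ltnn eqxx big1 ?addr0 //.
move=> j /andP[ij]; rewrite -val_eqE /= => /negPf ji.
by rewrite mxE (negPf ij) ji mul0r.
Qed.

Lemma fuchs_coef0 (a V : fps F) :
  fcoef a 0%N = (1 - d%:R ^+ 2) / 2%:R -> fcoef (fuchs a V) 0%N = 0.
Proof. by move=> a0; rewrite fcoef_fuchs // big_ord0 mulr0 !mul0r addr0. Qed.

(** A kernel vector starts with a nonzero entry, because the superdiagonal
    2 k (k - d) has no zero for 0 < k < d and the vector is determined by its
    first entry. Hence the determinant is the only obstruction to a solution
    of exponent [hexp] without logarithm. *)
Lemma det_Ymx_eq0 (a : fps F) : (0 < d)%N ->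
  fcoef a 0%N = (1 - d%:R ^+ 2) / 2%:R ->
  \det (Ymx d (fcoef a)) = 0 <->
  exists2 V : fps F, fcoef V 0%N != 0 &
    forall k, (k <= d)%N -> fcoef (fuchs a V) k = 0.
Proof.
move=> d0 a0; rewrite -det_tr; split=> [/eqP/det0P[v v0 vY]|[V V0 TV]].
- pose V := Fps (fun k => if insub k is Some i then v 0 i else 0).
  have VE (j : 'I_d) : fcoef V j = v 0 j by rewrite /= valK.
  have TV k : (k <= d)%N -> fcoef (fuchs a V) k = 0.
    case: k => [|k] kd; first exact: fuchs_coef0.
    rewrite -(Ymx_row _ (Ordinal kd)) //.
    have /matrixP/(_ 0 (Ordinal kd)) := vY; rewrite !mxE => vk.
    rewrite -[RHS]vk.
    by apply: eq_bigr => j _; rewrite VE [X in _ = _ * X]mxE mulrC.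
  exists V => //; apply: contra v0 => /eqP V0; apply/eqP/rowP => i; rewrite mxE.
  suff V0k k : (k < d)%N -> fcoef V k = 0 by rewrite -VE V0k.
  elim/ltn_ind: k => -[//|k] IH kd.
  have /eqP := TV k.+1 (ltnW kd); rewrite fcoef_fuchs // big1 ?addr0.
    rewrite !mulf_eq0 !pnatr_eq0 /= subr_eq0 eqr_nat ltn_eqF //=.
    by move/eqP.
  by move=> j _; rewrite IH ?mulr0 //; have := ltn_ord j; lia.
- apply/eqP/det0P; exists (\row_i fcoef V i).
    apply/eqP => /rowP/(_ (Ordinal d0)); rewrite !mxE /= => V00.
    by rewrite V00 eqxx in V0.
  apply/rowP => i; rewrite !mxE.
  apply: etrans (TV i.+1 (ltn_ord i)); rewrite -Ymx_row //.
  by apply: eq_bigr => j _; rewrite !mxE mulrC.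
Qed.

(** With G = V W' - W V', the difference of the two products is
    2 t ^ 2 G' + 2 (1 - d) t G = 2 t ^ (d + 1) (t ^ (1 - d) G)', and a derivative
    of a Laurent series has no residue. *)
Lemma fuchs_selfadjoint (a V W : fps F) : (0 < d)%N ->
  fcoef (V * fuchs a W) d = fcoef (W * fuchs a V) d.
Proof.
move=> d0; apply/eqP; rewrite -subr_eq0 -fcoefB; apply/eqP.
pose G := V * D W - W * D V.
have -> : V * fuchs a W - W * fuchs a V =
    2%:R * (t ^+ 2 * D G) + 4%:R * (e * (t * G)).
  by rewrite /G /fuchs fD_add fD_opp !fD_mul; ring.
rewrite fcoefD !fcoef_nat fcoefCM fcoefXnM fcoefXM.
have n2 : (2%:R : F) != 0 by rewrite pnatr_eq0.
rewrite /hexp; case: d d0 => [|[|k]] //= _; first by field.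
rewrite subn2 /= -[_ *+ k.+1]mulr_natl -[k.+2%:R]natr1; by field.
Qed.

(** The condition that a log-free solution [V] imposes on the image of
    [fuchs]: besides the vanishing of the constant term ([fuchs_coef0]), this
    is the second linear condition that each singular point contributes. *)
Lemma fuchs_residue (a V W : fps F) : (0 < d)%N ->
  (forall k, (k <= d)%N -> fcoef (fuchs a V) k = 0) ->
  fcoef (V * fuchs a W) d = 0.
Proof.
move=> d0 TV; rewrite fuchs_selfadjoint // fcoefM big1 // => i _.
by rewrite TV ?mulr0 // leq_subr.
Qed.

(** A logarithmic derivative [pi] that is regular at the point changes the
    unknown by a unit and leaves the exponents alone. *)
Lemma fuchs_gauge (a h pi v : fps F) : D h = pi * h ->
  fuchs a (h * v) = h * (2%:R * t ^+ 2 * D (D v)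
    + 4%:R * t * (e + t * pi) * D v
    + (a - 2%:R * e * (1 - e) + 2%:R * t ^+ 2 * (D pi + pi ^+ 2)
       + 4%:R * e * t * pi) * v).
Proof.
by move=> hE; rewrite /fuchs !(fD_mul, fD_add) hE !fD_mul hE; ring.
Qed.
End Indicial.

Section GlobalOperator.
Variable (F : numFieldType).

(** For phi = A / beta ^ 2 and u = v * exp (integral of sigma / beta), this is
    2 beta ^ 2 (u'' + (phi / 2) u) divided by the exponential. The operator is
    stated over any ring with a map [D], to be used for polynomials and for
    their local expansions alike. *)
Definition gop (S : comNzRingType) (D : S -> S) (beta sigma A v : S) : S :=
  2%:R * beta ^+ 2 * D (D v) + 4%:R * beta * sigma * D v
  + (A + 2%:R * (D sigma * beta - sigma * D beta + sigma ^+ 2)) * v.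

Local Notation t := (fvar F).
Local Notation D := (@fD F).

(** At a finite zero of beta, sigma / beta has residue [hexp F d] and the
    regular part [pi] is absorbed by [h]. *)
Lemma gop_finite d (a bc pi h v : fps F) :
  D h = pi * h ->
  h * gop D (t * bc) (bc * (fconst (hexp F d) + t * pi)) (bc ^+ 2 * a) v =
  bc ^+ 2 * fuchs d a (h * v).
Proof.
move=> hE; rewrite (fuchs_gauge _ _ _ hE) /gop !(fD_mul, fD_add) fD_var fD_const.
ring.
Qed.

(** The derivation of z read in the coordinate w = 1 / z on polynomials of
    degree at most m: if v is w ^ m f (1 / w), then [rdiff m v] is
    w ^ m f' (1 / w). *)
Definition rdiff m (v : fps F) := m%:R * t * v - t ^+ 2 * D v.

(** The coordinate w = 1 / z turns u into w ^ (-1) times a solution for the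
    transformed differential; together with the factor w ^ m of the reversed
    polynomial this shifts the exponent and explains why the residues of
    sigma / beta must add up to 1 - m - hexp. *)
Lemma gop_infty d m N (a b pi h v : fps F) :
  D h = pi * h ->
  let s := t * (b * (1 - m%:R - fconst (hexp F d) - t * pi)) in
  h * (2%:R * b ^+ 2 * rdiff m (rdiff m v) + 4%:R * b * s * rdiff m v
    + (t ^+ 2 * (b ^+ 2 * a)
       + 2%:R * (rdiff N s * b - s * rdiff N b + s ^+ 2)) * v) =
  t ^+ 2 * b ^+ 2 * fuchs d a (h * v).
Proof.
move=> hE s; rewrite (fuchs_gauge _ _ _ hE) /s /rdiff.
rewrite !(fD_mul, fD_add, fD_opp, fD_nat, fD_var, fD_const).
have D1 : D 1 = 0 := fD_nat F 1.
rewrite ?D1; ring.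
Qed.
End GlobalOperator.

(** * A dimension count *)

Section Kernel.
Variable F : fieldType.

Lemma linear_sum (V W : lmodType F) (f : V -> W) n (c : 'I_n -> F)
    (p : 'I_n -> V) :
  (forall k u v, f (k *: u + v) = k *: f u + f v) ->
  f (\sum_i c i *: p i) = \sum_i c i *: f (p i).
Proof.
move=> lin; have f0 : f 0 = 0.
  by have := lin (-1) 0 0; rewrite scaleN1r oppr0 addr0 scaleN1r addNr.
by apply: (big_ind2 (fun u v => f u = v)) => // [u1 _ u2 _ <- <-|i _];
  [rewrite -{1}(scale1r u1) lin scale1r
  |rewrite -[_ *: p i]addr0 lin f0 addr0].
Qed.

Lemma poly_sum n (p : {poly F}) : (size p <= n)%N ->
  p = \sum_(i < n) p`_i *: 'X^i.
Proof.
move=> pn; rewrite -poly_def; apply/polyP => i; rewrite coef_poly.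
by case: ltnP => // ni; rewrite nth_default // (leq_trans pn).
Qed.

(** The image of the polynomials of size at most [n] lies in the common kernel
    of #|J| independent functionals, so its dimension is at most M - #|J|, and
    at least two dimensions remain for the kernel of [L]. *)
Lemma kernel_dim2 (n M : nat) (J : finType) (L : {poly F} -> {poly F})
    (lam : J -> {poly F} -> F) :
  (forall k u v, L (k *: u + v) = k *: L u + L v) ->
  (forall j k u v, lam j (k *: u + v) = k * lam j u + lam j v) ->
  (forall v : {poly F}, (size v <= n)%N -> (size (L v) <= M)%N) ->
  (forall (v : {poly F}) j, (size v <= n)%N -> lam j (L v) = 0) ->
  (forall c : J -> F,
     (forall g : {poly F}, (size g <= M)%N -> \sum_j c j * lam j g = 0) ->
     forall j, c j = 0) ->
  (M + 2 <= n + #|J|)%N ->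
  exists v1 v2 : {poly F}, [/\ L v1 = 0, L v2 = 0 &
    forall c1 c2, c1 *: v1 + c2 *: v2 = 0 -> c1 = 0 /\ c2 = 0].
Proof.
move=> linL linlam sL lamL indep le_n.
pose A : 'M[F]_(n, M) := \matrix_(i < n, k < M) (L 'X^i)`_k.
pose B : 'M[F]_(M, #|J|) := \matrix_(k < M, j < #|J|) lam (enum_val j) 'X^k.
have lamE j (g : {poly F}) : (size g <= M)%N -> lam j g = \sum_(k < M) g`_k * lam j 'X^k.
  move=> gM; rewrite [in LHS](poly_sum gM).
  exact: (@linear_sum {poly F} F^o (lam j)).
have sX (i : 'I_n) : (size ('X^i : {poly F}) <= n)%N by rewrite size_polyXn.
have AB : A *m B = 0.
  apply/matrixP => i j; rewrite !mxE -[RHS](lamL _ (enum_val j) (sX i)).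
  by rewrite (lamE _ _ (sL _ (sX i))); apply: eq_bigr => k _; rewrite !mxE.
have rB : \rank B = #|J|.
  rewrite -mxrank_tr; apply/eqP/inj_row_free => u uB; apply/rowP => j.
  rewrite mxE -[j]enum_valK; pose c x := u 0 (enum_rank x).
  apply: (indep c) => g gM; under eq_bigr do rewrite lamE // mulr_sumr.
  rewrite exchange_big big1 // => k _; have /rowP/(_ k) := uB; rewrite !mxE.
  move=> uBk.
  under eq_bigr do rewrite mulrCA; rewrite -mulr_sumr.
  suff -> : \sum_i c i * lam i 'X^k = 0 by rewrite mulr0.
  rewrite -[RHS]uBk (reindex _ (onW_bij _ (@enum_val_bij J))) /=.
  by apply: eq_bigr => i _; rewrite /c enum_valK !mxE.
have := mulmx0_rank_max AB; rewrite rB => rA.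
have rK : (1 < \rank (kermx A))%N by rewrite mxrank_ker; lia.
pose K := row_base (kermx A).
pose i0 : 'I_(\rank (kermx A)) := Ordinal (ltnW rK).
pose i1 : 'I_(\rank (kermx A)) := Ordinal rK.
have LK i : L (rVpoly (row i K)) = 0.
  have KA : row i K *m A = 0.
    by apply/sub_kermxP; rewrite (submx_trans (row_sub _ _)) // eq_row_base.
  have sV : (size (rVpoly (row i K)) <= n)%N by apply: size_poly.
  rewrite (poly_sum sV) linear_sum //; apply/polyP => k; rewrite coef0 coef_sum.
  have [kM|kM] := ltnP k M; last first.
    rewrite big1 // => j _; rewrite coefZ [(L _)`_k]nth_default ?mulr0 //.
    exact: leq_trans (sL _ (sX j)) kM.
  have /rowP/(_ (Ordinal kM)) := KA; rewrite !mxE => e; apply: etrans e.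
  by apply: eq_bigr => j _; rewrite coefZ coef_rVpoly_ord !mxE.
exists (rVpoly (row i0 K)), (rVpoly (row i1 K)); split=> // c1 c2 c0.
pose u : 'rV[F]_(\rank (kermx A)) := c1 *: delta_mx 0 i0 + c2 *: delta_mx 0 i1.
have uK : u *m K = 0 *m K.
  rewrite mul0mx mulmxDl -!scalemxAl -!rowE.
  apply: (can_inj rVpolyK); rewrite raddf0 -c0 raddfD /=.
  by rewrite !linearZ.
have := row_free_inj (row_base_free _) uK => /rowP u0.
move: (u0 i0) (u0 i1); rewrite !mxE !eqxx /= !mulr1 !mulr0 addr0 add0r.
by move=> -> ->.
Qed.

End Kernel.

(** * Expansions of polynomials at a point and at infinity *)

Section Expansions.
Variable F : numFieldType.
Implicit Types (p q : {poly F}) (c w : F).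

Lemma poly_eq_nonzero p q :
  (forall w, w != 0 -> p.[w] = q.[w]) -> p = q.
Proof.
move=> pq; apply/eqP; rewrite -subr_eq0; apply/negPn/negP => r0.
pose rs : seq F := [seq i.+1%:R | i <- iota 0 (size (p - q))].
suff : (size rs < size (p - q)%R)%N by rewrite size_map size_iota ltnn.
apply: max_poly_roots => //.
  apply/allP => _ /mapP[i _ ->]; rewrite /root hornerD hornerN pq ?subrr //.
  by rewrite pnatr_eq0.
by rewrite map_inj_uniq ?iota_uniq // => i j /eqP; rewrite eqr_nat => /eqP[].
Qed.

(** The Taylor expansion at [c]. *)
Definition atp c (p : {poly F}) : fps F := fpoly (p \Po ('X + c%:P)).

Fact atp_is_additive c : additive (atp c).
Proof. by move=> p q; rewrite /atp !rmorphB. Qed.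
Fact atp_is_monoid c : monoid_morphism (atp c).
Proof. by split=> [|p q]; rewrite /atp ?rmorph1 ?rmorphM. Qed.
HB.instance Definition _ c :=
  GRing.isAdditive.Build {poly F} (fps F) (atp c) (atp_is_additive c).
HB.instance Definition _ c :=
  GRing.isMonoidMorphism.Build {poly F} (fps F) (atp c) (atp_is_monoid c).

Lemma atpC c k : atp c k%:P = fconst k.
Proof. by rewrite /atp comp_polyC. Qed.
Lemma atpZ c k p : atp c (k *: p) = fconst k * atp c p.
Proof. by rewrite -mul_polyC rmorphM /= atpC. Qed.
Lemma atp_sub c : atp c ('X - c%:P) = fvar F.
Proof. by rewrite /atp rmorphB /= comp_polyX comp_polyC addrK. Qed.
Lemma fcoef_atp0 c p : fcoef (atp c p) 0%N = p.[c].
Proof. by rewrite fcoef_poly -horner_coef0 horner_comp !hornerE. Qed.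
Lemma fD_atp c p : fD (atp c p) = atp c p^`().
Proof. by rewrite /atp fD_poly deriv_comp derivD derivX derivC addr0 mulr1. Qed.

(** The numerator of [p] at infinity for polynomials of degree at most [n];
    unlike a plain reversal it does not depend on the actual degree, and hence
    is linear in [p]. *)
Definition polyrev n p : {poly F} := \poly_(i < n.+1) p`_(n - i).

Lemma coef_rev n p i : (polyrev n p)`_i = if (i <= n)%N then p`_(n - i) else 0.
Proof. by rewrite coef_poly ltnS. Qed.

Lemma revD n p q : polyrev n (p + q) = polyrev n p + polyrev n q.
Proof.
by apply/polyP => i; rewrite coefD !coef_rev; case: ifP; rewrite ?coefD ?addr0.
Qed.
Lemma revZ n k p : polyrev n (k *: p) = k *: polyrev n p.
Proof.
by apply/polyP => i; rewrite coefZ !coef_rev; case: ifP; rewrite ?coefZ ?mulr0.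
Qed.
Lemma revN n p : polyrev n (- p) = - polyrev n p.
Proof. by rewrite -scaleN1r revZ scaleN1r. Qed.

Lemma horner_rev n p w : (size p <= n.+1)%N -> w != 0 ->
  (polyrev n p).[w] = w ^+ n * p.[w^-1].
Proof.
move=> pn w0; rewrite horner_poly (horner_coef_wide _ pn) mulr_sumr.
rewrite (reindex_inj rev_ord_inj) /=; apply: eq_bigr => i _.
have i_n : (i <= n)%N by rewrite -ltnS.
rewrite subSS subKn // mulrCA exprVn; congr (_ * _).
by rewrite -[in w ^+ n](subnK i_n) exprD mulfK // expf_neq0.
Qed.

Lemma revM n m p q : (size p <= n.+1)%N -> (size q <= m.+1)%N ->
  polyrev (n + m) (p * q) = polyrev n p * polyrev m q.
Proof.
move=> pn qm; apply: poly_eq_nonzero => w w0; rewrite hornerM !horner_rev //.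
  by rewrite hornerM exprD; ring.
by have := size_polyMleq p q; lia.
Qed.

Lemma rev_shift n k p : (size p <= n.+1)%N -> polyrev (k + n) p = 'X^k * polyrev n p.
Proof.
move=> pn; apply: poly_eq_nonzero => w w0.
rewrite hornerM !horner_rev ?hornerXn ?exprD ?mulrA //.
by rewrite (leq_trans pn) // ltnS leq_addl.
Qed.

Lemma rev_deriv n p : (size p <= n.+1)%N ->
  fpoly (polyrev n p^`()) = rdiff n (fpoly (polyrev n p)).
Proof.
move=> pn; have pE i : (n < i)%N -> p`_i = 0.
  by move=> ni; rewrite nth_default // (leq_trans pn).
apply: fpsP => i; rewrite /rdiff fcoefB -mulrA fcoef_nat fcoefXM fcoefXnM.
rewrite fcoef_poly coef_rev coef_deriv; case: i => [|i] /=.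
  by rewrite pE ?subn0 // mul0rn mulr0 subr0.
rewrite ?fcoef_poly coef_rev; case: i => [|i] /=.
  rewrite subr0 subn0 subnS subn0.
  by case: n {pn pE} => [|n]; rewrite ?mul0r // mulr_natl.
rewrite subn2 /= coef_rev subnS /=.
case: (ltngtP i.+1 n) => ni; last 1 first.
- by rewrite -ni mulr_natl subrr.
- rewrite prednK ?subn_gt0 // -[_ *+ i.+1]mulr_natl.
  by rewrite -mulrBl -natrB ?(ltnW ni) // mulr_natl.
- by rewrite mul0rn mulr0 subrr.
Qed.

Lemma fps_shift (f : fps F) : fcoef f 0%N = 0 -> exists g, f = fvar F * g.
Proof.
move=> f0; exists (Fps (fun n => fcoef f n.+1)); apply: fpsP => n.
by rewrite fcoefXM; case: n.
Qed.

End Expansions.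

(** * Polynomial solutions of the global equation *)

Lemma atp_subX_mul (F : numFieldType) (c : F) n (q : {poly F}) :
  atp c (('X - c%:P) ^+ n * q) = fvar F ^+ n * atp c q.
Proof. by rewrite rmorphM rmorphXn /= atp_sub. Qed.

Lemma atp_gop (F : numFieldType) c (b s A v : {poly F}) :
  atp c (gop (@deriv F) b s A v) =
  gop (@fD F) (atp c b) (atp c s) (atp c A) (atp c v).
Proof.
rewrite /gop !(rmorph_nat, rmorphXn, rmorphB, rmorphM, rmorphD) /= -!fD_atp.
ring.
Qed.

Lemma fpoly_rev_gop (F : numFieldType) N m (b s A v : {poly F}) :
  (size b <= N.+1)%N -> (size s <= N.+1)%N -> (size A <= (N + N).+1)%N ->
  (size v <= m.+1)%N ->
  let r n p := fpoly (polyrev n p) in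
  r (N + N + m)%N (gop (@deriv F) b s A v) =
  2%:R * r N b ^+ 2 * rdiff m (rdiff m (r m v))
    + 4%:R * r N b * r N s * rdiff m (r m v)
    + (r (N + N)%N A
       + 2%:R * (rdiff N (r N s) * r N b - r N s * rdiff N (r N b) + r N s ^+ 2))
      * r m v.
Proof.
move=> bN sN AN vm r; rewrite /r.
have sd (p : {poly F}) i : (size p <= i.+1 -> size p^`() <= i.+1)%N.
  move=> pi'; apply/leq_sizeP => k ik; rewrite coef_deriv nth_default ?mul0rn //.
  by rewrite (leq_trans pi') // ltnW.
have revnat (k n : nat) (p : {poly F}) : polyrev n (k%:R * p) = k%:R * polyrev n p.
  by rewrite -!polyC_natr !mul_polyC revZ.
have sM (p q : {poly F}) i j : (size p <= i.+1 -> size q <= j.+1 ->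
    size (p * q)%R <= (i + j).+1)%N.
  by move=> p1 q1; have := size_polyMleq p q; lia.
have sM2 (p q : {poly F}) : (size p <= N.+1 -> size q <= N.+1 ->
    size (p * q)%R <= (N + N).+1)%N by exact: sM.
have sD (p q : {poly F}) k : (size p <= k -> size q <= k -> size (p + q)%R <= k)%N.
  by move=> pk qk; rewrite (leq_trans (size_polyD _ _)) // geq_max pk.
have r3 (p q u : {poly F}) : (size p <= N.+1)%N -> (size q <= N.+1)%N ->
    (size u <= m.+1)%N -> polyrev (N + N + m) (p * (q * u)) =
    polyrev N p * polyrev N q * polyrev m u.
  by move=> pN qN um; rewrite mulrA !revM // sM2.
have sX : (size (s^`() * b - s * b^`() + s * s)%R <= (N + N).+1)%N.
  by apply: (sD); rewrite ?sM2 //; apply: (sD); rewrite ?size_polyN sM2 // sd.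
have sB : (size (A + 2%:R * (s^`() * b - s * b^`() + s * s))%R <= (N + N).+1)%N.
  by apply: (sD) => //; rewrite mulr_natl mulr2n; apply: (sD).
rewrite -!rev_deriv ?sd // /gop -!mulrA !revD !revnat !expr2.
rewrite !r3 ?sd // revM // revD revnat 2!revD revN !revM ?sd //.
rewrite !(rmorph_nat, rmorphB, rmorphM, rmorphD) /=; ring.
Qed.

Section Solve.
Variables (F : numFieldType) (s : seq F) (dd : F -> nat) (e : option F).
Variable A : {poly F}.

Definition beta : {poly F} := \prod_(c <- s) ('X - c%:P).
Definition betac c : {poly F} := \prod_(c' <- s | c' != c) ('X - c'%:P).
Local Notation N := (size s).

Hypothesis us : uniq s.
Hypothesis N0 : (0 < N)%N.
Hypothesis d0 : forall c, c \in s -> (0 < dd c)%N.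
Hypothesis sA : (size A <= 2 * N - 1)%N.

(** The condition of the theorem on the Laurent coefficients, with the
    determinant in place of [Y_d] so that it makes sense over any field. *)
Definition star_series (a : fps F) d :=
  fcoef a 0%N = (1 - d%:R ^+ 2) / 2%:R /\ \det (Ymx d (fcoef a)) = 0.

Hypothesis okF : forall c, c \in s -> Some c != e ->
  exists2 a : fps F, atp c A = atp c (betac c) ^+ 2 * a & star_series a (dd c).
Hypothesis okI : forall c, c \in s -> Some c = e ->
  exists2 a : fps F, fpoly (polyrev (2 * N - 2) A) = fpoly (polyrev N beta) ^+ 2 * a
    & star_series a (dd c).

(** The degree at which all singular points can be interpolated to the orders
    in use; [m] bounds the degree of the unknown and [M] that of its image. *)
Let D := (\sum_(c <- s) (dd c).+1)%N.
Let m := (2 * D + 3)%N.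
Let M := (m + 2 * N - 2)%N.

(** The residues of sigma / beta. At a pole they are the exponents, except at
    the pole [e] where nothing is known about the logarithm: there the residue
    is what is left when the behaviour at infinity is prescribed by
    [gop_infty]. Thus infinity takes the place of the exceptional pole. *)
Let kk c := if Some c == e
  then 1 - m%:R - hexp F (dd c) - \sum_(c' <- s | Some c' != e) hexp F (dd c')
  else hexp F (dd c).

Let sigma : {poly F} := \sum_(c <- s) kk c *: betac c.
Let op (v : {poly F}) : {poly F} := gop (@deriv F) beta sigma A v.
(** Expansions at the place attached to [c]: infinity stands in for [e]. *)
Let ev c (g : {poly F}) : fps F :=
  if Some c == e then fpoly (polyrev M g) else atp c g.

Lemma beta_split c : c \in s -> beta = ('X - c%:P) * betac c.
Proof. by move=> cs; rewrite /beta (bigD1_seq c cs us). Qed.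

Lemma betac_root c c' : c \in s -> c != c' -> (betac c').[c] = 0.
Proof.
move=> cs cc'; rewrite horner_prod; apply/eqP; rewrite prodf_seq_eq0; apply/hasP; exists c => //.
by rewrite cc' hornerXsubC subrr eqxx.
Qed.

Lemma betac_neq0 c : (betac c).[c] != 0.
Proof.
rewrite horner_prod prodf_seq_neq0; apply/allP => c' _; apply/implyP => cc'.
by rewrite hornerXsubC subr_eq0 eq_sym.
Qed.

Lemma size_beta : size beta = N.+1.
Proof. exact: size_prod_XsubC. Qed.

Lemma monic_beta : beta \is monic.
Proof. exact: monic_prod_XsubC. Qed.

Lemma betac_monic c : betac c \is monic.
Proof. by apply: monic_prod => i _; exact: monicXsubC. Qed.

Lemma size_betac c : c \in s -> size (betac c) = N.
Proof.
move=> cs; have := size_beta; rewrite (beta_split cs) size_monicM ?monicXsubC //.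
  by rewrite size_XsubC; lia.
exact: monic_neq0 (betac_monic c).
Qed.

Lemma size_sigma : (size sigma <= N)%N.
Proof.
rewrite /sigma big_seq; apply: (big_ind (fun p : {poly F} => size p <= N)%N).
- by rewrite size_poly0.
- by move=> p q pN qN; rewrite (leq_trans (size_polyD _ _)) // geq_max pN.
- by move=> c cs; rewrite (leq_trans (size_scale_leq _ _)) ?size_betac.
Qed.

Lemma size_op (v : {poly F}) : (size v <= m.+1)%N -> (size (op v) <= M.+1)%N.
Proof.
move=> vm; have sb := size_beta; have ss := size_sigma.
have sD (p q : {poly F}) k : (size p <= k -> size q <= k -> size (p + q)%R <= k)%N.
  by move=> pk qk; rewrite (leq_trans (size_polyD _ _)) // geq_max pk.
have sM (p q : {poly F}) i j : (size p <= i -> size q <= j.+1 ->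
    size (p * q)%R <= i + j)%N.
  by move=> pi qj; have := size_polyMleq p q; lia.
have sN (p : {poly F}) i k : (size p <= i -> size (k%:R * p)%R <= i)%N.
  move=> pi; rewrite mulr_natl; elim: k => [|k IH]; first by rewrite size_poly0.
  by rewrite mulrS; exact: sD.
have sd (p : {poly F}) i : (size p <= i.+1 -> size p^`() <= i)%N.
  move=> pi; apply/leq_sizeP => k ik; rewrite coef_deriv nth_default ?mul0rn //.
  by rewrite (leq_trans pi).
have [n NE] : exists n, N = n.+1 by exists N.-1; rewrite prednK.
have -> : M.+1 = (n + n + m.+1)%N by rewrite /M NE; lia.
rewrite NE in sb ss.
have {}sb : (size beta <= n.+2)%N by rewrite sb.
have [k mE] : exists k, m = k.+3 by exists (2 * D)%N; rewrite /m; lia.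
rewrite mE; rewrite mE in vm.
have sv1 := sd _ _ vm; have sv2 := sd _ _ sv1.
have sAn : (size A <= n + n.+1)%N by rewrite (leq_trans sA) // NE; lia.
have s2 (p q : {poly F}) : (size p <= n.+1 -> size q <= n.+2 ->
    size (p * q)%R <= n.+1 + n.+1)%N by exact: sM.
rewrite /op /gop; apply: (sD _ _ _ (sD _ _ _ _ _)).
- apply: leq_trans (_ : n.+2 + n.+1 + k.+1 <= _)%N; last lia.
  by apply: (sM) => //; apply: (sN); rewrite expr2; apply: sM.
- apply: leq_trans (_ : n.+2 + n + k.+2 <= _)%N; last lia.
  by apply: (sM) => //; apply: (sM) => //; apply: sN.
- apply: leq_trans (_ : n + n.+1 + k.+3 <= _)%N; last lia.
  apply: (sM) => //; apply: (sD) => //; apply: (sN); apply: (sD); first apply: (sD).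
  + apply: leq_trans (sM _ _ n n.+1 _ sb) _; last lia.
    exact: sd.
  + rewrite size_polyN; apply: leq_trans (sM _ _ n.+1 n ss _) _; last lia.
    exact: sd.
  + rewrite expr2; apply: leq_trans (sM _ _ n.+1 n ss _) _; last lia.
    exact: ss.
Qed.

(** The unit [u] is, up to the change of unknown, the log-free local solution
    [V]; pairing with it detects the two conditions satisfied by the image. *)
Lemma local_finite c : c \in s -> Some c != e -> exists2 u : fps F,
  fcoef u 0%N != 0 & forall v : {poly F},
    fcoef (u * atp c (op v)) 0%N = 0 /\ fcoef (u * atp c (op v)) (dd c) = 0.
Proof.
move=> cs ce; have [a aE [a0 /det_Ymx_eq0 detY]] := okF cs ce.
have [V V0 TV] := detY (d0 cs) a0.
pose bc := atp c (betac c).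
have [binv bK] : exists g, bc * g = 1.
  by apply: finv_ex; rewrite fcoef_atp0 betac_neq0.
have [tau tauE] : exists tau, \sum_(c' <- s | c' != c) kk c' *: betac c'
    = tau * ('X - c%:P).
  apply/factor_theorem; rewrite /root horner_sum big1_seq // => c' /andP[c'c _].
  by rewrite hornerZ betac_root ?mulr0 // eq_sym.
pose pi := atp c tau * binv.
have sE : atp c sigma = bc * (fconst (hexp F (dd c)) + fvar F * pi).
  rewrite /sigma (bigD1_seq c cs us) /= tauE rmorphD rmorphM /= atp_sub atpZ.
  rewrite {1}/kk (negPf ce) /pi -/bc -[atp c tau]mulr1 -{1}bK; ring.
have bE : atp c beta = fvar F * bc by rewrite (beta_split cs) rmorphM /= atp_sub.
have [h h0 hE] := exp_ode pi.
exists (V * h * binv ^+ 2).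
  by rewrite !fcoefM0 h0 mulr1 mulf_neq0 // -fcoefM0 -expr2 (finv0 bK).
move=> v; have -> : V * h * binv ^+ 2 * atp c (op v) =
    V * fuchs (dd c) a (h * atp c v).
  have := gop_finite (dd c) a bc (atp c v) hE.
  rewrite -sE -bE -aE -atp_gop -/(op v) => E.
  transitivity (V * binv ^+ 2 * (h * atp c (op v))); first by ring.
  by rewrite E -[RHS]mul1r -(expr1n _ 2) -bK; ring.
by rewrite fcoefM0 fuchs_coef0 // mulr0 fuchs_residue // d0.
Qed.

Lemma coef_sigma_top : sigma`_(N.-1) = \sum_(c <- s) kk c.
Proof.
rewrite /sigma coef_sum big_seq [RHS]big_seq; apply: eq_bigr => c cs.
have := betac_monic c; rewrite monicE lead_coefE (size_betac cs) => /eqP b1.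
by rewrite coefZ b1 mulr1.
Qed.

(** The analogue of [local_finite] for reversed polynomials: the choice of
    [kk] at the exceptional pole makes the exponent at infinity equal to
    [hexp F (dd c)]. *)
Lemma local_infty c : c \in s -> Some c = e -> exists2 u : fps F,
  fcoef u 0%N != 0 & forall v : {poly F}, (size v <= m.+1)%N ->
    fcoef (u * fpoly (polyrev M (op v))) 0%N = 0 /\
    fcoef (u * fpoly (polyrev M (op v))) (dd c) = 0.
Proof.
move=> cs ce; have [a aE [a0 /det_Ymx_eq0 detY]] := okI cs ce.
have [V V0 TV] := detY (d0 cs) a0.
pose b := fpoly (polyrev N beta).
have b0 : fcoef b 0%N = 1.
  rewrite /b fcoef_poly coef_rev subn0 /=.
  by have := monic_beta; rewrite monicE lead_coefE size_beta => /eqP.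
have [binv bK] : exists g, b * g = 1 by apply: finv_ex; rewrite b0 oner_eq0.
have [S SE] : exists S, fpoly (polyrev N sigma) = fvar F * S.
  apply: fps_shift; rewrite fcoef_poly coef_rev subn0 /= nth_default //.
  exact: size_sigma.
have S0 : fcoef S 0%N = 1 - m%:R - hexp F (dd c).
  have := congr1 (fun f => fcoef f 1%N) SE; rewrite fcoefXM /= => <-.
  rewrite coef_rev N0 subn1 coef_sigma_top (bigD1_seq c cs us) /=.
  rewrite {1}/kk ce eqxx [X in _ + X](eq_bigr (fun c => hexp F (dd c))).
    rewrite -ce (eq_bigl (fun c' => c' != c)) ?subrK //.
  by move=> c' c'c; rewrite /kk -ce ifF //; apply/negbTE.
have [g gE] : exists g, S * binv - fconst (1 - m%:R - hexp F (dd c)) = fvar F * g.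
  apply: fps_shift; rewrite fcoefB fcoefM0 S0 fcoef_const eqxx.
  have := congr1 (fun f => fcoef f 0%N) bK; rewrite fcoefM0 b0 mul1r => ->.
  by rewrite mulr1 subrr.
pose pi := - g.
have cE : fconst (1 - m%:R - hexp F (dd c)) = 1 - m%:R - fconst (hexp F (dd c)).
  by rewrite /fconst !polyCB polyC1 polyC_natr !rmorphB rmorph1 rmorph_nat.
have sE : fpoly (polyrev N sigma) =
    fvar F * (b * (1 - m%:R - fconst (hexp F (dd c)) - fvar F * pi)).
  by rewrite SE -cE /pi mulrN opprK -gE addrC subrK (mulrCA b) bK mulr1.
have [h h0 hE] := exp_ode pi.
exists (V * h * binv ^+ 2).
  by rewrite !fcoefM0 h0 mulr1 mulf_neq0 // -fcoefM0 -expr2 (finv0 bK).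
move=> v vm; set G := fpoly (polyrev M (op v)).
have sb : (size beta <= N.+1)%N by rewrite size_beta.
have ss : (size sigma <= N.+1)%N := leq_trans size_sigma (leqnSn _).
have revop : fvar F ^+ 2 * G = fpoly (polyrev (N + N + m) (op v)).
  have -> : (N + N + m = 2 + M)%N by rewrite /M; lia.
  by rewrite rev_shift ?size_op // rmorphM rmorphXn.
have -> : V * h * binv ^+ 2 * G = V * fuchs (dd c) a (h * fpoly (polyrev m v)).
  apply: (@fvarXn_inj F 2).
  have := gop_infty (dd c) m N a b (fpoly (polyrev m v)) hE.
  rewrite /= -sE => E.
  have {}E : h * fpoly (polyrev (N + N + m) (op v)) =
      fvar F ^+ 2 * b ^+ 2 * fuchs (dd c) a (h * fpoly (polyrev m v)).
    rewrite -E; congr (h * _).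
    have AE : fvar F ^+ 2 * (b ^+ 2 * a) = fpoly (polyrev (N + N) A).
      rewrite -aE; have -> : (N + N = 2 + (2 * N - 2))%N by lia.
      by rewrite rev_shift ?rmorphM ?rmorphXn // (leq_trans sA) //; lia.
    by rewrite AE fpoly_rev_gop // (leq_trans sA) //; lia.
  transitivity (V * binv ^+ 2 * (h * (fvar F ^+ 2 * G))); first by ring.
  rewrite revop E -[in RHS](mul1r (V * _)) -(expr1n _ 2) -bK; ring.
by rewrite fcoefM0 fuchs_coef0 // mulr0 fuchs_residue // d0.
Qed.

Lemma ev_linear c k p q : ev c (k *: p + q) = fconst k * ev c p + ev c q.
Proof.
rewrite /ev; case: ifP => _; last by rewrite rmorphD /= atpZ.
by rewrite revD revZ rmorphD /= -mul_polyC rmorphM.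
Qed.

Lemma le_D c : c \in s -> (dd c < D)%N.
Proof. by move=> cs; rewrite /D (bigD1_seq c cs us) leq_addr. Qed.

(** Vanishes to high order at every finite place other than that of [c]. *)
Let G c : {poly F} := \prod_(c' <- s | (c' != c) && (Some c' != e))
  ('X - c'%:P) ^+ (dd c').+1.

Lemma size_G c : c \in s -> (size (G c) + dd c <= D)%N.
Proof.
move=> cs; rewrite /D (bigD1_seq c cs us) /=.
have GD : (size (G c) <=
    (\sum_(c' <- s | (c' != c) && (Some c' != e)) (dd c').+1).+1)%N.
  apply: (big_ind2 (fun (p : {poly F}) n => size p <= n.+1)%N).
  - by rewrite size_poly1.
  - move=> p n q k pn qk; apply: leq_trans (size_polyMleq _ _) _.
    by move: pn qk; rewrite /=; lia.
  - by move=> c' _; rewrite size_exp_XsubC.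
apply: leq_trans (leq_add GD (leqnn _)) _; rewrite addSn -addnS addnC leq_add2l.
by rewrite big_mkcondr; apply: leq_sum => c' _; case: ifP.
Qed.

Lemma G_split c c' : c' \in s -> c' != c -> Some c' != e ->
  exists q, G c = ('X - c'%:P) ^+ (dd c').+1 * q.
Proof.
move=> cs cc' ce; rewrite /G (big_rem c') //= cc' ce /=.
by eexists.
Qed.

Lemma G_root c : (G c).[c] != 0.
Proof.
rewrite horner_prod prodf_seq_neq0; apply/allP => c' _; apply/implyP.
case/andP=> cc' _; rewrite horner_exp expf_neq0 // hornerXsubC subr_eq0.
by rewrite eq_sym.
Qed.

Lemma G_monic c : G c \is monic.
Proof. by apply: monic_prod => i _; rewrite monic_exp ?monicXsubC. Qed.

Lemma ev_vanish c q : c \in s -> Some c != e ->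
  forall k, (k <= dd c)%N -> fcoef (ev c (('X - c%:P) ^+ (dd c).+1 * q)) k = 0.
Proof.
move=> cs ce k kd; rewrite /ev (negPf ce) atp_subX_mul.
by rewrite fcoefXnM ltnS kd.
Qed.

(** A polynomial that vanishes to the relevant orders at all places but one,
    where its expansion starts at order 0 or [dd c]: these polynomials separate the functionals of
    [two_polynomial_solutions]. *)
Lemma witness c (b : bool) : c \in s -> exists g : {poly F},
  let k := if b then dd c else 0%N in
  [/\ (size g <= M.+1)%N,
      forall c', c' \in s -> c' != c ->
        forall k, (k <= dd c')%N -> fcoef (ev c' g) k = 0,
      forall j, (j < k)%N -> fcoef (ev c g) j = 0
    & fcoef (ev c g) k != 0].
Proof.
move=> cs; pose k := if b then dd c else 0%N; rewrite -/k.
have kd : (k <= dd c)%N by rewrite /k; case: (b).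
have sG := size_G cs; have G0 := monic_neq0 (G_monic c).
have sG0 : (0 < size (G c))%N by rewrite size_poly_gt0.
have vanish q c' : c' \in s -> c' != c -> Some c' != e ->
    forall k, (k <= dd c')%N -> fcoef (ev c' (G c * q)) k = 0.
  move=> c's c'c c'e; have [q' ->] := G_split c's c'c c'e.
  by rewrite -mulrA; exact: ev_vanish.
have [ce|ce] := eqVneq (Some c) e.
  pose g := G c * 'X^(M - k - (size (G c)).-1).
  have gm : g \is monic by rewrite monicMl ?monicXn // G_monic.
  have sg : size g = (M - k).+1.
    rewrite size_monicM ?G_monic ?monic_neq0 ?monicXn // size_polyXn /M /m; lia.
  have evE : ev c g = fpoly (polyrev M g) by rewrite /ev ce eqxx.
  have kM : (k <= M)%N by rewrite /M /m; lia.
  exists g; split.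
  - by rewrite sg; lia.
  - move=> c' c's c'c; apply: vanish => //; rewrite -ce; apply: contra c'c.
    by move=> /eqP[->].
  - move=> j jk; rewrite evE fcoef_poly coef_rev; case: ifP => // _.
    by rewrite nth_default // sg; lia.
  - rewrite evE fcoef_poly coef_rev kM; move: gm.
    by rewrite monicE lead_coefE sg => /eqP ->; rewrite oner_eq0.
pose g := G c * ('X - c%:P) ^+ k.
have sg : (size g <= D)%N.
  by rewrite size_monicM ?G_monic ?expf_neq0 ?polyXsubC_eq0 // size_exp_XsubC; lia.
have evE : ev c g = fvar F ^+ k * atp c (G c).
  by rewrite /ev (negPf ce) /g (mulrC (G c)) atp_subX_mul.
exists g; split.
- by rewrite /M /m; lia.
- move=> c' c's c'c; have [c'e|] := eqVneq (Some c') e; last exact: vanish.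
  move=> j jd; rewrite /ev c'e eqxx fcoef_poly coef_rev; case: ifP => // _.
  rewrite nth_default //; have := le_D c's; rewrite /M /m.
  by move=> dD; apply: leq_trans sg _; lia.
- by move=> j jk; rewrite evE fcoefXnM jk.
- by rewrite evE fcoefXnM ltnn subnn fcoef_atp0 G_root.
Qed.

(** The operator raises the degree bound from [m] to m + 2 N - 2, and its image
    satisfies two conditions at each of the N places. The conditions are
    independent, so the kernel has dimension at least
    (m + 1) - (m + 2 N - 1 - 2 N) = 2. *)
Lemma two_polynomial_solutions : exists v1 v2 : {poly F},
  [/\ op v1 = 0, op v2 = 0 &
    forall c1 c2, c1 *: v1 + c2 *: v2 = 0 -> c1 = 0 /\ c2 = 0].
Proof.
pose good c (u : fps F) := c \in s -> fcoef u 0%N != 0 /\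
  forall v : {poly F}, (size v <= m.+1)%N ->
  fcoef (u * ev c (op v)) 0%N = 0 /\ fcoef (u * ev c (op v)) (dd c) = 0.
have /boolp.choice[u uP] : forall c, exists u, good c u.
  move=> c; rewrite /good.
  have [cs|cs] := boolP (c \in s); last by exists 0.
  have [ce|ce] := eqVneq (Some c) e.
    by have [u u0 uP] := local_infty cs ce; exists u => _; rewrite /ev ce eqxx.
  have [u u0 uP] := local_finite cs ce; exists u => _; rewrite /ev (negPf ce).
  by split=> // v _; exact: uP.
pose pt (i : 'I_N) := s`_i.
have pts i : pt i \in s by rewrite mem_nth.
pose ix (j : 'I_N * bool) := if j.2 then dd (pt j.1) else 0%N.
pose lam (j : 'I_N * bool) g := fcoef (u (pt j.1) * ev (pt j.1) g) (ix j).
apply: (@kernel_dim2 F m.+1 M.+1 _ op lam).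
- by move=> k v1 v2; rewrite /op /gop !(derivD, derivZ) -!mul_polyC; ring.
- move=> j k g1 g2; rewrite /lam ev_linear mulrDr fcoefD mulrCA fcoefCM //.
- exact: size_op.
- move=> v [i b] vm; have [_ /(_ v vm)[u0 ud]] := uP _ (pts i).
  by rewrite /lam /ix; case: b.
- move=> cf cf0.
  have vanish i b g : (forall c', c' \in s -> c' != pt i ->
        forall k, (k <= dd c')%N -> fcoef (ev c' g) k = 0) ->
      (size g <= M.+1)%N -> cf (i, ~~ b) * lam (i, ~~ b) g = 0 ->
      lam (i, b) g != 0 -> cf (i, b) = 0.
    move=> gv gM cf' lam0; have := cf0 g gM; rewrite (bigD1 (i, b)) //= big1.
      by rewrite addr0 => /eqP; rewrite mulf_eq0 (negPf lam0) orbF => /eqP.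
    move=> [i' b'] jne; have [ii'|ii'] := eqVneq i' i.
      have -> : (i', b') = (i, ~~ b).
        rewrite ii' in jne *; congr pair; apply/eqP; move: jne.
        by rewrite xpair_eqE eqxx /=; case: b {cf' lam0}; case: b'.
      by [].
    rewrite /lam fcoefM big1 ?mulr0 // => k _; rewrite gv ?mulr0 //=.
      apply: contra ii'; rewrite /pt => /eqP.
      by move/eqP; rewrite nth_uniq.
    by rewrite (leq_trans (leq_subr _ _)) // /ix /=; case: ifP.
  have lamE i b g : (forall j, (j < ix (i, b))%N -> fcoef (ev (pt i) g) j = 0) ->
      lam (i, b) g = fcoef (u (pt i)) 0%N * fcoef (ev (pt i) g) (ix (i, b)).
    move=> g0; rewrite /lam fcoefM big_ord_recl subn0 big1 ?addr0 // => k _.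
    by rewrite g0 ?mulr0 // lift0; have := ltn_ord k; lia.
  have cf1 i : cf (i, true) = 0.
    have [g /= [gM gv gk g0]] := witness true (pts i).
    have [u0 _] := uP _ (pts i).
    apply: (vanish i true g) => //; last by rewrite lamE // mulf_neq0.
    by rewrite lamE // gk ?mulr0 // d0.
  move=> [i [//|]]; have [g /= [gM gv gk g0]] := witness false (pts i).
  have [u0 _] := uP _ (pts i).
  apply: (vanish i false g) => //; last by rewrite lamE // mulf_neq0.
  by rewrite cf1 mul0r.
- by rewrite card_prod card_ord card_bool /M; lia.
Qed.
End Solve.

(** * The Schwarzian derivative of a quotient of polynomials *)

Section Wronskian.
Variable F : numFieldType.
Implicit Types P Q b s A g : {poly F}.

Definition wron P Q := P^`() * Q - P * Q^`().
Definition minor P Q := P^`()^`() * Q^`() - P^`() * Q^`()^`().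
(** The Schwarzian derivative of P / Q is schw P Q / (2 W ^ 2). *)
Definition schw P Q := let W := wron P Q in
  2%:R * W * W^`()^`() - 3%:R * W^`() ^+ 2 + 4%:R * W * minor P Q.

Lemma wron_deriv P Q : (wron P Q)^`() = P^`()^`() * Q - P * Q^`()^`().
Proof. by rewrite /wron !(derivD, derivN, derivM); ring. Qed.

Lemma wron_scale g P Q : wron (g * P) (g * Q) = g ^+ 2 * wron P Q.
Proof. by rewrite /wron !derivM; ring. Qed.

Lemma schw_scale g P Q : schw (g * P) (g * Q) = g ^+ 4 * schw P Q.
Proof.
rewrite /schw /wron /minor !(derivD, derivN, derivM, expr2); ring.
Qed.

Lemma wron_swap P Q : wron Q P = - wron P Q.
Proof. by rewrite /wron; ring. Qed.
Lemma schw_swap P Q : schw Q P = schw P Q.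
Proof. by rewrite /schw wron_swap !derivN /minor; ring. Qed.

Lemma wron_sub c P Q : wron (P - c *: Q) Q = wron P Q.
Proof. by rewrite /wron derivB derivZ -!mul_polyC; ring. Qed.
Lemma schw_sub c P Q : schw (P - c *: Q) Q = schw P Q.
Proof.
by rewrite /schw wron_sub /minor !(derivB, derivZ) -!mul_polyC; ring.
Qed.

(** Two solutions of the same equation have a quotient with Schwarzian
    A / beta ^ 2. The proof eliminates the derivatives of P and Q: the Wronskian
    satisfies the first-order equation beta W' = - 2 sigma W, and the minor is
    proportional to it. *)
Lemma gop_schw b s A P Q : b != 0 ->
  gop (@deriv F) b s A P = 0 -> gop (@deriv F) b s A Q = 0 ->
  b ^+ 2 * schw P Q = 2%:R * A * wron P Q ^+ 2.
Proof.
move=> b0; set R := A + 2%:R * (s^`() * b - s * b^`() + s ^+ 2) => LP LQ.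
set W := wron P Q.
have n2 : (2%:R : {poly F}) != 0 by rewrite -polyC_natr polyC_eq0 pnatr_eq0.
have W1 : b * W^`() = - (2%:R * s * W).
  apply: (mulfI (mulf_neq0 n2 b0)); apply/eqP; rewrite -subr_eq0.
  (* Abel's identity. *)
  have -> : 2%:R * b * (b * W^`()) - 2%:R * b * - (2%:R * s * W) =
      Q * gop (@deriv F) b s A P - P * gop (@deriv F) b s A Q.
    by rewrite wron_deriv /gop -/R /W /wron; ring.
  by rewrite LP LQ !mulr0 subr0.
have W2 : b^`() * W^`() + b * W^`()^`() = - (2%:R * (s^`() * W + s * W^`())).
  have := congr1 (@deriv F) W1; rewrite derivN !derivM -polyC_natr derivC => ->.
  by ring.
have Z : 2%:R * b ^+ 2 * minor P Q = R * W.
  apply/eqP; rewrite -subr_eq0.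
  have -> : 2%:R * b ^+ 2 * minor P Q - R * W =
      Q^`() * gop (@deriv F) b s A P - P^`() * gop (@deriv F) b s A Q.
    by rewrite /gop -/R /minor /W /wron; ring.
  by rewrite LP LQ !mulr0 subr0.
have W2' : b ^+ 2 * W^`()^`() = - (2%:R * b * s^`() * W)
    + 2%:R * (2%:R * s + b^`()) * s * W.
  have -> : b ^+ 2 * W^`()^`() =
    b * (b^`() * W^`() + b * W^`()^`()) - b^`() * (b * W^`()) by ring.
  rewrite W2 W1.
  have -> : b * - (2%:R * (s^`() * W + s * W^`())) =
     - (2%:R * b * s^`() * W) - 2%:R * s * (b * W^`()) by ring.
  rewrite W1; ring.
have -> : b ^+ 2 * schw P Q = 2%:R * W * (b ^+ 2 * W^`()^`())
    - 3%:R * (b * W^`()) ^+ 2 + 2%:R * W * (2%:R * b ^+ 2 * minor P Q).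
  by rewrite /schw -/W; ring.
rewrite W2' W1 Z /R; ring.
Qed.

Lemma deriv_dvdp_eq0 Q : Q %| Q^`() -> Q != 0 -> (size Q <= 1)%N.
Proof.
move=> dQ Q0; have dQ0 : Q^`() = 0.
  apply/eqP/negPn/negP => /dvdp_leq/(_ dQ); rewrite leqNgt => /negP; apply.
  exact: lt_size_deriv.
apply/leq_sizeP => -[|i] // _; have := congr1 (fun p : {poly F} => p`_i) dQ0.
by rewrite coef_deriv coef0 -mulr_natr => /eqP; rewrite mulf_eq0 pnatr_eq0 orbF => /eqP.
Qed.

(** For coprime P and Q, P' Q = P Q' forces Q to divide Q' and P to divide P'. *)
Lemma wron_eq0 P Q : coprimep P Q -> wron P Q = 0 ->
  (size P <= 1)%N /\ (size Q <= 1)%N.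
Proof.
have aux P' Q' : coprimep P' Q' -> wron P' Q' = 0 -> (size Q' <= 1)%N.
  move=> co /eqP; rewrite /wron subr_eq0 => /eqP E.
  have [->|Q0] := eqVneq Q' 0; first by rewrite size_poly0.
  apply: deriv_dvdp_eq0 => //; rewrite -(@Gauss_dvdpr _ _ P').
    by rewrite -E dvdp_mull.
  by rewrite coprimep_sym.
move=> co W0; split; last exact: aux co W0.
apply: (aux Q P); first by rewrite coprimep_sym.
by rewrite wron_swap W0 oppr0.
Qed.

(** The function u = Q / sqrt W solves u'' + (S / 2) u = 0 for the Schwarzian S
    of P / Q. If P vanishes to order d at 0 and Q does not vanish, then W is
    t ^ (d - 1) times a unit, so that u = t ^ hexp * (h Q), where [h] plays the
    role of the inverse square root of the unit. Thus h Q is a log-free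
    solution of exponent [hexp], and [det_Ymx_eq0] applies. *)
Lemma schw_expansion P Q : P.[0] = 0 -> Q.[0] != 0 -> wron P Q != 0 ->
  exists d Ph (a : fps F), [/\ (0 < d)%N, P = 'X^d * Ph, Ph.[0] != 0,
    fpoly (2%:R * wron P Q ^+ 2) * a = fpoly ('X^2 * schw P Q)
    & star_series a d /\ (d = 1%N -> (wron P Q).[0] != 0)].
Proof.
move=> P0 Q0 W0.
have PN0 : P != 0.
  by apply: contra W0 => /eqP ->; rewrite /wron derivC !mul0r subr0.
have [[//|d] [Ph rPh PE]] := multiplicity_XsubC P 0.
  move: rPh P0 PE; rewrite PN0 expr0 mulr1 /root => rPh P0 PE.
  by rewrite -PE P0 eqxx in rPh.
move: rPh PE; rewrite PN0 /root /= subr0 => rPh; rewrite mulrC => PE.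
exists d.+1, Ph.
pose Wh := d.+1%:R * Ph * Q + 'X * wron Ph Q.
have WE : wron P Q = 'X^d * Wh.
  rewrite /wron PE /Wh /wron derivM derivXn exprS /= -mulr_natr; ring.
pose P1h := d.+1%:R * Ph + 'X * Ph^`().
have P1E : P^`() = 'X^d * P1h.
  by rewrite PE derivM derivXn /= /P1h exprS -mulr_natr; ring.
pose Zh := (d%:R * P1h + 'X * P1h^`()) * Q^`() - 'X * P1h * Q^`()^`().
have ZE : 'X * minor P Q = 'X^d * Zh.
  have X2 : 'X * ('X^d)^`() = d%:R * 'X^d :> {poly F}.
    rewrite derivXn -mulr_natl mulrCA -exprS.
    by case: (d) => [|n] //; rewrite mulr0n !mul0r.
  rewrite /minor P1E derivM mulrBr mulrA mulrDr [in LHS]mulrA X2 /Zh; ring.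
have Wh0 : fcoef (fpoly Wh) 0%N != 0.
  rewrite fcoef_poly -horner_coef0 /Wh -polyC_natr !hornerE.
  by rewrite !mulf_neq0 // pnatr_eq0.
have [winv wK] := finv_ex Wh0.
pose t := fvar F; pose e := fconst (hexp F d.+1); pose w := fpoly Wh.
pose half := fconst (2%:R^-1 : F).
have half2 : 2%:R * half = 1.
  rewrite /half /fconst -(rmorph_nat (@fpoly F)) -rmorphM -polyC_natr -polyCM.
  by rewrite divff ?rmorph1 // pnatr_eq0.
(* The logarithmic derivative of the inverse square root of the unit [Wh]. *)
pose pi := - (half * (fpoly Wh^`() * winv)).
have piE : 2%:R * pi * w = - fpoly Wh^`().
  rewrite /pi /w; transitivity (- (2%:R * half) * fpoly Wh^`() * (fpoly Wh * winv)).
    ring.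
  by rewrite half2 wK; ring.
pose z := fpoly Zh * winv.
have zE : z * w = fpoly Zh by rewrite /z -mulrA (mulrC winv) wK mulr1.
have eE : 2%:R * e = - d%:R.
  rewrite /e /fconst -(rmorph_nat (@fpoly F)) -rmorphM -polyC_natr -polyCM hexpE.
  rewrite -[d.+1%:R]natr1 opprD addrCA subrr addr0 polyCN rmorphN /=.
  by rewrite polyC_natr rmorph_nat.
(* The coefficient for which [h * q] below is a solution, read off from
   [fuchs_gauge]. *)
pose a := 2%:R * e * (1 - e) - 4%:R * e * t * pi
  - 2%:R * t ^+ 2 * (fD pi + pi ^+ 2) + 2%:R * t * z.
pose W := fpoly (wron P Q); pose Z := fpoly (minor P Q).
pose k := e + t * pi.
have X2 n : 'X * ('X^n)^`() = n%:R * 'X^n :> {poly F}.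
  rewrite derivXn -mulr_natl mulrCA -exprS.
  by case: n => [|n] //; rewrite mulr0n !mul0r.
have tn : fpoly 'X^d = t ^+ d by rewrite rmorphXn.
have Wtw : W = t ^+ d * w by rewrite /W WE rmorphM /= tn.
have Z1 : t * Z = z * W.
  by rewrite /t /fvar /Z -rmorphM /= ZE rmorphM /= tn -zE Wtw; ring.
(* The Wronskian behaves like t ^ (- 2 e) times the inverse square of [h]. *)
have W1 : t * fD W = - (2%:R * k * W).
  have -> : t * fD W = t ^+ d * (d%:R * w + t * fpoly Wh^`()).
    rewrite /W fD_poly -tn /t /fvar -rmorphM /= WE derivM mulrDr mulrA X2.
    have -> : d%:R * 'X^d * Wh + 'X * ('X^d * Wh^`()) =
      'X^d * (d%:R * Wh + 'X * Wh^`()) by ring.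
    by rewrite rmorphM rmorphD !rmorphM rmorph_nat.
  have -> : fpoly Wh^`() = - (2%:R * pi * w) by rewrite piE opprK.
  have -> : d%:R = - (2%:R * e) by rewrite eE opprK.
  by rewrite Wtw /k; ring.
have W2 : t * fD (fD W) = - (2%:R * fD k * W) - 2%:R * k * fD W - fD W.
  have := congr1 (@fD F) W1; rewrite fD_opp !fD_mul fD_var fD_nat mul1r => E.
  by rewrite -[LHS](addKr (fD W)) E; ring.
have kE : fD k = pi + t * fD pi.
  by rewrite /k fD_add fD_const add0r fD_mul fD_var mul1r.
have aW : fpoly (2%:R * wron P Q ^+ 2) * a = fpoly ('X^2 * schw P Q).
  have -> : fpoly (2%:R * wron P Q ^+ 2) = 2%:R * W ^+ 2.
    by rewrite rmorphM rmorphXn rmorph_nat.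
  have -> : fpoly ('X^2 * schw P Q) = 2%:R * W * (t * (t * fD (fD W)))
      - 3%:R * (t * fD W) ^+ 2 + 4%:R * t * W * (t * Z).
    rewrite /schw /W !fD_poly /Z /t /fvar; set W' := wron P Q.
    rewrite -!(rmorph_nat (@fpoly F)) -!(rmorphXn, rmorphM, rmorphB, rmorphD) /=.
    by congr fpoly; ring.
  rewrite W2.
  have -> : t * (- (2%:R * fD k * W) - 2%:R * k * fD W - fD W) =
    - (2%:R * t * fD k * W) - (2%:R * k + 1) * (t * fD W) by ring.
  by rewrite W1 Z1 kE /a /k; ring.
have [h h0 hE] := exp_ode pi.
pose q := fpoly Q.
have fuchs0 : fuchs d.+1 a (h * q) = 0.
  rewrite (fuchs_gauge _ _ _ hE) -/t -/e; set y := (X in h * X).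
  suff -> : y = 0 by rewrite mulr0.
  have Wy : W * y = 0.
    have -> : W * y = 2%:R * t ^+ 2 * W * fD (fD q)
        + 2%:R * t * (2%:R * k * W) * fD q + 2%:R * t * (z * W) * q.
      by rewrite /y /a /k; ring.
    rewrite -Z1 -[2%:R * k * W]opprK -W1.
    have -> : 2%:R * t ^+ 2 * W * fD (fD q) + 2%:R * t * - (t * fD W) * fD q
        + 2%:R * t * (t * Z) * q =
      2%:R * t ^+ 2 * (W * fD (fD q) - fD W * fD q + Z * q) by ring.
    rewrite /W /q /Z !fD_poly wron_deriv -!rmorphM -rmorphB -rmorphD /=.
    rewrite (_ : _ + _ = 0) ?rmorph0 ?mulr0 // /wron /minor; ring.
  have {Wy} : w * y = 0.
    by apply: (@fvarXn_inj F d); rewrite mulr0 mulrA -/t -Wtw.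
  by move=> wy; rewrite -[y]mul1r -wK (mulrC _ winv) -mulrA wy mulr0.
have V0 : fcoef (h * q) 0%N != 0.
  by rewrite fcoefM0 h0 mul1r fcoef_poly -horner_coef0.
have a0 : fcoef a 0%N = (1 - d.+1%:R ^+ 2) / 2%:R.
  have -> : a = fconst (2%:R * hexp F d.+1 * (1 - hexp F d.+1))
      + t * (2%:R * z - 4%:R * e * pi - 2%:R * t * (fD pi + pi ^+ 2)).
    by rewrite -fconst_indicial /a /e; ring.
  rewrite fcoefD fcoef_const fcoefXM addr0 /hexp.
  have n2 : (2%:R : F) != 0 by rewrite pnatr_eq0.
  by field.
exists a; split=> //; split; last first.
  by move=> [dz]; rewrite WE dz mul1r horner_coef0.
split=> //; apply/det_Ymx_eq0 => //.
by exists (h * q) => // n _; rewrite fuchs0.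
Qed.
End Wronskian.

(** * Convergent power series *)

Section Convergence.
Variable C : numClosedFieldType.
Implicit Types (f g : fps C) (w l : C).

Lemma nbhs_disc (c : C) (P : C -> Prop) :
  (\forall z \near c, P z) <->
  exists2 e : C, 0 < e & forall w, `|w| < e -> P (c + w).
Proof.
split=> [/nbhs_ballP[e /= e0 eP]|[e e0 eP]].
  exists e => // w we; apply: eP; rewrite -ball_normE /=.
  by rewrite opprD addrA subrr add0r normrN.
apply/nbhs_ballP; exists e => // z; rewrite -ball_normE /= => cz.
by rewrite -[z](subrK c) addrC; apply: eP; rewrite distrC.
Qed.

Lemma dnbhs_disc (P : C -> Prop) :
  (\forall w \near (0 : C)^', P w) <->
  exists2 e : C, 0 < e & forall w, w != 0 -> `|w| < e -> P w.
Proof.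
split=> [/nbhs_disc[e e0 eP]|[e e0 eP]].
  by exists e => // w w0 we; rewrite -[w]add0r; apply: eP => //; rewrite add0r.
by apply/nbhs_disc; exists e => // w we; rewrite add0r => w0; apply: eP.
Qed.

Definition psum f w n : C := \sum_(i < n) fcoef f i * w ^+ i.

Definition conv f w l := psum f w @ \oo --> l.

Lemma convE (a : nat -> C) w l :
  (series (fun n => a n * w ^+ n) @ \oo --> l) = conv (Fps a) w l.
Proof.
rewrite /conv (_ : psum _ w = series (fun n => a n * w ^+ n)) //.
by apply/funext => n; rewrite /series /= big_mkord.
Qed.

Lemma psumS f w n : psum f w n.+1 = psum f w n + fcoef f n * w ^+ n.
Proof. by rewrite /psum big_ord_recr. Qed.

Lemma psum_X f w n : psum (fvar C * f) w n.+1 = w * psum f w n.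
Proof.
rewrite /psum big_ord_recl fcoefXM mul0r add0r mulr_sumr.
by apply: eq_bigr => i _; rewrite fcoefXM exprS mulrCA.
Qed.

Lemma conv_unique f w l l' : conv f w l -> conv f w l' -> l = l'.
Proof. by move=> fl fl'; apply: (norm_cvg_unique fl fl'). Qed.

Lemma conv_add f g w l l' :
  conv f w l -> conv g w l' -> conv (f + g) w (l + l').
Proof.
move=> fl gl; rewrite /conv.
rewrite (_ : psum _ _ = (fun n => psum f w n + psum g w n)); first exact: cvgD.
apply/funext => n; rewrite /psum -big_split.
by apply: eq_bigr => i _; rewrite fcoefD mulrDl.
Qed.

Lemma conv_scale f w l c : conv f w l -> conv (fconst c * f) w (c * l).
Proof.
move=> fl; rewrite /conv (_ : psum _ _ = (fun n => c * psum f w n)).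
  by apply: cvgM => //; exact: cvg_cst.
apply/funext => n; rewrite /psum mulr_sumr.
by apply: eq_bigr => i _; rewrite fcoefCM mulrA.
Qed.

Lemma conv_opp f w l : conv f w l -> conv (- f) w (- l).
Proof.
move=> fl; rewrite -[- l]mulN1r (_ : - f = fconst (-1) * f); first exact: conv_scale.
by rewrite /fconst polyCN polyC1 rmorphN rmorph1 mulN1r.
Qed.

Lemma conv_X f w l : conv f w l -> conv (fvar C * f) w (w * l).
Proof.
move=> fl; rewrite /conv -cvg_shiftS.
rewrite (_ : (fun n => _) = (fun n => w * psum f w n)).
  by apply: cvgM => //; exact: cvg_cst.
by apply/funext => n; exact: psum_X.
Qed.

Lemma conv_divX f w l : w != 0 -> conv (fvar C * f) w l -> conv f w (l / w).
Proof.
move=> w0; rewrite /conv -cvg_shiftS => fl.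
rewrite (_ : psum f w = (fun n => psum (fvar C * f) w n.+1 / w)).
  by apply: cvgM => //; exact: cvg_cst.
by apply/funext => n; rewrite psum_X mulrC mulKf.
Qed.

Lemma conv_divXn g w l k : w != 0 ->
  conv (fvar C ^+ k * g) w l -> conv g w (l / w ^+ k).
Proof.
move=> w0; elim: k l => [|k IH] l; first by rewrite mul1r divr1.
rewrite exprS -mulrA => /(conv_divX w0)/IH.
by rewrite exprS invfM mulrA.
Qed.

Lemma conv_zero w : conv 0 w 0.
Proof.
rewrite /conv (_ : psum _ _ = fun=> 0); first exact: cvg_cst.
by apply/funext => n; rewrite /psum big1 // => i _; rewrite mul0r.
Qed.

Lemma conv_polyM (p : {poly C}) f w l :
  conv f w l -> conv (fpoly p * f) w (p.[w] * l).
Proof.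
move=> fl; elim/poly_ind: p => [|p c IH].
  by rewrite rmorph0 horner0 !mul0r; exact: conv_zero.
rewrite hornerMXaddC mulrDl rmorphD rmorphM /= mulrDl.
apply: conv_add; last exact: conv_scale.
by rewrite mulrAC mulrC [p.[w] * w * l]mulrAC [_ * w]mulrC; exact: conv_X.
Qed.

Lemma conv_const_tail f w : (forall n, fcoef f n.+1 * w ^+ n.+1 = 0) ->
  conv f w (fcoef f 0%N).
Proof.
move=> f0; rewrite /conv -cvg_shiftS (_ : (fun n => _) = fun=> fcoef f 0%N).
  exact: cvg_cst.
apply/funext => n; rewrite /psum big_ord_recl mulr1 big1 ?addr0 // => i _.
by rewrite f0.
Qed.

Lemma conv_one w : conv 1 w 1.
Proof. by apply: (@conv_const_tail 1) => n; rewrite mul0r. Qed.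

Lemma conv_poly (p : {poly C}) w : conv (fpoly p) w p.[w].
Proof. by rewrite -[fpoly p]mulr1 -[p.[w]]mulr1; apply/conv_polyM/conv_one. Qed.

Lemma conv_at0 f : conv f 0 (fcoef f 0%N).
Proof. by apply: conv_const_tail => n; rewrite expr0n mulr0. Qed.

(** A positive radius of convergence. *)
Definition geo f := exists M K : C,
  [/\ 0 < M, 0 < K & forall n, `|fcoef f n| <= M * K ^+ n].

Lemma half_sum n : \sum_(i < n) (2%:R^-1 : C) ^+ i <= 2%:R.
Proof.
suff -> : \sum_(i < n) (2%:R^-1 : C) ^+ i = 2%:R - 2%:R * 2%:R^-1 ^+ n.
  by rewrite lerBlDr lerDl mulr_ge0 ?ler0n // exprn_ge0 // invr_ge0 ler0n.
have n2 : (2%:R : C) != 0 by rewrite pnatr_eq0.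
elim: n => [|n IH]; first by rewrite big_ord0 mulr1 subrr.
by rewrite big_ord_recr /= IH exprS; field.
Qed.

Lemma geo_terms f M K w n : 0 < K -> (forall n, `|fcoef f n| <= M * K ^+ n) ->
  `|w| <= (2%:R * K)^-1 -> `|fcoef f n * w ^+ n| <= M * 2%:R^-1 ^+ n.
Proof.
move=> K0 fM wK; rewrite normrM normrX.
apply: le_trans (ler_wpM2r (exprn_ge0 _ (normr_ge0 w)) (fM n)) _.
have M0 : 0 <= M by have := fM 0%N; rewrite mulr1; exact: le_trans.
rewrite -mulrA -exprMn; apply: ler_wpM2l => //.
apply: lerXn2r; rewrite ?nnegrE ?mulr_ge0 ?invr_ge0 ?ler0n ?(ltW K0) //.
apply: le_trans (ler_wpM2l (ltW K0) wK) _.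
by rewrite invfM mulrCA divff ?gt_eqF // mulr1.
Qed.

(** The first-order estimate behind the local bounds below. *)
Lemma conv_near f : geo f -> exists e B : C, [/\ 0 < e, 0 < B &
  forall w l, `|w| <= e -> conv f w l -> `|l - fcoef f 0%N| <= B * `|w|].
Proof.
move=> [M [K [M0 K0 fM]]].
have e0 : 0 < (2%:R * K)^-1 by rewrite invr_gt0 mulr_gt0.
exists (2%:R * K)^-1, (2%:R * M * K); split=> //; first by rewrite !mulr_gt0.
move=> w l wK fl.
have bound n : `|psum f w n.+1 - fcoef f 0%N| <= 2%:R * M * K * `|w|.
  rewrite /psum big_ord_recl mulr1 addrC addKr.
  apply: le_trans (ler_norm_sum _ _ _) _.
  apply: le_trans (_ : \sum_(i < n) M * K * `|w| * 2%:R^-1 ^+ i <= _); last first.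
    have -> : 2%:R * M * K * `|w| = M * K * `|w| * 2%:R by ring.
    by rewrite -mulr_sumr ler_wpM2l ?half_sum ?mulr_ge0 ?(ltW M0) ?(ltW K0).
  apply: ler_sum => i _.
  have := @geo_terms (Fps (fun n => fcoef f n.+1)) (M * K) K w i K0 _ wK.
  rewrite lift0 exprSr mulrA [`|_ * w|]normrM [M * K * _ * _]mulrAC => le1.
  apply: ler_wpM2r => //; apply: le1 => k; apply: le_trans (fM _) _.
  by rewrite exprS mulrA.
apply/ler_addgt0Pr => eps eps0.
have /cvgrPdist_le/(_ _ eps0)[n _ /(_ n.+1 (leqnSn n))] := fl => ln.
rewrite -[l](subrK (psum f w n.+1)) -addrA (le_trans (ler_normD _ _)) //.
by rewrite [leRHS]addrC lerD.
Qed.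

(** The terms of a convergent series are bounded, hence convergence at one
    nonzero point suffices. *)
Lemma conv_geo f w l : w != 0 -> conv f w l -> geo f.
Proof.
move=> w0 fl; have fl' : (fun n => psum f w n.+1) @ \oo --> l by rewrite cvg_shiftS.
have : (fun n => psum f w n.+1 - psum f w n) @ \oo --> l - l by exact: cvgB.
rewrite subrr => /cvgrPdist_le/(_ 1 ltr01)[N _ fN].
exists (1 + \sum_(i < N) `|fcoef f i * w ^+ i|), `|w|^-1; split.
- by rewrite ltr_wpDr ?sumr_ge0.
- by rewrite invr_gt0 normr_gt0.
- move=> n; rewrite exprVn ler_pdivlMr ?exprn_gt0 ?normr_gt0 // -normrX -normrM.
  have [nN|Nn] := ltnP n N.
    rewrite (bigD1 (Ordinal nN)) //= addrCA lerDl addr_ge0 ?sumr_ge0 //.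
  have := fN n Nn; rewrite /= sub0r normrN psumS addrAC subrr add0r => /le_trans; apply.
  by rewrite lerDl sumr_ge0.
Qed.

(** The coefficients obey a linear recurrence with the coefficients of [D],
    which bounds their growth by a geometric progression. *)
Lemma geo_rational (D N : {poly C}) f : D`_0 != 0 ->
  fpoly D * f = fpoly N -> geo f.
Proof.
move=> D0 DN.
pose A : C := \sum_(i < size D) `|D`_i| / `|D`_0|.
pose B : C := \sum_(i < size N) `|N`_i| / `|D`_0|.
have sumle (p : {poly C}) n : \sum_(i < n) `|p`_i| / `|D`_0|
    <= \sum_(i < size p) `|p`_i| / `|D`_0|.
  have [np|pn] := leqP n (size p).
    rewrite (big_ord_widen _ (fun i => `|p`_i| / `|D`_0|) np) big_mkcond.
    by apply: ler_sum => i _; case: ifP => // _; rewrite divr_ge0.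
  rewrite (big_ord_widen _ (fun i => `|p`_i| / `|D`_0|) (ltnW pn)).
  rewrite [X in _ <= X]big_mkcond; apply: ler_sum => i _; case: ifP => //.
  by move/negbT; rewrite -leqNgt => /(nth_default _) ->; rewrite normr0 mul0r.
have A1 : 1 <= A.
  by apply: le_trans (sumle D 1%N); rewrite big_ord1 divff // normr_eq0.
have B0 : 0 <= B by rewrite sumr_ge0 // => i _; rewrite divr_ge0.
(* The factors 2 leave half of the bound for each of the two contributions to
   the recurrence, the coefficient of [N] and the sum over [D]. *)
pose K := 2%:R * A; pose M := 2%:R * B + 1.
have K1 : 1 <= K.
  rewrite /K mulr_natl mulr2n; apply: (le_trans A1).
  by rewrite lerDl (le_trans ler01 A1).
have K0 : 0 < K := lt_le_trans ltr01 K1.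
have M0 : 0 < M by rewrite ltr_wpDl // mulr_ge0.
exists M, K; split=> //; elim/ltn_ind => n IH.
have Dn : fcoef f n * D`_0 = N`_n - \sum_(i < n) D`_i.+1 * fcoef f (n - i.+1).
  have : fcoef (fpoly D * f) n = N`_n by rewrite DN.
  by rewrite fcoefM big_ord_recl subn0 => <-; rewrite addrK mulrC.
have -> : fcoef f n = (N`_n - \sum_(i < n) D`_i.+1 * fcoef f (n - i.+1)) / D`_0.
  by rewrite -Dn mulfK.
rewrite normrM normfV; apply: le_trans (_ : B + M * K ^+ n / 2%:R <= _); last first.
  have n2 : (2%:R : C) != 0 by rewrite pnatr_eq0.
  rewrite [leRHS](_ : _ = M * K ^+ n / 2%:R + M * K ^+ n / 2%:R); last by field.
  rewrite lerD2r ler_pdivlMr // mulrC; apply: le_trans (_ : M <= _).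
    by rewrite /M lerDl.
  by rewrite ler_peMr ?(ltW M0) // exprn_ege1.
apply: le_trans (ler_wpM2r _ (ler_normB _ _)) _; first by rewrite invr_ge0.
rewrite mulrDl lerD //.
  apply: le_trans (sumle N n.+1); rewrite big_ord_recr /= lerDr.
  by rewrite sumr_ge0 // => i _; rewrite divr_ge0.
case: n IH {Dn} => [|n] IH.
  by rewrite big_ord0 normr0 mul0r !mulr_ge0 ?invr_ge0 ?(ltW M0) ?exprn_ge0 ?(ltW K0).
apply: le_trans (_ : \sum_(i < n.+1) `|D`_i.+1| / `|D`_0| * (M * K ^+ n) <= _).
  apply: le_trans (ler_wpM2r _ (ler_norm_sum _ _ _)) _; first by rewrite invr_ge0.
  rewrite mulr_suml; apply: ler_sum => i _; rewrite normrM mulrAC.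
  apply: ler_wpM2l; first by rewrite divr_ge0.
  apply: le_trans (IH _ _) _; first by have := ltn_ord i; lia.
  apply: ler_wpM2l; first exact: ltW.
  by rewrite ler_weXn2l // subSS leq_subr.
rewrite -mulr_suml exprS.
have n2 : (2%:R : C) != 0 by rewrite pnatr_eq0.
have -> : M * (K * K ^+ n) / 2%:R = A * (M * K ^+ n) by rewrite /K; field.
apply: ler_wpM2r; first by rewrite mulr_ge0 ?exprn_ge0 ?(ltW M0) ?(ltW K0).
apply: le_trans (sumle D n.+2); rewrite [X in _ <= X]big_ord_recl lerDr.
by rewrite divr_ge0.
Qed.

Lemma small_pos (e1 e2 : C) : 0 < e1 -> 0 < e2 ->
  exists e, [/\ 0 < e, e <= e1 & e <= e2].
Proof.
move=> e10 e20; have e12 : 0 < e1 + e2 by rewrite addr_gt0.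
exists (e1 * e2 / (e1 + e2)); split; first by rewrite divr_gt0 ?mulr_gt0.
  by rewrite ler_pdivrMr // ler_pM2l // lerDr ltW.
by rewrite ler_pdivrMr // mulrC ler_pM2l // lerDl ltW.
Qed.

Lemma half_lt (e : C) : 0 < e -> 0 < e / 2%:R /\ e / 2%:R < e.
Proof.
move=> e0; split; first by rewrite divr_gt0.
by rewrite ltr_pdivrMr // mulr_natr mulr2n ltrDl.
Qed.

Lemma dnbhs_point (P : C -> Prop) (e : C) : 0 < e ->
  (\forall w \near (0 : C)^', P w) -> exists w, [/\ w != 0, `|w| <= e & P w].
Proof.
move=> e0 /dnbhs_disc[e1 e10 eP]; have [e2 [e20 e2e e2e1]] := small_pos e0 e10.
have [h0 h1] := half_lt e20; exists (e2 / 2%:R); rewrite gtr0_norm //; split.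
- exact: lt0r_neq0.
- exact: le_trans (ltW h1) e2e.
- by apply: eP; rewrite ?lt0r_neq0 // gtr0_norm // (lt_le_trans h1).
Qed.

Lemma geo_near f : (\forall w \near (0 : C)^', exists l, conv f w l) -> geo f.
Proof. by move=> /(dnbhs_point ltr01)[w [w0 _ [l fl]]]; apply: conv_geo fl. Qed.

Lemma conv_neq0 f : geo f -> fcoef f 0%N != 0 ->
  exists2 e : C, 0 < e & forall w l, `|w| <= e -> conv f w l -> l != 0.
Proof.
move=> /conv_near[e [B [e0 B0 nearf]]] f0; rewrite -normr_gt0 in f0.
have [h0 h1] := half_lt f0.
have [e1 [e10 e1e e1B]] := small_pos e0 (divr_gt0 h0 B0).
exists e1 => // w l we fl; apply/eqP => l0.
have := nearf w l (le_trans we e1e) fl; rewrite l0 sub0r normrN.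
rewrite lt_geF //; apply: le_lt_trans h1; rewrite -ler_pdivlMl // mulrC.
exact: le_trans we e1B.
Qed.

(** The constant term vanishes, for otherwise the sum would be nonzero near 0;
    then divide by the variable and repeat. *)
Lemma conv_eq0 f : (\forall w \near (0 : C)^', conv f w 0) -> f = 0.
Proof.
move=> f0; have head g : (\forall w \near (0 : C)^', conv g w 0) -> fcoef g 0%N = 0.
  move=> g0; apply/eqP/negPn/negP => g00.
  have gg : geo g by apply: geo_near; apply: filterS g0 => w gw; exists 0.
  have [e e0 /(_ _ 0) ge] := conv_neq0 gg g00.
  have [w [_ we gw]] := dnbhs_point e0 g0.
  by have := ge w we gw; rewrite eqxx.
apply: fpsP => n; elim: n f f0 => [|n IH] f f0; first exact: head.
have [g gE] := fps_shift (head f f0).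
rewrite gE fcoefXM; apply: (IH g); move/dnbhs_disc: f0 => [e e0 fe].
apply/dnbhs_disc; exists e => // w w0 we; rewrite -(mul0r w^-1).
by apply: conv_divX => //; rewrite -gE; exact: fe.
Qed.

(** The principle by which identities between functions near a point become
    identities between formal power series. *)
Lemma conv_inj f g (l : C -> C) : (\forall w \near (0 : C)^', conv f w (l w)) ->
  (\forall w \near (0 : C)^', conv g w (l w)) -> f = g.
Proof.
move=> fl gl; apply/eqP; rewrite -subr_eq0; apply/eqP/conv_eq0.
apply: filterS2 fl gl => w fw gw; rewrite -(subrr (l w)).
by apply: conv_add => //; exact: conv_opp.
Qed.

Lemma horner_near_neq0 (p : {poly C}) : p != 0 ->
  \forall w \near (0 : C)^', p.[w] != 0.
Proof.
move=> p0; have [k [q q0 ->]] := multiplicity_XsubC p 0.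
rewrite p0 /= in q0; rewrite subr0.
have gq : geo (fpoly q) := conv_geo (oner_neq0 C) (@conv_poly q 1).
have q00 : fcoef (fpoly q) 0%N != 0 by rewrite fcoef_poly -horner_coef0.
have [e e0 eq] := conv_neq0 gq q00; apply/dnbhs_disc; exists e => // w w0 we.
rewrite hornerM hornerXn mulf_neq0 ?expf_neq0 //.
exact: eq (ltW we) (@conv_poly q w).
Qed.
End Convergence.

Section Complex.
Variable R : realType.
Local Notation C := (CC R).
Local Open Scope complex_scope.

Lemma normc_le (z : R[i]) : `|z| <= (`|complex.Re z| + `|complex.Im z|)%:C.
Proof.
rewrite normc_def lecR -[leRHS]ger0_norm ?addr_ge0 // -sqrtr_sqr.
apply: ler_wsqrtr; rewrite sqrrD !real_normK ?num_real // lerD2r lerDl.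
by rewrite mulrn_wge0 // mulr_ge0.
Qed.

Lemma normc_ge_Im (z : R[i]) : `|complex.Im z|%:C <= `|z|.
Proof.
rewrite normc_def lecR -sqrtr_sqr; apply: ler_wsqrtr.
by rewrite lerDr sqr_ge0.
Qed.

Lemma ltC_real (e : C) : 0 < e -> exists2 s : R, 0 < s & e = s%:C.
Proof.
rewrite /CC; case: e => a b; rewrite ltcE /= => /andP[/eqP-> a0].
by exists a.
Qed.

Lemma cvg_complex (u : nat -> C) (x y : R) :
  (fun n => complex.Re (u n : R[i])) @ \oo --> x ->
  (fun n => complex.Im (u n : R[i])) @ \oo --> y ->
  u @ \oo --> (x +i* y : C).
Proof.
move=> /cvgrPdist_lt ux /cvgrPdist_lt uy; apply/cvgrPdist_lt => e e0.
have [r r0 ->] := ltC_real e0.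
have h0 : 0 < r / 2%:R by rewrite divr_gt0.
apply: filterS2 (ux _ h0) (uy _ h0) => n xn yn.
apply: (@le_lt_trans _ R[i] _ _ _ (normc_le _)); rewrite ltcR [ltRHS](splitr r).
by move: xn yn; case: (u n) => a b /= xa yb; rewrite ltrD.
Qed.

(** Completeness is used in the real line, to which complex series are
    reduced by real and imaginary parts. *)
Lemma real_series_cvg (v : nat -> R) (m : R) :
  (forall n, `|v n| <= m * 2%:R^-1 ^+ n) -> cvgn (series v).
Proof.
move=> vm; apply: normed_cvg; apply: (@series_le_cvg _ _ (geometric m 2%:R^-1)).
- by move=> n /=.
- by move=> n /=; exact: le_trans (vm n).
- by move=> n /=; exact: vm.
apply: is_cvg_geometric_series; rewrite ger0_norm ?invr_ge0 ?ler0n //.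
by rewrite invf_lt1 ?ltr0n // (ltr_nat _ 1 2).
Qed.

Lemma complex_series_cvg (u : nat -> C) (M : C) :
  (forall n, `|u n| <= M * 2%:R^-1 ^+ n) ->
  exists l : C, (fun n => \sum_(i < n) u i) @ \oo --> l.
Proof.
move=> uM; have M0 : 0 <= M by have := uM 0%N; rewrite mulr1; exact: le_trans.
have [m mM] : exists m : R, M = m%:C.
  by move: M0; rewrite /CC; case: (M) => a b; rewrite lecE /= => /andP[/eqP-> _]; exists a.
have bound (n : nat) (r : R) : r%:C <= `|u n : R[i]| -> r <= m * 2%:R^-1 ^+ n.
  have -> : m * 2%:R^-1 ^+ n = complex.Re (M * 2%:R^-1 ^+ n : R[i]).
    have -> : M * 2%:R^-1 ^+ n = (m * 2%:R^-1 ^+ n)%:C :> R[i].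
      by rewrite mM rmorphM rmorphXn fmorphV rmorph_nat.
    by [].
  by move=> ru; have := le_trans ru (uM n); rewrite lecE /= => /andP[_].
have Re_sum n : complex.Re (\sum_(i < n) u i : R[i]) = \sum_(i < n) complex.Re (u i : R[i]).
  by apply: (big_morph (@complex.Re R)) => // -[a b] [c d].
have Im_sum n : complex.Im (\sum_(i < n) u i : R[i]) = \sum_(i < n) complex.Im (u i : R[i]).
  by apply: (big_morph (@complex.Im R)) => // -[a b] [c d].
have /cvg_ex[x xu] := real_series_cvg (fun n => bound n _ (normc_ge_Re _)).
have /cvg_ex[y yu] := real_series_cvg (fun n => bound n _ (normc_ge_Im _)).
exists (x +i* y); apply: cvg_complex.
  by under eq_fun do rewrite Re_sum -(big_mkord xpredT (fun i => complex.Re (u i : R[i]))).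
by under eq_fun do rewrite Im_sum -(big_mkord xpredT (fun i => complex.Im (u i : R[i]))).
Qed.

Lemma geo_conv (f : fps C) : geo f ->
  exists2 e : C, 0 < e & forall w, `|w| <= e -> exists l, conv f w l.
Proof.
move=> [M [K [M0 K0 fM]]]; exists (2%:R * K)^-1.
  by rewrite invr_gt0 mulr_gt0.
move=> w wK; have [l fl] := @complex_series_cvg (fun n => fcoef f n * w ^+ n) M
  (fun n => geo_terms n K0 fM wK).
by exists l.
Qed.

Lemma rational_conv (D N : {poly C}) (f : fps C) : D != 0 ->
  fpoly D * f = fpoly N ->
  geo f /\ \forall w \near (0 : C)^', conv f w (N.[w] / D.[w]).
Proof.
move=> D0 DN; have gf : geo f.
  have [k [q q0 DE]] := multiplicity_XsubC D 0.
  rewrite D0 /= in q0; rewrite subr0 mulrC in DE.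
  have [r NE] : exists r, N = 'X^k * r.
    exists (drop_poly k N); rewrite mulrC -[LHS](poly_take_drop k).
    rewrite (_ : take_poly k N = 0) ?add0r //; apply/polyP => i.
    rewrite coef_take_poly coef0; case: ifP => // ik.
    have : fcoef (fpoly D * f) i = N`_i by rewrite DN.
    by rewrite DE rmorphM rmorphXn -mulrA fcoefXnM ik => <-.
  apply: (@geo_rational _ q r); first by rewrite -horner_coef0.
  apply: (@fvarXn_inj _ k); move: DN.
  by rewrite DE NE !rmorphM rmorphXn mulrA.
split=> //; have [e e0 ef] := geo_conv gf.
have /dnbhs_disc[e1 e10 De] := horner_near_neq0 D0.
have [e2 [e20 e2e e2e1]] := small_pos e0 e10.
apply/dnbhs_disc; exists e2 => // w w0 we.
have [l fl] := ef w (le_trans (ltW we) e2e).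
have := @conv_unique _ _ _ _ _ (@conv_polyM _ D _ _ _ fl).
rewrite DN => /(_ _ (@conv_poly _ N w)) => <-.
by rewrite mulrC mulKf // De // (lt_le_trans we).
Qed.
End Complex.

(** * Laurent expansions *)

Section Laurent.
Variable C : numClosedFieldType.

Lemma det_Ymx1 (a : nat -> C) : \det (Ymx 1 a) = a 1%N.
Proof.
rewrite (_ : Ymx 1 a = (a 1%N)%:M) ?det_scalar1 //.
by apply/matrixP => i j; rewrite !mxE !ord1.
Qed.

Lemma Ymx_eval1 (d : nat) (a : nat -> C) : (0 < d)%N ->
  \det (Ymx d a) = 0 <-> a d = eval1 (Y C d) a.
Proof.
case: d => [|[|d]] // _.
  by rewrite /Y /= /eval1 raddf0 det_Ymx1.
have [N N0 ->] := @Y_specP C d.+2 isT.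
split=> [/eqP|->]; last by rewrite subrr mulr0.
by rewrite mulf_eq0 (negPf N0) subr_eq0 => /eqP.
Qed.

Lemma laurentE (g : C -> C) m a :
  laurent g m a <-> \forall w \near (0 : C)^', conv (Fps a) w (w ^ (- m) * g w).
Proof. by split; apply: filterS => w; rewrite convE. Qed.

Lemma laurent_shift (g : C -> C) m (k : nat) a b :
  laurent g m a -> laurent g (m + k%:Z) b -> Fps a = fvar C ^+ k * Fps b.
Proof.
move=> /laurentE ga /laurentE gb; apply: (conv_inj ga).
have w0 : \forall w \near (0 : C)^', w != 0.
  by apply/dnbhs_disc; exists 1.
apply: filterS2 w0 gb => w w0 /(@conv_polyM _ 'X^k).
rewrite rmorphXn /= hornerXn mulrA; congr (conv _ _ (_ * _)).
by rewrite exprnP -expfzDr // opprD addrCA addrN addr0.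
Qed.

Lemma laurent_uniq (g : C -> C) m a b :
  laurent g m a -> laurent g m b -> a = b.
Proof.
move=> ga gb; have := @laurent_shift g m 0 a b ga; rewrite addr0 => /(_ gb).
by rewrite mul1r => -[].
Qed.

Lemma order_uniq (g : C -> C) m m' : order_at0 g m -> order_at0 g m' -> m = m'.
Proof.
wlog mm' : m m' / m <= m'.
  move=> th gm gm'; have [mm'|/ltW m'm] := leP m m'; first exact: th.
  by apply/esym; apply: th.
move=> [a ga a0] [b gb b0]; have m'E : m' = m + `|m' - m|%N%:Z.
  by rewrite gez0_abs ?subr_ge0 // addrCA subrr addr0.
rewrite m'E in gb *; have := laurent_shift ga gb.
case: `|m' - m|%N => [|k] /(congr1 (fun f => fcoef f 0%N)).
  by rewrite addr0.
by rewrite fcoefXnM /= => a00; rewrite a00 eqxx in a0.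
Qed.

(** [rdiff] on polynomials. *)
Definition rd n (T : {poly C}) : {poly C} := n%:R * 'X * T - 'X ^+ 2 * T^`().

Lemma polyrev_rd n (T : {poly C}) : (size T <= n.+1)%N ->
  polyrev n T^`() = rd n (polyrev n T).
Proof.
move=> sT; apply: fpoly_inj; rewrite rev_deriv // /rd /rdiff fD_poly.
by rewrite rmorphB !rmorphM rmorph_nat.
Qed.

Lemma wron_rd n (T U : {poly C}) :
  'X ^+ 2 * wron T U = - (rd n T * U - T * rd n U).
Proof. by rewrite /rd /wron; ring. Qed.

(** In the coordinate w = 1 / z the derivation of z is - w ^ 2 d/dw, so the
    Wronskian acquires the factor w ^ 2 and the numerator of the Schwarzian the
    factor w ^ 8, which is the w ^ 4 of the quadratic differential times the
    square of the w ^ 2 of the Wronskian. *)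
Lemma schw_rd n (T U : {poly C}) :
  let V := rd n T * U - T * rd n U in
  let V1 := rd n (rd n T) * U - T * rd n (rd n U) in
  let M := rd n (rd n T) * rd n U - rd n T * rd n (rd n U) in
  let V2 := rd n (rd n (rd n T)) * U + M - T * rd n (rd n (rd n U)) in
  'X ^+ 8 * schw T U = 2%:R * V * V2 - 3%:R * V1 ^+ 2 + 4%:R * V * M.
Proof.
rewrite /schw /wron /minor /rd /= -!polyC_natr.
rewrite !(derivD, derivN, derivM, expr2, derivC, derivX) !polyC_natr; ring.
Qed.
End Laurent.

(** * Local form of a rational map *)

Section LocalAnalysis.
Variable R : realType.
Local Notation C := (CC R).
Implicit Types (P Q : {poly C}) (g : C -> C).

(** The condition of the theorem for a function given in a local coordinate. *)
Definition star_at g d := exists a : nat -> C,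
  [/\ laurent g (- 2%:Z) a, a 0%N = (1 - d%:R ^+ 2) / 2%:R
    & a d = eval1 (Y C d) a].

Definition is_schw P Q g := \forall w \near (0 : C)^',
  2%:R * g w * (wron P Q).[w] ^+ 2 = (schw P Q).[w].

Lemma near_neq0 : \forall w \near (0 : C)^', w != 0.
Proof. by apply/dnbhs_disc; exists 1. Qed.

Lemma wron_nz P Q : wron P Q != 0 -> P != 0 /\ Q != 0.
Proof.
move=> W0; split; apply: contra W0 => /eqP ->; rewrite /wron derivC.
  by rewrite !mul0r subr0.
by rewrite !mulr0 subr0.
Qed.

(** Transfers the formal statement [schw_expansion] to convergent expansions,
    at a point sent to 0. *)
Lemma local_star P Q g u : P.[0] = 0 -> Q.[0] != 0 -> wron P Q != 0 ->
  is_schw P Q g -> (\forall w \near (0 : C)^', u w = P.[w] / Q.[w]) ->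
  exists d, [/\ (0 < d)%N, order_at0 u d%:Z, star_at g d
    & d = 1%N -> (wron P Q).[0] != 0].
Proof.
move=> P0 Q0 W0 gS uE.
have [d [Ph [a [d0 PE Ph0 aE [[a0 detY] Wd]]]]] := schw_expansion P0 Q0 W0.
exists d; split=> //.
  have [qinv qK] : exists q, fpoly Q * q = 1.
    by apply: finv_ex; rewrite fcoef_poly -horner_coef0.
  pose b := qinv * fpoly Ph.
  have bE : fpoly Q * b = fpoly Ph by rewrite /b mulrA qK mul1r.
  have [_ bc] := rational_conv (wron_nz W0).2 bE.
  exists (fcoef b).
    apply/laurentE; apply: filterS3 near_neq0 uE bc => w w0 -> bw.
    rewrite PE hornerM hornerXn (_ : Fps _ = b); last exact: fpsP.
    by rewrite -exprnN -(mulrA (w ^+ d)) mulKf ?expf_neq0.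
  have := congr1 (fun f => fcoef f 0%N) bE; rewrite fcoefM0 !fcoef_poly => b0.
  apply/eqP => b00; rewrite b00 mulr0 in b0.
  by rewrite horner_coef0 -b0 eqxx in Ph0.
have n2 : (2%:R : C) != 0 by rewrite pnatr_eq0.
have D0 : 2%:R * wron P Q ^+ 2 != 0.
  by rewrite mulf_neq0 ?expf_neq0 // -polyC_natr polyC_eq0.
have [_ ac] := rational_conv D0 aE.
exists (fcoef a); split; [|exact: a0|exact/Ymx_eval1].
apply/laurentE; rewrite /is_schw in gS.
apply: filterS3 gS ac (horner_near_neq0 W0) => w gw aw Ww.
rewrite (_ : Fps _ = a); last exact: fpsP.
 rewrite (_ : _ * g w = ('X^2 * schw P Q).[w] / (2%:R * wron P Q ^+ 2).[w]) //.
have -> : (2%:R * wron P Q ^+ 2).[w] = 2%:R * (wron P Q).[w] ^+ 2.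
  by rewrite hornerM horner_exp -polyC_natr hornerC.
rewrite hornerM hornerXn -gw opprK -exprnP; field.
by rewrite Ww.
Qed.

Definition value P Q w : sphere C :=
  if Q.[w] == 0 then None else Some (P.[w] / Q.[w]).

(** Post-composition with a Moebius map does not change the Schwarzian: a pole
    is moved to 0 by inversion and a finite value by translation. *)
Lemma local_star_value P Q g : (P.[0] != 0) || (Q.[0] != 0) ->
  wron P Q != 0 -> is_schw P Q g ->
  exists d, [/\ (0 < d)%N,
    order_at0 (fun w => coord_at (value P Q 0) (value P Q w)) d%:Z, star_at g d
    & d = 1%N -> (wron P Q).[0] != 0].
Proof.
move=> PQ0 W0 gS; have [P0 Q0] := wron_nz W0.
have [Q00|Q00] := eqVneq Q.[0] 0.
  rewrite Q00 eqxx orbF in PQ0.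
  have -> : ((wron P Q).[0] != 0) = ((wron Q P).[0] != 0).
    by rewrite [in RHS]wron_swap hornerN oppr_eq0.
  apply: (@local_star Q P) => //.
  - by rewrite wron_swap oppr_eq0.
  - by rewrite /is_schw wron_swap schw_swap; apply: filterS gS => w; rewrite hornerN sqrrN.
  - rewrite /value Q00 eqxx; apply: filterS (horner_near_neq0 Q0) => w Qw.
    by rewrite (negPf Qw) /= invf_div.
pose b := P.[0] / Q.[0].
rewrite -(wron_sub b).
apply: (@local_star (P - b *: Q) Q) => //.
- by rewrite !hornerE /b divfK // subrr.
- by rewrite wron_sub.
- by rewrite /is_schw wron_sub schw_sub.
- rewrite /value (negPf Q00); apply: filterS (horner_near_neq0 Q0) => w Qw.
  by rewrite (negPf Qw) /= !hornerE mulrBl mulfK.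
Qed.

Lemma wron_comp P Q c : wron (P \Po ('X + c%:P)) (Q \Po ('X + c%:P)) =
  wron P Q \Po ('X + c%:P).
Proof.
rewrite /wron !deriv_comp derivD derivX derivC addr0 !mulr1.
by rewrite rmorphB !rmorphM.
Qed.

Lemma schw_comp P Q c : schw (P \Po ('X + c%:P)) (Q \Po ('X + c%:P)) =
  schw P Q \Po ('X + c%:P).
Proof.
have D p : (p \Po ('X + c%:P))^`() = p^`() \Po ('X + c%:P) :> {poly C}.
  by rewrite deriv_comp derivD derivX derivC addr0 mulr1.
rewrite /schw wron_comp /minor !D -!polyC_natr. move: (wron P Q) => W.
have N p : - p \Po ('X + c%:P) = - (p \Po ('X + c%:P)) :> {poly C} by exact: raddfN.
by rewrite !(comp_polyD, N, comp_polyM, comp_polyC, expr2).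
Qed.

Lemma size_drv n P : (size P <= n.+1)%N -> (size P^`() <= n.+1)%N.
Proof.
move=> pn; apply/leq_sizeP => k ik; rewrite coef_deriv nth_default ?mul0rn //.
by rewrite (leq_trans pn) // ltnW.
Qed.

(** The local heart of both directions: a differential that agrees with the
    Schwarzian of P / Q near [p] has, at [p], the form prescribed by the local
    degree [d]. A simple point is the case d = 1, where the condition says that
    the differential is regular and where the Wronskian does not vanish. *)
Lemma schwarz_local P Q phi p : coprimep P Q -> wron P Q != 0 ->
  (\forall w \near (0 : C)^', forall z, point_at p w = Some z ->
     2%:R * phi z * (wron P Q).[z] ^+ 2 = (schw P Q).[z]) ->
  exists d, [/\ local_degree (ratmap P Q) p d, star phi p d
    & forall c, p = Some c -> d = 1%N -> (wron P Q).[c] != 0].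
Proof.
move=> co W0 phiS.
suff : exists d, [/\ (0 < d)%N, order_at0 (fun w =>
    coord_at (ratmap P Q p) (ratmap P Q (point_at p w))) d%:Z,
    star_at (qd_local phi p) d
    & forall c, p = Some c -> d = 1%N -> (wron P Q).[c] != 0].
  by move=> [d [d0 od sd Wd]]; exists d.
have noroot z : P.[z] != 0 \/ Q.[z] != 0.
  have [Pz|Pz] := eqVneq P.[z] 0; [right|by left].
  by apply: (coprimep_root co); rewrite /root Pz.
case: p phiS => [c|] phiS /=.
  have XE w : ('X + c%:P).[w] = c + w by rewrite hornerD hornerX hornerC addrC.
  have -> : (fun w => coord_at (ratmap P Q (Some c)) (ratmap P Q (Some (c + w))))
    = (fun w => coord_at (value (P \Po ('X + c%:P)) (Q \Po ('X + c%:P)) 0)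
        (value (P \Po ('X + c%:P)) (Q \Po ('X + c%:P)) w)).
    by apply/funext => w; rewrite /value /ratmap !horner_comp !XE addr0.
  suff [d [d0 od sd Wd]] : exists d, [/\ (0 < d)%N, order_at0 (fun w =>
        coord_at (value (P \Po ('X + c%:P)) (Q \Po ('X + c%:P)) 0)
        (value (P \Po ('X + c%:P)) (Q \Po ('X + c%:P)) w)) d%:Z,
        star_at (fun w => phi (c + w)) d
      & d = 1%N -> (wron (P \Po ('X + c%:P)) (Q \Po ('X + c%:P))).[0] != 0].
    exists d; split=> // _ [<-] /Wd; rewrite wron_comp horner_comp XE addr0.
    exact.
  apply: local_star_value.
  - by rewrite !horner_comp !XE; apply/orP; exact: noroot.
  - rewrite wron_comp; apply: contra W0 => /eqP e; apply/eqP.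
    rewrite -[LHS](@comp_polyXaddC_K _ _ c) e comp_poly0 //.
  - rewrite /is_schw wron_comp schw_comp; apply: filterS phiS => w /(_ (c + w) erefl).
    by rewrite !horner_comp !XE.
set n := (maxn (size P) (size Q)).-1.
pose T := polyrev n P; pose U := polyrev n Q.
have [P0 Q0] := wron_nz W0.
have sP : (size P <= n.+1)%N.
  by rewrite /n prednK ?leq_maxl // (leq_trans _ (leq_maxl _ _)) ?size_poly_gt0.
have sQ : (size Q <= n.+1)%N.
  by rewrite /n prednK ?leq_maxr // (leq_trans _ (leq_maxr _ _)) ?size_poly_gt0.
have T0 : T.[0] = P`_n by rewrite horner_coef0 coef_rev subn0.
have U0 : U.[0] = Q`_n by rewrite horner_coef0 coef_rev subn0.
have Tw w : w != 0 -> T.[w] = w ^+ n * P.[w^-1] by exact: horner_rev.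
have Uw w : w != 0 -> U.[w] = w ^+ n * Q.[w^-1] by exact: horner_rev.
have -> : (fun w : C => coord_at (if Q`_n == 0 then None else Some (P`_n / Q`_n))
      (ratmap P Q (if w == 0 then None else Some w^-1))) =
    (fun w => coord_at (value T U 0) (value T U w)).
  apply/funext => w; rewrite /value T0 U0; congr coord_at.
  have [->|w0] := eqVneq w 0; first by rewrite /ratmap T0 U0.
  rewrite /ratmap Tw // Uw // mulf_eq0 (negPf (expf_neq0 _ w0)) /=.
  by case: ifP => // _; rewrite -mulf_div divff ?expf_neq0 // mul1r.
have wronE w : w != 0 -> w ^+ 2 * (wron T U).[w] =
    - (w ^+ n ^+ 2 * (wron P Q).[w^-1]).
  move=> w0; have := congr1 (fun p : {poly C} => p.[w]) (wron_rd n T U).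
  rewrite -!polyrev_rd // hornerM hornerXn => ->.
  rewrite hornerN hornerD hornerN !hornerM Tw // Uw // !horner_rev ?size_drv //.
  by rewrite /wron hornerD hornerN !hornerM; ring.
have schwE w : w != 0 -> w ^+ 8 * (schw T U).[w] =
    w ^+ n ^+ 4 * (schw P Q).[w^-1].
  move=> w0; have := congr1 (fun p : {poly C} => p.[w]) (schw_rd n T U).
  rewrite -!polyrev_rd ?size_drv // hornerM hornerXn => ->.
  rewrite /schw wron_deriv derivD derivN !derivM /wron /minor.
  rewrite -!polyC_natr.
  rewrite !(hornerD, hornerN, hornerM, expr2, hornerC).
  rewrite Tw // Uw // !horner_rev ?size_drv //; ring.
suff [d [d0 od sd _]] : exists d, [/\ (0 < d)%N, order_at0 (fun w =>
      coord_at (value T U 0) (value T U w)) d%:Z,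
      star_at (fun w => phi w^-1 * w ^- 4) d & d = 1%N -> (wron T U).[0] != 0].
  by exists d.
apply: local_star_value.
- rewrite T0 U0 /n; have [le|le] := leqP (size P) (size Q).
    by rewrite -!lead_coefE lead_coef_eq0 Q0 orbT.
  by rewrite -!lead_coefE lead_coef_eq0 P0.
- apply: contra W0 => /eqP TU0; apply/eqP/poly_eq_nonzero => z z0.
  have := wronE z^-1; rewrite invr_eq0 TU0 horner0 mulr0 invrK => /(_ z0) /eqP.
  rewrite eq_sym oppr_eq0 mulf_eq0 !expf_eq0 invr_eq0 (negPf z0) andbF /=.
  by move/eqP ->; rewrite horner0.
- rewrite /is_schw; apply: filterS2 near_neq0 phiS => w w0.
  rewrite /point_at (negPf w0) => /(_ _ erefl) e.
  apply: (mulfI (expf_neq0 8 w0)); rewrite schwE // -e.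
  transitivity (2%:R * phi w^-1 * (w ^+ 2 * (wron T U).[w]) ^+ 2).
    by field.
  by rewrite wronE //; ring.
Qed.
End LocalAnalysis.

(** * The analytic Schwarzian derivative *)

Section Derivatives.
Variable C : numClosedFieldType.
Implicit Types (P Q N D : {poly C}) (g : C -> C).

Lemma cvg_horner P (z : C) : horner P @ z --> P.[z].
Proof.
have cst (k : C) : (fun _ : C => k) @ z --> k by exact: (@cvg_cst C k C (nbhs z) _).
elim/poly_ind: P => [|p c IH].
  have -> : horner (0 : {poly C}) = fun=> 0 by apply/funext => y; rewrite horner0.
  exact: cst.
have -> : horner (p * 'X + c%:P) = (fun y => p.[y] * y + c).
  by apply/funext => y; rewrite hornerMXaddC.
have pz := @cvgM C C (nbhs z) (nbhs_filter z) (horner p) id p.[z] z IH cvg_id.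
exact: (@cvgD C C C (nbhs z) (nbhs_filter z) _ _ _ _ pz (cst c)).
Qed.

Lemma cvg_dnbhs (f : C -> C) (z l : C) : f @ z --> l -> f @ z^' --> l.
Proof.
move=> fl.
exact: (@cvg_within_filter C C f (nbhs z) (nbhs_filter z) (nbhs l) _ fl).
Qed.

Lemma horner_nbhs_neq0 P (z : C) : P.[z] != 0 -> \forall y \near z, P.[y] != 0.
Proof.
move=> Pz.
exact: (@cvgr_neq0 C C C (nbhs z) (nbhs_filter z) (horner P) P.[z]
  (@cvg_horner P z) Pz).
Qed.

Lemma cvg_ratio P Q (z : C) : Q.[z] != 0 ->
  (fun y => P.[y] / Q.[y]) @ z^' --> P.[z] / Q.[z].
Proof.
move=> Qz; have Fz : Filter z^' by apply: within_filter.
have QV := @cvgV C C z^' Fz (horner Q) Q.[z] Qz (cvg_dnbhs (@cvg_horner Q z)).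
exact: (@cvgM C C z^' Fz _ _ _ _ (cvg_dnbhs (@cvg_horner P z)) QV).
Qed.

Lemma cvg_near_eq (f g : C -> C) (z l : C) :
  (\forall y \near z^', g y = f y) -> g @ z^' --> l -> f @ z^' --> l.
Proof.
move=> gf gl; have Fz : Filter z^' by apply: within_filter.
move=> A /gl; rewrite /fmap /= => gA.
by apply: filterS2 gf gA => y; rewrite /= => ->.
Qed.

(** The numerator of the difference quotient is a polynomial in the increment
    that vanishes at 0; dividing by the increment leaves a polynomial whose
    value at 0 is the Wronskian. *)
Lemma derive1_rational g N D (z : C) : D.[z] != 0 ->
  (\forall y \near z, g y = N.[y] / D.[y]) ->
  g^`()%classic z = (wron N D).[z] / (D * D).[z].
Proof.
move=> Dz gE.
(* The numerator of the difference quotient. *)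
pose q0 := D.[z] *: (N \Po ('X + z%:P)) - N.[z] *: (D \Po ('X + z%:P)).
have XE h : ('X + z%:P).[h] = h + z by rewrite hornerD hornerX hornerC.
have [q qE] : exists q, q0 = q * ('X - 0%:P).
  apply/factor_theorem; rewrite /root /q0 hornerD hornerN !hornerZ !horner_comp.
  by rewrite !XE add0r mulrC subrr.
have q0E : q.[0] = (wron N D).[z].
  have := congr1 (fun p : {poly C} => p^`().[0]) qE.
  rewrite /= derivM derivXsubC mulr1 hornerD hornerM hornerXsubC subrr.
  rewrite mulr0 add0r => <-; rewrite /q0 derivB !derivZ !deriv_comp.
  rewrite derivD derivX derivC addr0 !mulr1 hornerD hornerN !hornerZ.
  by rewrite !horner_comp XE add0r /wron hornerD hornerN !hornerM mulrC.
apply/cvg_lim => //.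
pose Dt := D.[z] *: (D \Po ('X + z%:P)).
have Dt0 : Dt.[0] = (D * D).[z].
  by rewrite /Dt hornerZ horner_comp XE add0r hornerM.
rewrite -q0E -Dt0; apply: (@cvg_near_eq _ (fun h => q.[h] / Dt.[h])); last first.
  by apply: cvg_ratio; rewrite Dt0 hornerM mulf_neq0.
have [e e0 eP] := (nbhs_disc _ _).1 (filterI gE (horner_nbhs_neq0 Dz)).
apply/dnbhs_disc; exists e => // h h0 he; have [gh Dh] := eP h he.
have := eP 0; rewrite normr0 addr0 => /(_ e0)[gz _].
rewrite /Dt hornerZ horner_comp XE [h + z]addrC gh gz.
have := congr1 (fun p : {poly C} => p.[h]) qE.
rewrite subr0 hornerM hornerX /q0 hornerD hornerN !hornerZ !horner_comp XE [h + z]addrC => qh.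
have -> : q.[h] = (D.[z] * N.[z + h] - N.[z] * D.[z + h]) / h.
  by rewrite qh mulfK.
rewrite /GRing.scale /=; field.
by rewrite h0 Dz Dh.
Qed.

Lemma near_derive1_rational g N D (z : C) : D.[z] != 0 ->
  (\forall y \near z, g y = N.[y] / D.[y]) ->
  \forall y \near z, g^`()%classic y = (wron N D).[y] / (D * D).[y].
Proof.
move=> Dz gE.
have [e e0 eP] := (nbhs_disc _ _).1 (filterI gE (horner_nbhs_neq0 Dz)).
have [h0 h1] := half_lt e0; apply/nbhs_disc; exists (e / 2%:R) => // w we.
apply: derive1_rational; first by have [] := eP w (lt_trans we h1).
apply/nbhs_disc; exists (e / 2%:R) => // w' w'e; rewrite -addrA.
have [] := eP (w + w') => //; apply: le_lt_trans (ler_normD _ _) _.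
by rewrite [ltRHS]splitr ltrD.
Qed.

Lemma minor_wron P Q : Q * minor P Q = (wron P Q)^`() * Q^`() - wron P Q * Q^`()^`().
Proof. by rewrite wron_deriv /minor /wron; ring. Qed.

Definition schwarz_expr g (w : C) : C := (g^`(3))%classic w / (g^`())%classic w
    - 3%:R / 2%:R * ((g^`(2))%classic w / (g^`())%classic w) ^+ 2.

Lemma schwarz_expr_rational g P Q (z : C) : Q.[z] != 0 -> (wron P Q).[z] != 0 ->
  (\forall y \near z, g y = P.[y] / Q.[y]) ->
  schwarz_expr g z = (schw P Q).[z] / (2%:R * (wron P Q).[z] ^+ 2).
Proof.
move=> Qz Wz g0; have g1 := near_derive1_rational Qz g0.
have Qz2 : (Q * Q).[z] != 0 by rewrite hornerM mulf_neq0.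
have g2 := near_derive1_rational Qz2 g1.
have Qz4 : (Q * Q * (Q * Q)).[z] != 0 by rewrite hornerM mulf_neq0.
have g3 := near_derive1_rational Qz4 g2.
rewrite /schwarz_expr !derive1nS derive1n0 (nbhs_singleton g1) (nbhs_singleton g2) (nbhs_singleton g3).
have mE : (minor P Q).[z] = ((wron P Q)^`().[z] * Q^`().[z]
    - (wron P Q).[z] * Q^`()^`().[z]) / Q.[z].
  by rewrite -!hornerM -hornerN -hornerD -minor_wron hornerM mulrAC divff ?mul1r.
rewrite /schw; move: mE Wz; move: (wron P Q) (minor P Q) => W m mE Wz.
rewrite {1 2}/wron !derivM -!polyC_natr /wron.
rewrite !(derivD, derivN, derivM) !(hornerD, hornerN, hornerM, hornerC, expr2).
rewrite mE; field.
by rewrite Wz Qz.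
Qed.

Lemma dnbhs_disc_at (c : C) (P : C -> Prop) :
  (\forall y \near c^', P y) <-> (\forall w \near (0 : C)^', P (c + w)).
Proof.
rewrite dnbhs_disc; split=> [/nbhs_disc[e e0 eP]|[e e0 eP]].
  exists e => // w w0 we; apply: eP => //; rewrite -subr_eq0 addrAC subrr add0r //.
apply/nbhs_disc; exists e => // w we; rewrite -subr_eq0 addrAC subrr add0r => w0.
exact: eP.
Qed.

Lemma horner_dnbhs_neq0 P (z : C) : P != 0 -> \forall y \near z^', P.[y] != 0.
Proof.
move=> P0; apply/dnbhs_disc_at.
have XE h : ('X + z%:P).[h] = z + h by rewrite hornerD hornerX hornerC addrC.
have /horner_near_neq0 : P \Po ('X + z%:P) != 0.
  by apply: contra P0 => /eqP e; rewrite -[P](@comp_polyXaddC_K _ _ z) e comp_poly0.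
by apply: filterS => w; rewrite horner_comp XE.
Qed.

Lemma schwarzian_ratmap P Q (z : C) : (wron P Q).[z] != 0 ->
  schwarzian (ratmap P Q) z = (schw P Q).[z] / (2%:R * (wron P Q).[z] ^+ 2).
Proof.
move=> Wz; have finE y : Q.[y] != 0 -> finite_part (ratmap P Q) y = P.[y] / Q.[y].
  by move=> Qy; rewrite /finite_part /ratmap (negPf Qy).
have exprE y : Q.[y] != 0 -> (wron P Q).[y] != 0 ->
    schwarz_expr (finite_part (ratmap P Q)) y =
    (schw P Q).[y] / (2%:R * (wron P Q).[y] ^+ 2).
  move=> Qy Wy; apply: schwarz_expr_rational => //.
  have [e e0 eP] := (nbhs_disc _ _).1 (horner_nbhs_neq0 Qy).
  by apply/nbhs_disc; exists e => // w we; rewrite finE // eP.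
rewrite /schwarzian; have [Qz|Qz] := eqVneq Q.[z] 0; last first.
  by rewrite {1}/ratmap (negPf Qz); exact: exprE.
rewrite {1}/ratmap Qz eqxx; apply/cvg_lim => //.
have W0 : wron P Q != 0 by apply: contraNneq Wz => ->; rewrite horner0.
have Q0 : Q != 0 by apply: contraNneq W0 => ->; rewrite /wron derivC !mulr0 subrr.
pose D := 2%:R * wron P Q ^+ 2.
have DE y : D.[y] = 2%:R * (wron P Q).[y] ^+ 2.
  by rewrite /D hornerM horner_exp -polyC_natr hornerC.
have Dz : D.[z] != 0 by rewrite DE mulf_neq0 ?expf_neq0 // pnatr_eq0.
rewrite -DE; apply: (@cvg_near_eq _ (fun y => (schw P Q).[y] / D.[y])).
  have Fz : Filter z^' by apply: within_filter.
  apply: filterS2 (horner_dnbhs_neq0 z Q0) (horner_dnbhs_neq0 z W0) => y Qy Wy.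
  by rewrite -[RHS]/(schwarz_expr (finite_part (ratmap P Q)) y) exprE // DE.
exact: cvg_ratio.
Qed.

End Derivatives.

(** * A maximum principle on the sphere *)

Section Compactness.
Variable R : realType.
Local Notation C := (CC R).
Local Open Scope complex_scope.

(** Compactness as an induction principle: the complements of the sets with
    property [P] would form a proper filter without cluster point. *)
Lemma compact_ind (T : topologicalType) (A : set T) (P : set T -> Prop) :
  compact A -> P set0 -> (forall B D, B `<=` D -> P D -> P B) ->
  (forall B D, P B -> P D -> P (B `|` D)) ->
  (forall x, A x -> exists2 U, nbhs x U & P U) -> P A.
Proof.
move=> cA P0 Psub PU Ploc; apply: contrapT => PA.
pose F : set_system T := fun B => P (A `\` B).
have FF : Filter F.
  split.
  - by rewrite /F setDT.
  - move=> B D PB PD; rewrite /F setDE setCI setIUr -!setDE; exact: PU.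
  - by move=> B D BD; apply: Psub => x [Ax Dx]; split=> // /BD.
have PF : ProperFilter F by split=> //; rewrite /F setD0.
have [|x [Ax xF]] := cA F PF; first by rewrite /F setDv.
have [U xU PUU] := Ploc x Ax.
have [|y [Uy /=]] := xF (~` U) U _ xU; last by [].
by apply: Psub PUU => y [_ /contrapT].
Qed.

Definition square (r : R) : set C :=
  fun z => `|complex.Re (z : R[i])| <= r /\ `|complex.Im (z : R[i])| <= r.

Lemma square_ind (r : R) (P : set C -> Prop) :
  P set0 -> (forall B D, B `<=` D -> P D -> P B) ->
  (forall B D, P B -> P D -> P (B `|` D)) ->
  (forall z : C, exists2 e : C, 0 < e & P (fun y => `|y - z| < e)) ->
  P (square r).
Proof.
move=> P0 Psub PU Ploc.
pose i (xy : R * R) : C := xy.1 +i* xy.2.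
pose A := `[- r, r]%classic `*` `[- r, r]%classic.
have cA : compact A by apply: compact_setX; exact: segment_compact.
suff : P (i @` A).
  apply: Psub => -[x y] [/= xr yr]; exists (x, y) => //.
  by split=> /=; rewrite in_itv /= -ler_norml.
apply: (@compact_ind _ A (fun B => P (i @` B))) => //.
- by rewrite image_set0.
- by move=> B D BD; apply: Psub; exact: image_subset.
- by move=> B D PB PD; rewrite image_setU; exact: PU.
move=> [x y] _; have [e e0 Pe] := Ploc (i (x, y)).
have [s s0 eE] := ltC_real e0.
have h0 : 0 < s / 2%:R by rewrite divr_gt0.
exists (ball x (s / 2%:R) `*` ball y (s / 2%:R)).
  by exists (ball x (s / 2%:R), ball y (s / 2%:R)) => //; split; exact: nbhsx_ballx.
apply: Psub Pe => _ [[x' y'] [/= x'x y'y] <-].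
move: x'x y'y; rewrite -!ball_normE /= => x'x y'y.
apply: (@le_lt_trans _ R[i] _ _ _ (normc_le _)); rewrite eE ltcR [ltRHS](splitr s).
by rewrite ltrD //= distrC.
Qed.

(** The values are bounded above on the square, and the supremum is attained,
    since otherwise every point would have a neighbourhood on which they stay
    below it by a fixed margin; both steps are [square_ind]. *)
Lemma usc_max (r : R) (K : set C) (s : C -> R) :
  K `<=` square r -> K !=set0 ->
  (forall z, ~ K z -> exists2 e : C, 0 < e & forall w, `|w| < e -> ~ K (z + w)) ->
  (forall z (d : R), 0 < d ->
     exists2 e : C, 0 < e & forall w, `|w| < e -> s (z + w) <= s z + d) ->
  exists2 c, K c & forall z, K z -> s z <= s c.
Proof.
move=> Kr K0 Kcl usc.
have [M sM] : exists M, forall z, (K `&` square r) z -> s z <= M.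
  apply: (@square_ind r (fun B => exists M, forall z, (K `&` B) z -> s z <= M)).
  - by exists 0 => z [].
  - by move=> B D BD [M DM]; exists M => z [Kz /BD Dz]; exact: DM.
  - move=> B D [M BM] [M' DM]; exists (Num.max M M') => z [Kz [Bz|Dz]].
      by rewrite le_max BM.
    by rewrite le_max DM // orbT.
  - move=> z; have [e e0 ze] := usc z 1 ltr01; exists e => //; exists (s z + 1).
    by move=> y [_ yz]; have := ze (y - z) yz; rewrite addrC subrK.
pose S := sup (s @` K).
have hS : has_sup (s @` K).
  split; first by have [z Kz] := K0; exists (s z), z.
  by exists M => _ [z Kz <-]; apply: sM; split=> //; exact: Kr.
have leS z : K z -> s z <= S by move=> Kz; apply: sup_upper_bound => //; exists z.
apply: contrapT => nomax.
have ltS z : K z -> s z < S.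
  move=> Kz; rewrite lt_neqAle leS // andbT; apply/eqP => szS; apply: nomax.
  by exists z => // y /leS; rewrite szS.
have [d d0 sd] : exists2 d, 0 < d & forall z, (K `&` square r) z -> s z <= S - d.
  apply: (@square_ind r (fun B => exists2 d, 0 < d &
    forall z, (K `&` B) z -> s z <= S - d)).
  - by exists 1 => // z [].
  - by move=> B D BD [d d0 DM]; exists d => // z [Kz /BD Dz]; exact: DM.
  - move=> B D [d d0 BM] [d' d'0 DM]; exists (Num.min d d').
      by rewrite lt_min d0.
    move=> z [Kz [Bz|Dz]].
      by apply: le_trans (BM z _) _ => //; rewrite lerD2l lerN2 ge_min lexx.
    by apply: le_trans (DM z _) _ => //; rewrite lerD2l lerN2 ge_min lexx orbT.
  - move=> z; have [Kz|Kz] := pselect (K z).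
      pose d := (S - s z) / 2%:R.
      have d0 : 0 < d by rewrite divr_gt0 // subr_gt0 ltS.
      have [e e0 ze] := usc z d d0; exists e => //; exists d => //.
      move=> y [_ yz]; have := ze (y - z) yz; rewrite addrC subrK.
      by move=> /le_trans; apply; rewrite /d; lra.
    have [e e0 ze] := Kcl z Kz; exists e => //; exists 1 => // y [Ky yz].
    by have := ze (y - z) yz; rewrite addrC subrK.
have [_ [z Kz <-]] := sup_adherent d0 hS.
by rewrite -/S ltNge sd //; split=> //; exact: Kr.
Qed.

(** If the series is not constant, its first nonconstant term a w ^ (k + 1) can
    be aligned with h c by a root of order k + 1, and for small w it dominates
    the remainder, so that |h| exceeds |h c|. *)
Lemma local_max (h : C -> C) (c : C) (f : fps C) :
  (\forall w \near (0 : C), conv f w (h (c + w))) ->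
  (forall z, `|h z| <= `|h c|) -> h c != 0 ->
  \forall w \near (0 : C), h (c + w) = h c.
Proof.
move=> /nbhs_disc[e e0 fe] hmax hc0.
have {}fe w : `|w| < e -> conv f w (h (c + w)) by move=> /fe; rewrite add0r.
have f0 : fcoef f 0%N = h c.
  have := fe 0; rewrite normr0 addr0 => /(_ e0).
  exact: conv_unique (@conv_at0 _ f).
have [[k fk]|none] := pselect (exists k, fcoef f k.+1 != 0); last first.
  apply/nbhs_disc; exists e => // w we; rewrite add0r -f0.
  apply: (conv_unique (fe w we)); apply: conv_const_tail => n.
  have /negP/negPn/eqP -> : ~ fcoef f n.+1 != 0 by move=> fn; apply: none; exists n.
  by rewrite mul0r.
have [{fk}k fk kmin] := ex_minnP (ex_intro (fun k => fcoef f k.+1 != 0) k fk).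
pose g := Fps (fun n => fcoef f (n + k.+1)%N).
have fg : f - fconst (h c) = fvar C ^+ k.+1 * g.
  apply: fpsP => -[|n]; rewrite fcoefB fcoef_const fcoefXnM /=.
    by rewrite f0 subrr.
  rewrite subr0 ltnS; case: ltnP => nk.
    by apply/eqP/negPn/negP => /kmin; rewrite leqNgt nk.
  by rewrite subSS addnS subnK.
have gc w : w != 0 -> `|w| < e -> conv g w ((h (c + w) - h c) / w ^+ k.+1).
  move=> w0 we; apply: conv_divXn => //; rewrite -fg.
  apply: conv_add; first exact: fe.
  apply: conv_opp; rewrite -[X in conv _ _ X](hornerC (h c) w).
  exact: conv_poly.
have gg : geo g.
  apply: geo_near; apply/dnbhs_disc; exists e => // w w0 we.
  by eexists; exact: gc.
have [e1 [B [e10 B0 gB]]] := conv_near gg.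
(* In the direction [zeta] the term of order [k.+1] is a positive multiple of
   [h c]. *)
pose zeta := k.+1.-root (h c / fcoef f k.+1).
have zetaE : zeta ^+ k.+1 = h c / fcoef f k.+1 by rewrite rootCK.
have zeta0 : zeta != 0.
  apply/eqP => z0; move: zetaE; rewrite z0 expr0n => /esym/eqP.
  by rewrite mulf_eq0 invr_eq0 (negPf hc0) (negPf fk).
have nz : 0 < `|zeta| by rewrite normr_gt0.
have nh : 0 < `|h c| by rewrite normr_gt0.
have [e2 [e20 e2e e2e1]] := small_pos e0 e10.
have [s1 [s10 s1a s1b]] := small_pos (divr_gt0 e20 nz)
  (divr_gt0 nh (mulr_gt0 B0 (exprn_gt0 k.+2 nz))).
have [s0 s2] := half_lt s10; set s := s1 / 2%:R in s0 s2.
pose w := s * zeta.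
have nw : `|w| = s * `|zeta| by rewrite normrM gtr0_norm.
have w0 : w != 0 by rewrite mulf_neq0 // lt0r_neq0.
have we : `|w| < e2.
  by rewrite nw -ltr_pdivlMr // (lt_le_trans s2).
have gw := gc w w0 (lt_le_trans we e2e).
have := gB w _ (le_trans (ltW we) e2e1) gw; rewrite /= add0n => err.
exfalso; have := hmax (c + w); rewrite lt_geF //.
set G := (h (c + w) - h c) / w ^+ k.+1 in err.
have hE : h (c + w) = h c * (1 + s ^+ k.+1) + w ^+ k.+1 * (G - fcoef f k.+1).
  have WG : w ^+ k.+1 * G = h (c + w) - h c by rewrite mulrC divfK ?expf_neq0.
  have WF : w ^+ k.+1 * fcoef f k.+1 = s ^+ k.+1 * h c.
    by rewrite exprMn zetaE -mulrA divfK.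
  by rewrite mulrBr WG WF; ring.
have S0 : 0 < s ^+ k.+1 by rewrite exprn_gt0.
rewrite hE; apply: lt_le_trans (lerB_normD _ _).
rewrite normrM (gtr0_norm (addr_gt0 ltr01 S0)) mulrDr mulr1 -addrA ltrDl.
rewrite subr_gt0 normrM normrX nw exprMn.
apply: le_lt_trans (ler_wpM2l _ err) _; first by rewrite ?mulr_ge0 ?exprn_ge0 ?ltW.
rewrite nw; set z := `|zeta| in nz s1a s1b *.
have -> : s ^+ k.+1 * z ^+ k.+1 * (B * (s * z)) = s ^+ k.+1 * (s * (B * z ^+ k.+2)).
  by rewrite [z ^+ k.+2]exprS; ring.
have zk : 0 < z ^+ k.+2 := exprn_gt0 _ nz.
rewrite mulrC ltr_pM2r // -ltr_pdivlMr; last exact: mulr_gt0.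
exact: lt_le_trans s2 s1b.
Qed.

Lemma continuous_at (h : C -> C) (c : C) (f : fps C) :
  (\forall w \near (0 : C), conv f w (h (c + w))) ->
  forall d : C, 0 < d -> exists2 e : C, 0 < e &
    forall w, `|w| < e -> `|h (c + w) - h c| <= d.
Proof.
move=> /nbhs_disc[e e0 fe] d d0.
have {}fe w : `|w| < e -> conv f w (h (c + w)) by move=> /fe; rewrite add0r.
have f0 : fcoef f 0%N = h c.
  have := fe 0; rewrite normr0 addr0 => /(_ e0).
  exact: conv_unique (@conv_at0 _ f).
have gf : geo f.
  by apply: geo_near; apply/dnbhs_disc; exists e => // w _ we; eexists; exact: fe.
have [e1 [B [e10 B0 fB]]] := conv_near gf.
have [e2 [e20 e2e e2e1]] := small_pos e0 e10.
have [e3 [e30 e3e2 e3d]] := small_pos e20 (divr_gt0 d0 B0).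
exists e3 => // w we; rewrite -f0; have we2 := lt_le_trans we e3e2.
apply: le_trans (fB w _ (le_trans (ltW we2) e2e1) (fe w (lt_le_trans we2 e2e))) _.
by rewrite mulrC -ler_pdivlMr // (le_trans (ltW we)).
Qed.

Lemma normC_real (z : C) : `|z| = (complex.Re (`|z| : R[i]))%:C.
Proof. by rewrite normc_def. Qed.

(** Otherwise |h| attains a positive maximum, on a compact set. Choose a point
    of largest modulus among those where the maximum is attained: by
    [local_max] h is constant near it, so the maximum is also attained at
    points further from 0. *)
Lemma vanishing_at_infinity (h : C -> C) :
  (forall c, exists f, \forall w \near (0 : C), conv f w (h (c + w))) ->
  (forall d : C, 0 < d ->
     exists2 r : C, 0 < r & forall z, r <= `|z| -> `|h z| <= d) ->
  forall z, h z = 0.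
Proof.
move=> hol lim z0; apply/eqP/negPn/negP => hz0.
pose s z : R := complex.Re (`|h z| : R[i]).
have sE z : `|h z| = (s z)%:C by exact: normC_real.
have cont c (d : R) : 0 < d ->
    exists2 e : C, 0 < e & forall w, `|w| < e -> `|s (c + w) - s c| <= d.
  move=> d0; have [f fc] := hol c.
  have d0' : (0 : R[i]) < d%:C by rewrite ltcR.
  have [e e0 he] := continuous_at fc d0'; exists e => // w we.
  rewrite -lecR; apply: le_trans (he w we).
  apply: le_trans (ler_dist_dist _ _); rewrite !sE -rmorphB.
  by rewrite normc_def /= expr0n addr0 sqrtr_sqr.
have s0 : 0 < s z0 by rewrite -ltcR -sE normr_gt0.
have [r r0 hr] := lim (s z0 / 2%:R)%:C ltac:(by rewrite ltcR divr_gt0).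
have [rho rho0 rE] := ltC_real r0.
pose K : set C := fun z => s z0 <= s z.
have Kr : K `<=` square rho.
  move=> z; rewrite /K => Kz; suff zr : complex.Re (`|z| : R[i]) < rho.
    split; rewrite -lecR.
      by apply: le_trans (normc_ge_Re z) _; rewrite normC_real lecR ltW.
    by apply: le_trans (normc_ge_Im z) _; rewrite normC_real lecR ltW.
  rewrite ltNge; apply/negP => rz; have := hr z; rewrite rE normC_real lecR rz.
  by rewrite sE lecR => /(_ isT); move: Kz s0; lra.
have [c Kc cmax] : exists2 c, K c & forall z, K z -> s z <= s c.
  apply: (usc_max Kr); first by exists z0; rewrite /K.
    move=> z /negP; rewrite -ltNge => zK.
    have [e e0 ze] := cont z ((s z0 - s z) / 2%:R) ltac:(by rewrite divr_gt0 // subr_gt0).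
    exists e => // w /ze; rewrite ler_distl /K => /andP[_ le1].
    by apply/negP; rewrite -ltNge; move: le1 zK; lra.
  move=> z d d0; have [e e0 ze] := cont z d d0; exists e => // w /ze.
  by rewrite ler_distl => /andP[].
have {}cmax z : s z <= s c.
  have [Kz|Kz] := lerP (s z0) (s z); first exact: cmax.
  by apply: le_trans (ltW Kz) _.
pose K2 : set C := fun z => s z = s c.
pose t (z : C) : R := complex.Re (`|z| : R[i]).
have tE z : `|z| = (t z)%:C by exact: normC_real.
have [c2 c2K c2max] : exists2 c2, K2 c2 & forall z, K2 z -> t z <= t c2.
  apply: (@usc_max rho).
  - by move=> z zK; apply: Kr; rewrite /K zK.
  - by exists c.
  - move=> z zK; have zc : s z < s c by rewrite lt_neqAle cmax andbT; apply/eqP.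
    have [e e0 ze] := cont z ((s c - s z) / 2%:R) ltac:(by rewrite divr_gt0 // subr_gt0).
    exists e => // w /ze; rewrite ler_distl /K2 => /andP[_ le1] zwc.
    by move: le1 zc; rewrite zwc; lra.
  - move=> z d d0; have d0' : (0 : R[i]) < d%:C by rewrite ltcR.
    exists d%:C => // w wd; rewrite -lecR rmorphD /= -!tE.
    by apply: le_trans (ler_normD _ _) _; rewrite lerD2l ltW.
have [f fc] := hol c2.
have hc2 : h c2 != 0.
  rewrite -normr_gt0 sE ltcR c2K; exact: lt_le_trans s0 Kc.
have : \forall w \near (0 : C), h (c2 + w) = h c2.
  by apply: (local_max fc) => // z; rewrite !sE lecR c2K.
move=> /nbhs_disc[e e0 hc]; have [h0 h1] := half_lt e0.
(* [c2] is as far from 0 as possible, yet moving outwards stays in the set. *)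
have out w : `|w| < e -> (`|c2 + w| <= `|c2|).
  move=> we; rewrite !tE lecR; apply: c2max; rewrite /K2 -c2K.
  by apply: complexI; rewrite -!sE; have := hc w we; rewrite add0r => ->.
have [c20|c20] := eqVneq c2 0.
  have := out (e / 2%:R); rewrite c20 add0r normr0 gtr0_norm // => /(_ h1).
  by rewrite lt_geF.
have nc : 0 < `|c2| by rewrite normr_gt0.
have d0 : 0 < e / 2%:R / `|c2| by rewrite divr_gt0.
have := out (e / 2%:R / `|c2| * c2); rewrite normrM gtr0_norm // divfK ?gt_eqF //.
move=> /(_ h1); rewrite -{1}(mul1r c2) -mulrDl normrM.
rewrite gtr0_norm ?addr_gt0 // -[leRHS]mul1r ler_pM2r // gerDl.
by rewrite lt_geF.
Qed.
End Compactness.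

(** * Poles are isolated, and the differential is rational *)

Section Poles.
Variable C : numClosedFieldType.

Lemma laurent_bound (g : C -> C) m a : laurent g m a ->
  exists e K : C, [/\ 0 < e, 0 < K &
    forall w, w != 0 -> `|w| < e -> `|g w| <= K * `|w ^ m|].
Proof.
move=> /laurentE ga.
have geoa : geo (Fps a) by apply: geo_near; apply: filterS ga => w; eexists; eassumption.
have [e [B [e0 B0 near_a]]] := conv_near geoa.
move/dnbhs_disc: ga => [e1 e10 ga]; have [e2 [e20 e2e e2e1]] := small_pos e0 e10.
exists e2, (`|a 0%N| + B * e2); split=> //.
  by rewrite ltr_wpDl // mulr_gt0.
move=> w w0 we; have gw := ga w w0 (lt_le_trans we e2e1).
have := near_a w _ (le_trans (ltW we) e2e) gw; rewrite /= => le1.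
have -> : g w = w ^ (- m) * g w * w ^ m.
  by rewrite mulrAC -expfzDr // addNr mul1r.
rewrite normrM ler_wpM2r // -[X in `|X|](subrK (a 0%N)) addrC.
apply: le_trans (ler_normD _ _) _; rewrite lerD2l; apply: le_trans le1 _.
by rewrite ler_wpM2l ?ltW.
Qed.

Lemma exprz_bounded (z : C) (k : int) : z != 0 -> exists e K : C,
  [/\ 0 < e, 0 < K & forall w, `|w| < e -> z + w != 0 /\ `|(z + w) ^ k| <= K].
Proof.
move=> z0; have nz : 0 < `|z| by rewrite normr_gt0.
have [h0 h1] := half_lt nz; set r := `|z| / 2%:R in h0 h1.
have zE : `|z| = r + r by rewrite -splitr.
have low w : `|w| < r -> r <= `|z + w|.
  move=> wr; apply: le_trans (lerB_normD _ _); rewrite zE -addrA lerDl subr_ge0.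
  exact: ltW.
have up w : `|w| < r -> `|z + w| <= `|z| + r.
  by move=> wr; apply: le_trans (ler_normD _ _) _; rewrite lerD2l ltW.
have nzw w : `|w| < r -> z + w != 0.
  by move=> /low zw; rewrite -normr_gt0; exact: lt_le_trans zw.
case: k => n.
  exists r, ((`|z| + r) ^+ n); split=> //; first by rewrite exprn_gt0 ?addr_gt0.
  move=> w wr; split; first exact: nzw.
  by rewrite -exprnP normrX lerXn2r ?nnegrE ?addr_ge0 ?up // ltW.
exists r, (r ^+ n.+1)^-1; split=> //; first by rewrite invr_gt0 exprn_gt0.
move=> w wr; split; first exact: nzw.
rewrite NegzE -exprnN normfV normrX lef_pV2 ?posrE ?exprn_gt0 ?normr_gt0 ?nzw //.
by rewrite lerXn2r ?nnegrE ?low // ltW.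
Qed.

(** A pole is unbounded; the lemma turns growth estimates into the isolation
    of poles. *)
Lemma bounded_not_pole (phi : C -> C) (z e K : C) : 0 < e -> 0 < K ->
  (forall w, w != 0 -> `|w| < e -> `|phi (z + w)| <= K) -> ~ is_pole phi (Some z).
Proof.
move=> e0 K0 bd [k [k0 [a /laurentE ga a0]]]; case: k k0 ga => [//|k] _ ga.
have geoa : geo (Fps a) by apply: geo_near; apply: filterS ga => w; eexists; eassumption.
have [e1 [B [e10 B0 near_a]]] := conv_near geoa.
have [e2 [e20 e2e e2e1]] := small_pos e0 e10.
have [e3 [e30 e3e2 e31]] := small_pos e20 (@ltr01 C).
rewrite -normr_gt0 in a0; have [h0 h1] := half_lt a0.
have KB : 0 < K + B by rewrite addr_gt0.
have [e4 [e40 e4e3 e4a]] := small_pos e30 (divr_gt0 h0 KB).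
have [e5 e51] := half_lt e40.
have [w [w0 we gw]] := dnbhs_point e5 ga.
have {}we : `|w| < e4 := le_lt_trans we e51.
have we2 : `|w| < e2 := lt_le_trans we (le_trans e4e3 e3e2).
have := near_a w _ (ltW (lt_le_trans we2 e2e1)) gw; rewrite /= opprK -exprnP.
rewrite distrC => le1.
have : `|a 0%N| <= (K + B) * `|w|.
  rewrite -[X in `|X|](subrK (w ^+ k.+1 * phi (z + w))).
  apply: le_trans (ler_normD _ _) _; rewrite mulrDl addrC lerD //.
  rewrite normrM mulrC ler_pM ?bd ?(lt_le_trans we2) // normrX exprS.
  by rewrite ler_piMr // exprn_ile1 // ltW // (lt_le_trans we) // (le_trans e4e3).
rewrite lt_geF //; apply: le_lt_trans h1.
by rewrite mulrC -ler_pdivlMr // (le_trans (ltW we)).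
Qed.

(** Near c the differential is dominated by a power of the distance to c, hence
    is bounded near every other point of a disc. *)
Lemma isolated_pole (phi : C -> C) (c : C) m a :
  laurent (fun w => phi (c + w)) m a ->
  \forall w \near (0 : C)^', ~ is_pole phi (Some (c + w)).
Proof.
move=> /laurent_bound[e [K [e0 K0 bd]]]; apply/dnbhs_disc; exists e => // w w0 we.
have [e1 [M [e10 M0 zM]]] := exprz_bounded m w0.
have e2 : 0 < e - `|w| by rewrite subr_gt0.
have [e3 [e30 e3e1 e3e2]] := small_pos e10 e2.
apply: (@bounded_not_pole _ _ e3 (K * M)) => //; first exact: mulr_gt0.
move=> u u0 ue; have [wu wuM] := zM u (lt_le_trans ue e3e1).
rewrite -addrA; apply: le_trans (bd _ wu _) _.
  apply: le_lt_trans (ler_normD _ _) _; rewrite -ltrBrDl.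
  exact: lt_le_trans ue e3e2.
by rewrite ler_wpM2l // ltW.
Qed.

Lemma isolated_infty (phi : C -> C) m a : laurent (qd_local phi None) m a ->
  \forall w \near (0 : C)^', ~ is_pole phi (Some w^-1).
Proof.
move=> /laurent_bound[e [K [e0 K0 bd]]]; apply/dnbhs_disc; exists e => // w w0 we.
have wV0 : w^-1 != 0 by rewrite invr_eq0.
have [e1 [M [e10 M0 zM]]] := exprz_bounded (- (m + 4)) wV0.
have e2 : 0 < `|w^-1| - e^-1.
  by rewrite subr_gt0 normfV ltf_pV2 ?posrE ?normr_gt0.
have [e3 [e30 e3e1 e3e2]] := small_pos e10 e2.
apply: (@bounded_not_pole _ _ e3 (K * M)) => //; first exact: mulr_gt0.
move=> u u0 ue; have [y0 yM] := zM u (lt_le_trans ue e3e1).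
set y := w^-1 + u in y0 yM *.
have yV0 : y^-1 != 0 by rewrite invr_eq0.
have ye : `|y^-1| < e.
  rewrite normfV -[e]invrK ltf_pV2 ?posrE ?invr_gt0 ?normr_gt0 //.
  apply: lt_le_trans (lerB_normD _ _); rewrite ltrBrDr -ltrBrDl.
  exact: lt_le_trans ue e3e2.
have := bd _ yV0 ye; rewrite /= invrK => le1.
have -> : phi y = phi y * y^-1 ^- 4 * y^-1 ^+ 4.
  by rewrite divfK // expf_neq0.
rewrite normrM; apply: le_trans (ler_wpM2r (normr_ge0 _) le1) _.
rewrite -mulrA -normrM ler_wpM2l ?(ltW K0) // exprnP -expfzDr // exprz_inv.
exact: yM.
Qed.
End Poles.

Section Rationality.
Variables (R : realType) (phi : CC R -> CC R).
Local Notation C := (CC R).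
Hypothesis mero : meromorphic_quad_diff phi.

Lemma laurent_finite c : exists m a, laurent (fun w => phi (c + w)) m a.
Proof.
have [[hol|[k [_ [a ga _]]]] _] := (mero.1 c, tt); last by exists (- k%:Z), a.
have [a /nbhs_disc[e e0 ha]] := hol; exists 0, a; apply/dnbhs_disc.
exists e => // w _ we; rewrite oppr0 expr0z mul1r.
by have := ha w we; rewrite add0r.
Qed.

Lemma poles_isolated c : \forall w \near (0 : C)^', ~ is_pole phi (Some (c + w)).
Proof. by have [m [a ga]] := laurent_finite c; exact: isolated_pole ga. Qed.

(** Poles do not accumulate at infinity, so they all lie in a square, and each
    point of the square has a neighbourhood with at most one pole. *)
Lemma finite_poles : exists2 s : seq C, uniq s &
  forall c, c \in s <-> is_pole phi (Some c).
Proof.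
have [m [a ga]] := mero.2; have /dnbhs_disc[e e0 inf] := isolated_infty ga.
have [r r0 eE] : exists2 r : R, 0 < r & e^-1 = (r%:C)%C.
  by apply: ltC_real; rewrite invr_gt0.
pose P (B : set C) := exists s : seq C, forall z, B z -> is_pole phi (Some z) -> z \in s.
have [s sP] : P (square r).
  apply: square_ind.
  - by exists [::].
  - by move=> B D BD [s sP]; exists s => z /BD; exact: sP.
  - move=> B D [s sP] [s' s'P]; exists (s ++ s') => z [Bz|Dz] pz; rewrite mem_cat.
      by rewrite sP.
    by rewrite s'P // orbT.
  - move=> z; have /dnbhs_disc[e' e'0 iso] := poles_isolated z; exists e' => //.
    exists [:: z] => y ye py; rewrite inE; apply/negPn/negP => yz.
    have yz0 : y - z != 0 by rewrite subr_eq0.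
    have := iso _ yz0 ye; rewrite [z + _]addrC subrK => npy; exact: npy py.
have inS z : is_pole phi (Some z) -> z \in s.
  move=> pz; apply: (sP z _ pz).
  have zr : `|z| <= (r%:C)%C :> C.
    have [->|z0] := eqVneq z 0; first by rewrite normr0 -eE invr_ge0 ltW.
    have zV0 : z^-1 != 0 by rewrite invr_eq0.
    have rr : `|z| \is Num.real by rewrite normr_real.
    have er : e^-1 \is Num.real by rewrite gtr0_real // invr_gt0.
    rewrite -eE real_leNgt //; apply/negP => ez; apply: (inf _ zV0).
      by rewrite normfV -[e]invrK ltf_pV2 // posrE ?invr_gt0 ?normr_gt0.
    by rewrite invrK.
  split; rewrite -lecR; first exact: le_trans (normc_ge_Re z) zr.
  exact: le_trans (normc_ge_Im z) zr.
exists (undup [seq c <- s | `[< is_pole phi (Some c) >]]); first exact: undup_uniq.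
move=> c; rewrite mem_undup mem_filter; split=> [/andP[/asboolP]//|pc].
by rewrite inS // andbT; apply/asboolP.
Qed.

(** The function beta ^ 2 phi extends to an entire function F, and near
    infinity w ^ (2 N) F (1 / w) is a power series without terms of order 0 and 1.
    Reversing its truncation yields a polynomial A such that F - A is entire and
    tends to 0 at infinity, hence is 0. *)
Lemma rational_form :
  (forall c, is_pole phi (Some c) ->
     exists a, laurent (qd_local phi (Some c)) (- 2%:Z) a) ->
  (exists a, laurent (qd_local phi None) (- 2%:Z) a) ->
  exists (s : seq C) (A : {poly C}), [/\ uniq s,
    forall c, c \in s <-> is_pole phi (Some c),
    (size A <= 2 * size s - 1)%N &
    forall z, z \notin s -> (beta s).[z] ^+ 2 * phi z = A.[z]].
Proof.
move=> two_fin [a0 ga0]; have [s us sP] := finite_poles.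
pose N := size s; exists s.
have [alpha alphaP] : exists alpha : C -> fps C, forall c, c \in s ->
    \forall w \near (0 : C)^', conv (alpha c) w (w ^+ 2 * phi (c + w)).
  have /boolp.choice[al alP] : forall c, exists f : fps C, c \in s ->
      \forall w \near (0 : C)^', conv f w (w ^+ 2 * phi (c + w)).
    move=> c; have [cs|cs] := pselect (c \in s); last by exists 0 => /cs [].
    have [a /laurentE ga] := two_fin c ((sP c).1 cs).
    by exists (Fps a) => _; apply: filterS ga => w; rewrite opprK -exprnP.
  by exists al.
(* At a pole the value of phi carries no information, so the limit is used. *)
pose F z := if z \in s then (betac s z).[z] ^+ 2 * fcoef (alpha z) 0%N
            else (beta s).[z] ^+ 2 * phi z.
have shiftE (p : {poly C}) c w : (p \Po ('X + c%:P)).[w] = p.[c + w].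
  by rewrite horner_comp hornerD hornerX hornerC addrC.
have holF c : exists f, \forall w \near (0 : C), conv f w (F (c + w)).
  have /dnbhs_disc[e e0 iso] := poles_isolated c.
  have nots w : w != 0 -> `|w| < e -> c + w \notin s.
    by move=> w0 we; apply/negP => /sP; exact: iso.
  have [cs|cs] := boolP (c \in s).
    have /dnbhs_disc[e1 e10 al] := alphaP c cs.
    have [e2 [e20 e2e e2e1]] := small_pos e0 e10.
    exists (atp c (betac s c ^+ 2) * alpha c); apply/nbhs_disc; exists e2 => // w we.
    rewrite add0r; have [->|w0] := eqVneq w 0.
      rewrite addr0 /F cs -horner_exp -fcoef_atp0 -fcoefM0; exact: conv_at0.
    rewrite /F (negPf (nots w w0 (lt_le_trans we e2e))).
    have := @conv_polyM _ ((betac s c ^+ 2) \Po ('X + c%:P)) _ _ _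
      (al w w0 (lt_le_trans we e2e1)).
    rewrite shiftE horner_exp (beta_split us cs) hornerM hornerXsubC.
    by rewrite addrAC subrr add0r exprMn mulrA [_ ^+ 2 * w ^+ 2]mulrC.
  have [[a /nbhs_disc[e1 e10 al]]|/sP] := mero.1 c; last by rewrite (negPf cs).
  have [e2 [e20 e2e e2e1]] := small_pos e0 e10.
  exists (atp c (beta s ^+ 2) * Fps a); apply/nbhs_disc; exists e2 => // w we.
  have := al w (lt_le_trans we e2e1); rewrite convE !add0r => aw.
  have := @conv_polyM _ ((beta s ^+ 2) \Po ('X + c%:P)) _ _ _ aw.
  rewrite shiftE horner_exp /F ifF //; have [->|w0] := eqVneq w 0.
    by rewrite addr0; apply/negbTE.
  by apply/negbTE; apply: nots => //; exact: lt_le_trans we e2e.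
pose b := polyrev N (beta s).
pose c := fpoly ('X^2 * b ^+ 2) * Fps a0.
have sb : (size (beta s) <= N.+1)%N by rewrite size_beta.
have cF : \forall w \near (0 : C)^', conv c w (w ^+ (N + N) * F w^-1).
  have Fz : Filter (0 : C)^' by apply: within_filter.
  have ga := (laurentE _ _ _).1 ga0; have nopole := isolated_infty ga0.
  apply: (@filterS3 _ _ Fz _ _ _ _ _ (near_neq0 R) nopole ga) => w w0 iso aw.
  have ns : (w^-1 \in s) = false.
    apply/negP => wi.
    exact: iso ((sP _).1 wi).
  suff -> : w ^+ (N + N) * F w^-1 =
      ('X^2 * b ^+ 2).[w] * (w ^ (- - 2%:Z) * qd_local phi None w).
    exact: conv_polyM aw.
  rewrite /F ns hornerM hornerXn horner_exp horner_rev // opprK -exprnP /=.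
  by rewrite exprD; field.
have c01 : fcoef c 0%N = 0 /\ fcoef c 1%N = 0.
  by rewrite /c rmorphM rmorphXn -mulrA !fcoefXnM.
pose A := polyrev (N + N) (ftrunc (N + N).+1 c).
have sA' : (size (ftrunc (N + N).+1 c) <= (N + N).+1)%N by exact: size_poly.
have Ac : polyrev (N + N) A = ftrunc (N + N).+1 c.
  apply/polyP => i; rewrite coef_rev; case: leqP => iN.
    by rewrite coef_rev leq_subr subKn.
  by rewrite nth_default // (leq_trans sA').
have sAN : (size A <= (N + N).+1)%N by exact: size_poly.
exists A; split=> //.
  apply/leq_sizeP => j Nj; rewrite coef_rev; case: leqP => // jN.
  have : (N + N - j < 2)%N by rewrite /N; lia.
  have ltj : (N + N - j < (N + N).+1)%N by rewrite ltnS leq_subr.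
  rewrite coef_ftrunc //; case: (N + N - j)%N => [|[|]] // _; first exact: c01.1.
  exact: c01.2.
suff FA z : F z - A.[z] = 0.
  by move=> z zs; have /eqP := FA z; rewrite subr_eq0 /F (negPf zs) => /eqP.
move: z; apply: vanishing_at_infinity => [z|d d0].
  have [f /nbhs_disc[e e0 fF]] := holF z; exists (f - atp z A).
  apply/nbhs_disc; exists e; first exact: e0.
  move=> w we.
  have Aw := @conv_poly _ (A \Po ('X + z%:P)) w; rewrite shiftE in Aw.
  have := fF w we; rewrite add0r => fw.
  exact: conv_add fw (conv_opp Aw).
pose g := Fps (fun n => fcoef c (n + (N + N).+1)%N).
have cg : c - fpoly (ftrunc (N + N).+1 c) = fvar C ^+ (N + N).+1 * g.
  apply: fpsP => n; rewrite fcoefB fcoefXnM fcoef_poly coef_poly.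
  by case: ltnP => nN; rewrite ?subrr // subr0 /= subnK.
have gconv : \forall w \near (0 : C)^', conv g w ((F w^-1 - A.[w^-1]) / w).
  have Fz : Filter (0 : C)^' by apply: within_filter.
  apply: (@filterS2 _ _ Fz _ _ _ _ (near_neq0 R) cF) => w w0 cw.
  have -> : (F w^-1 - A.[w^-1]) / w =
      (w ^+ (N + N) * F w^-1 - (polyrev (N + N) A).[w]) / w ^+ (N + N).+1.
    rewrite horner_rev // -mulrBr exprSr invfM [w ^+ _ * _]mulrC mulrA.
    by rewrite mulfK // expf_neq0.
  apply: conv_divXn; first exact: w0.
  by rewrite -cg Ac; exact: conv_add cw (conv_opp (@conv_poly _ _ _)).
have gg : geo g.
  by have [w [w0 _ gw]] := dnbhs_point (@ltr01 C) gconv; exact: conv_geo w0 gw.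
have [e [B [e0 B0 near_g]]] := conv_near gg.
move/dnbhs_disc: gconv => [e1 e10 gconv].
pose K := `|fcoef g 0%N| + B * e + 1.
have K0 : 0 < K by rewrite ltr_wpDl // addr_ge0 // mulr_ge0 // ltW.
have [e2 [e20 e2e e2e1]] := small_pos e0 e10.
have [e3 [e30 e3e2 e3d]] := small_pos e20 (divr_gt0 d0 K0).
have [h0 h1] := half_lt e30.
exists (e3 / 2%:R)^-1; first by rewrite invr_gt0.
move=> z zr; have z0 : z != 0.
  by rewrite -normr_gt0; apply: lt_le_trans zr; rewrite invr_gt0.
pose w := z^-1; have w0 : w != 0 by rewrite invr_eq0.
have we : `|w| < e3.
  apply: le_lt_trans h1; rewrite normfV -[leRHS]invrK lef_pV2 ?posrE ?invr_gt0 //.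
  by rewrite normr_gt0.
have we2 := lt_le_trans we e3e2.
have gw := gconv w w0 (lt_le_trans we2 e2e1).
have := near_g w _ (ltW (lt_le_trans we2 e2e)) gw; rewrite invrK => le1.
have -> : F z - A.[z] = (F z - A.[z]) * z * w by rewrite mulfK.
rewrite normrM; apply: le_trans (_ : K * `|w| <= _).
  rewrite ler_wpM2r // -[X in `|X|](subrKC (fcoef g 0%N)).
  apply: le_trans (ler_normD _ _) _; rewrite /K -addrA lerD2l.
  apply: le_trans le1 _; apply: le_trans (_ : B * e <= _); last by rewrite lerDl.
  by rewrite ler_wpM2l ?(ltW B0) // ltW // (lt_le_trans we2).
by rewrite mulrC -ler_pdivlMr // (le_trans (ltW we)).
Qed.
End Rationality.

(** * Orders of poles *)

Section PoleOrders.
Variable C : numClosedFieldType.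

Lemma indicial_eq0 (d : nat) : (0 < d)%N ->
  (1 - d%:R ^+ 2) / 2%:R = 0 :> C -> d = 1%N.
Proof.
move=> d0 /eqP; rewrite mulf_eq0 invr_eq0 pnatr_eq0 orbF subr_eq0.
rewrite -natrX (eqr_nat C 1 (d ^ 2)) => /eqP d1.
by move: d0 d1; case: d => [|[|d]] // _; rewrite expnS expn1; lia.
Qed.

Lemma indicial_inj (d d' : nat) :
  (1 - d%:R ^+ 2) / 2%:R = (1 - d'%:R ^+ 2) / 2%:R :> C -> d = d'.
Proof.
move=> /(mulIf _) e; have {e} /eqP : 1 - d%:R ^+ 2 = 1 - d'%:R ^+ 2 :> C.
  by apply: e; rewrite invr_eq0 pnatr_eq0.
rewrite (inj_eq (addrI _)) eqr_opp -!natrX eqr_nat eqn_exp2r // => /eqP.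
exact.
Qed.

Lemma star_pole (phi : C -> C) p d : (2 <= d)%N -> star phi p d ->
  pole_of_order phi p 2.
Proof.
move=> d2 [a [ga a0 _]]; split=> //; exists a => //; rewrite a0; apply/eqP.
by move=> e; move: (d2); rewrite (indicial_eq0 (ltnW d2) e).
Qed.

(** For d = 1 the condition says that the coefficients of orders -2 and -1 both
    vanish, so that there is no pole; for d > 1 the one of order -2 does not
    vanish. *)
Lemma pole_star (phi : C -> C) p d k : (0 < d)%N -> star phi p d ->
  pole_of_order phi p k -> k = 2%N /\ (2 <= d)%N.
Proof.
move=> d0 [a [ga a0 ad]] [k0 [b gb b0]].
have d1 : a 0%N = 0 -> d = 1%N by rewrite a0; exact: indicial_eq0.
have a1 : a 0%N = 0 -> a 1%N = 0.
  by move=> /d1 dE; move: ad; rewrite dE => /Ymx_eval1; rewrite det_Ymx1; exact.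
case: k k0 gb => [|[|k]] // _ gb.
  have := @laurent_shift _ _ (- 2%:Z) 1 a b ga gb.
  rewrite expr1 => ab; have a00 : a 0%N = 0.
    by have := congr1 (fun f => fcoef f 0%N) ab; rewrite fcoefXM.
  have := congr1 (fun f => fcoef f 1%N) ab; rewrite fcoefXM /= a1 // => b00.
  by rewrite -b00 eqxx in b0.
have := @laurent_shift _ _ (- (k.+2)%:Z) k b a gb.
rewrite (_ : - (k.+2)%:Z + k%:Z = - 2%:Z); last by lia.
move=> /(_ ga) ba; have := congr1 (fun f => fcoef f 0%N) ba; rewrite fcoefXnM.
case: k {gb ba} => [|k] /= b00; last by rewrite b00 eqxx in b0.
split=> //; rewrite ltn_neqAle d0 andbT; apply/eqP => d1E.
by rewrite b00 a0 -d1E expr1n subrr mul0r eqxx in b0.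
Qed.

(** The first nonzero Laurent coefficient would give a pole if its order were
    negative. *)
Lemma nonpole_expansion (phi : C -> C) p :
  (exists m a, laurent (qd_local phi p) m a) -> ~ is_pole phi p ->
  exists a, [/\ laurent (qd_local phi p) (- 2%:Z) a, a 0%N = 0 & a 1%N = 0].
Proof.
move=> [m [a ga]] np.
have [[j aj]|none] := pselect (exists j, a j != 0); last first.
  exists (fun=> 0); split=> //; apply/laurentE; move/laurentE: ga.
  rewrite (_ : Fps a = 0) => [|]; last first.
    by apply: fpsP => n; apply/eqP/negPn/negP => an; apply: none; exists n.
  move=> /dnbhs_disc[e e0 ga]; apply/dnbhs_disc; exists e => // w w0 we.
  have := conv_unique (ga w w0 we) (@conv_zero _ w) => /eqP.
  rewrite mulf_eq0 (negPf (expfz_neq0 _ w0)) /= => /eqP ->; rewrite mulr0.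
  exact: conv_zero.
have [{aj}j aj jmin] := ex_minnP (ex_intro (fun j => a j != 0) j aj).
pose b := Fps (fun n => a (n + j)%N).
have ab : Fps a = fvar C ^+ j * b.
  apply: fpsP => n; rewrite fcoefXnM /=; case: ltnP => nj; last by rewrite subnK.
  by apply/eqP/negPn/negP => /jmin; rewrite leqNgt nj.
have gb : laurent (qd_local phi p) (m + j%:Z) (fcoef b).
  apply/laurentE; move/laurentE: ga => /dnbhs_disc[e e0 ga].
  apply/dnbhs_disc; exists e => // w w0 we.
  have := ga w w0 we; rewrite ab => /(conv_divXn w0).
  rewrite mulrAC exprnN -expfzDr // -opprD.
  by rewrite (_ : Fps _ = b) //; apply: fpsP.
case mj : (m + j%:Z) gb => [n|k] gb; last first.
  exfalso; apply: np; exists k.+1; split=> //; exists (fcoef b) => //.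
exists (fcoef (fvar C ^+ n.+2 * b)); split; [|by rewrite fcoefXnM|by rewrite fcoefXnM].
apply/laurentE; move/laurentE: gb => /dnbhs_disc[e e0 gb].
apply/dnbhs_disc; exists e => // w w0 we.
rewrite (_ : Fps _ = fpoly 'X^(n.+2) * Fps (fcoef b)); last first.
  by rewrite rmorphXn; apply: fpsP.
suff -> : w ^ (- - 2%:Z) * qd_local phi p w =
    'X^(n.+2).[w] * (w ^ (- n%:Z) * qd_local phi p w).
  exact: conv_polyM (gb w w0 we).
rewrite hornerXn opprK -exprnP -exprnN mulrA; congr (_ * _).
by rewrite -[n.+2]/(2 + n)%N exprD mulfK // expf_neq0.
Qed.
End PoleOrders.

(** * Both directions of the theorem *)

Lemma free_X_1 (F : fieldType) (a b : F) :
  a *: 'X + b *: 1 = 0 -> a = 0 /\ b = 0.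
Proof.
move=> E; have ab i := congr1 (fun p : {poly F} => p`_i) E.
split; [have := ab 1%N|have := ab 0%N];
  by rewrite coefD !coefZ coefX coef1 coef0 !(mulr0, mulr1, addr0, add0r).
Qed.

Section Conclusions.
Variables (R : realType) (phi : CC R -> CC R).
Local Notation C := (CC R).
Hypothesis mero : meromorphic_quad_diff phi.

Lemma nonconstant_wron (P Q : {poly C}) : coprimep P Q ->
  ~ constant_map (ratmap P Q) -> wron P Q != 0.
Proof.
move=> co nc; apply/eqP => W0; have [sP sQ] := wron_eq0 co W0.
apply: nc; exists (if Q`_0 == 0 then None else Some (P`_0 / Q`_0)) => -[z|] /=.
  by rewrite (size1_polyC sP) (size1_polyC sQ) !hornerC !coefC.
suff -> : (maxn (size P) (size Q)).-1 = 0%N by [].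
by apply/eqP; rewrite -subn1 subn_eq0 geq_max sP.
Qed.

Lemma local_degree_nonconstant (f : sphere C -> sphere C) p d :
  local_degree f p d -> ~ constant_map f.
Proof.
move=> [_ [a /laurentE fa a0]] [v fv].
have z0 q : coord_at q q = 0 :> C by case: q => [b|] //=; rewrite subrr.
suff a00 : Fps a = 0.
  by have := congr1 (fun g => fcoef g 0%N) a00 => /= a00'; rewrite a00' eqxx in a0.
apply: conv_eq0; move/dnbhs_disc: fa => [e e0 fa].
apply/dnbhs_disc; exists e; first exact: e0.
move=> w w0 we; have := fa w w0 we; rewrite !fv z0 mulr0; exact: id.
Qed.

Lemma is_schw_local (P Q : {poly C}) p : wron P Q != 0 ->
  (forall z, ~ is_pole phi (Some z) -> (wron P Q).[z] != 0 ->
     2%:R * phi z * (wron P Q).[z] ^+ 2 = (schw P Q).[z]) ->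
  \forall w \near (0 : C)^', forall z, point_at p w = Some z ->
    2%:R * phi z * (wron P Q).[z] ^+ 2 = (schw P Q).[z].
Proof.
move=> W0 H; have Fz : Filter (0 : C)^' by apply: within_filter.
case: p => [c|].
  have /dnbhs_disc_at Wc := horner_dnbhs_neq0 c W0.
  apply: (@filterS2 _ _ Fz _ _ _ _ (poles_isolated mero c) Wc) => w np Ww z [<-].
  exact: H.
have [m [a ga]] := mero.2.
pose W := wron P Q; pose V := polyrev (size W) W.
have sW : (size W <= (size W).+1)%N by [].
have V0 : V != 0.
  apply: contra W0 => /eqP V0; apply/eqP/poly_eq_nonzero => z z0; rewrite horner0.
  have := @horner_rev _ _ W z^-1 sW; rewrite -/V V0 horner0 invrK invr_eq0.
  move=> /(_ z0) /esym/eqP; rewrite mulf_eq0 expf_eq0 invr_eq0 (negPf z0) andbF.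
  by move/eqP.
apply: (@filterS3 _ _ Fz _ _ _ _ _ (near_neq0 R) (isolated_infty ga)
  (horner_near_neq0 V0)) => w w0 np Vw z.
rewrite /point_at (negPf w0) => -[<-]; apply: H => //.
by apply: contra Vw => /eqP e; rewrite horner_rev // -/W e mulr0.
Qed.

(** Off the poles of phi and the zeros of the Wronskian, phi is schw P Q over
    2 W ^ 2, so [schwarz_local] applies at every point of the sphere. *)
Lemma schwarzian_part_a (f : sphere C -> sphere C) :
  rational_map f -> ~ constant_map f -> is_schwarzian phi f ->
  (forall p k, pole_of_order phi p k -> k = 2%N) /\
  (forall p d, (2 <= d)%N -> local_degree f p d -> star phi p d).
Proof.
move=> [P [Q [co fPQ]]] nc fS; have fE : f = ratmap P Q by apply/funext.
rewrite {}fE in nc fS *; have W0 := nonconstant_wron co nc.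
have loc p : exists d, [/\ local_degree (ratmap P Q) p d, star phi p d
    & forall c, p = Some c -> d = 1%N -> (wron P Q).[c] != 0].
  apply: schwarz_local => //; apply: is_schw_local => // z np Wz.
  rewrite fS // schwarzian_ratmap //; field.
  by rewrite Wz.
split=> [p k pk|p d d2 fd].
  have [d [[d0 _] sd _]] := loc p.
  by have [] := pole_star d0 sd pk.
have [d' [[d'0 od'] sd' _]] := loc p.
by case: (order_uniq fd.2 od') => ->.
Qed.

(** Once phi is given by coprime polynomials P and Q, [schwarz_local] describes
    phi at every point, the exceptional pole included. The poles are the points
    of local degree at least 2, and the leading coefficient determines the
    degree. *)
Lemma schwarzian_from_form (s : seq C) (A P Q : {poly C}) :
  (forall c, c \in s <-> is_pole phi (Some c)) ->
  (forall z, z \notin s -> (beta s).[z] ^+ 2 * phi z = A.[z]) ->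
  coprimep P Q -> wron P Q != 0 ->
  beta s ^+ 2 * schw P Q = 2%:R * A * wron P Q ^+ 2 ->
  let f := ratmap P Q in
  (forall p, is_pole phi p -> exists2 d, (2 <= d)%N & star phi p d) /\
  [/\ rational_map f, ~ constant_map f, is_schwarzian phi f,
      (forall p, critical_point f p <-> is_pole phi p)
    & forall p d, (2 <= d)%N -> is_pole phi p -> star phi p d ->
        local_degree f p d].
Proof.
move=> sP phiA co W0 SA f.
have phiS z : ~ is_pole phi (Some z) ->
    2%:R * phi z * (wron P Q).[z] ^+ 2 = (schw P Q).[z].
  move=> np; have zs : z \notin s by apply/negP => /sP.
  have b0 : (beta s).[z] ^+ 2 != 0.
    rewrite expf_neq0 // horner_prod prodf_seq_neq0; apply/allP => c cs /=.
    rewrite hornerXsubC subr_eq0; apply/eqP => zc; rewrite zc in zs.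
    by rewrite cs in zs.
  apply: (mulfI b0); have := congr1 (fun p : {poly C} => p.[z]) SA.
  rewrite -polyC_natr !(hornerM, horner_exp, hornerC) -phiA // => ->.
  by ring.
have loc p : exists d, [/\ local_degree f p d, star phi p d
    & forall c, p = Some c -> d = 1%N -> (wron P Q).[c] != 0].
  by apply: schwarz_local => //; apply: is_schw_local => // z np _; exact: phiS.
split.
  move=> p [k pk]; have [d [[d0 _] sd _]] := loc p; exists d => //.
  by have [] := pole_star d0 sd pk.
split.
- by exists P, Q.
- by have [d [fd _ _]] := loc None; exact: local_degree_nonconstant fd.
- move=> z np; have [d [[d0 fd] sd Wd]] := loc (Some z).
  have d1 : d = 1%N.
    move: d0; rewrite leq_eqVlt => /predU1P[//|d2]; exfalso; apply: np.
    by exists 2%N; exact: star_pole d2 sd.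
  have Wz := Wd z erefl d1; rewrite schwarzian_ratmap // -phiS //; field.
  by rewrite Wz.
- move=> p; have [d [fd sd _]] := loc p; split.
    move=> [d' d'2 fd']; exists 2%N; case: (order_uniq fd.2 fd'.2) => dE.
    by rewrite dE in sd; exact: star_pole d'2 sd.
  by move=> [k pk]; exists d => //; have [] := pole_star fd.1 sd pk.
- move=> p d d2 _ [a [ga a0 _]]; have [d' [fd' [b [gb b0 _]] _]] := loc p.
  have ab := laurent_uniq ga gb; rewrite (@indicial_inj C d d') //.
  by rewrite -a0 -b0 ab.
Qed.

Lemma two_fin : (forall p, is_pole phi p -> exists a, laurent (qd_local phi p) (- 2%:Z) a) ->
  exists a, laurent (qd_local phi None) (- 2%:Z) a.
Proof.
move=> two; have [/two//|np] := pselect (is_pole phi None).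
by have [a [ga _ _]] := nonpole_expansion mero.2 np; exists a.
Qed.

Section Existence.
Variable e : sphere C.
Hypothesis two : forall p, is_pole phi p ->
  exists a, laurent (qd_local phi p) (- 2%:Z) a.
Hypothesis starE : forall p, is_pole phi p -> p <> e ->
  exists2 d, (2 <= d)%N & star phi p d.

(** If infinity is not a pole, its expansion has the required form with d = 1. *)
Lemma star_infty : e <> None -> exists2 d, (0 < d)%N & star phi None d.
Proof.
move=> eN; have [pN|np] := pselect (is_pole phi None).
  by have [|d d2 sd] := starE pN; [move=> e'; exact: eN|exists d => //; exact: ltnW].
have [a [ga a0 a1]] := nonpole_expansion mero.2 np.
exists 1%N => //; exists a; split=> //; first by rewrite a0 expr1n subrr mul0r.
by apply/Ymx_eval1 => //; rewrite det_Ymx1.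
Qed.

Lemma star_expansion (p : sphere C) d : (0 < d)%N -> star phi p d ->
  exists2 a : fps C, star_series a d & \forall w \near (0 : C)^',
    conv a w (w ^+ 2 * qd_local phi p w).
Proof.
move=> d0 [a [/laurentE ga a0 ad]]; exists (Fps a).
  by split=> //; apply/Ymx_eval1.
by apply: filterS ga => w; rewrite opprK -exprnP.
Qed.

Variables (s : seq C) (A : {poly C}).
Hypothesis us : uniq s.
Hypothesis sP : forall c, c \in s <-> is_pole phi (Some c).
Hypothesis sA : (size A <= 2 * size s - 1)%N.
Hypothesis phiA : forall z, z \notin s -> (beta s).[z] ^+ 2 * phi z = A.[z].

(** The expansion of phi at c has the denominator beta ^ 2, whose nonvanishing
    part is the square of [betac s c]. *)
Lemma finite_numerator c d : c \in s -> (0 < d)%N -> star phi (Some c) d ->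
  exists2 a : fps C, atp c A = atp c (betac s c) ^+ 2 * a & star_series a d.
Proof.
move=> cs d0 /(star_expansion d0)[a aok ga]; exists a => //.
have Fz : Filter (0 : C)^' by apply: within_filter.
have shiftE (p : {poly C}) w : (p \Po ('X + c%:P)).[w] = p.[c + w].
  by rewrite horner_comp hornerD hornerX hornerC addrC.
apply: (@conv_inj _ _ _ (fun w => A.[c + w])).
  by apply: (@filterS _ _ Fz _ _ _ ga) => w _; rewrite -shiftE; exact: conv_poly.
apply: (@filterS2 _ _ Fz _ _ _ _ (poles_isolated mero c) ga) => w np aw.
have cw : c + w \notin s by apply/negP => /sP; exact: np.
rewrite -(phiA cw) (beta_split us cs) -rmorphXn.
have := @conv_polyM _ ((betac s c ^+ 2) \Po ('X + c%:P)) _ _ _ aw.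
rewrite shiftE horner_exp /=; congr (conv _ _ _).
by rewrite hornerM hornerXsubC addrAC subrr add0r; ring.
Qed.

Lemma infinite_numerator d : (0 < size s)%N -> (0 < d)%N -> star phi None d ->
  exists2 a : fps C, fpoly (polyrev (2 * size s - 2) A)
      = fpoly (polyrev (size s) (beta s)) ^+ 2 * a & star_series a d.
Proof.
move=> N0 d0 /(star_expansion d0)[a aok ga]; exists a => //.
have Fz : Filter (0 : C)^' by apply: within_filter.
have [m [b gb]] := mero.2.
set n := (2 * size s - 2)%N; set N := size s.
apply: (@conv_inj _ _ _ (fun w => (polyrev n A).[w])).
  by apply: (@filterS _ _ Fz _ _ _ ga) => w _; exact: conv_poly.
apply: (@filterS3 _ _ Fz _ _ _ _ _ (near_neq0 R) (isolated_infty gb) ga).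
move=> w w0 np aw.
have ws : w^-1 \notin s by apply/negP => /sP; exact: np.
rewrite -rmorphXn; have := @conv_polyM _ (polyrev N (beta s) ^+ 2) _ _ _ aw.
congr (conv _ _ _); rewrite horner_exp !horner_rev ?size_beta //; last first.
  by rewrite (leq_trans sA) // /n; lia.
rewrite -(phiA ws) /= exprMn -exprM.
have -> : (N * 2 = n + 2)%N by rewrite /n /N; lia.
by rewrite exprD; field.
Qed.

(** An exceptional pole in the plane is traded for infinity. If the exceptional
    pole is infinity itself, or if there is none, the finite poles suffice. *)
Lemma polynomial_solutions : exists sigma v1 v2 : {poly C},
  [/\ gop (@deriv C) (beta s) sigma A v1 = 0,
      gop (@deriv C) (beta s) sigma A v2 = 0 &
    forall c1 c2, c1 *: v1 + c2 *: v2 = 0 -> c1 = 0 /\ c2 = 0].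
Proof.
have [s0|N0] := posnP (size s).
  have A0 : A = 0 by apply/eqP; rewrite -size_poly_leq0; move: sA; rewrite s0.
  exists 0, 'X, 1; rewrite A0 /gop !derivC derivX !derivC.
  by split; [ring|ring|exact: free_X_1].
have /boolp.choice[dd ddP] : forall c, exists d, c \in s -> (0 < d)%N /\
    star phi (if Some c == e then None else Some c) d.
  move=> c; have [cs|] := boolP (c \in s); last by exists 0%N.
  case: eqP => [ce|ce].
    have [|d d0 sd] := star_infty; first by rewrite -ce.
    by exists d.
  by have [d d2 sd] := starE ((sP c).1 cs) ce; exists d => _; split=> //; exact: ltnW.
have := @two_polynomial_solutions _ s dd e A us N0 _ sA.
case.
- by move=> c /ddP[].
- move=> c cs ce; have [d0 sd] := ddP c cs; rewrite (negPf ce) in sd.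
  exact: finite_numerator.
- move=> c cs ce; have [d0 sd] := ddP c cs; rewrite ce eqxx in sd.
  exact: infinite_numerator.
- move=> v1 [v2 V]; eexists; exists v1, v2; exact: V.
Qed.

(** The common factor of the two solutions does not affect their quotient. *)
Lemma coprime_solution : exists P Q : {poly C},
  [/\ coprimep P Q, wron P Q != 0 &
    beta s ^+ 2 * schw P Q = 2%:R * A * wron P Q ^+ 2].
Proof.
have [sigma [v1 [v2 [L1 L2 free]]]] := polynomial_solutions.
have b0 : beta s != 0 by rewrite -size_poly_gt0 size_beta.
have v0 : (v1 != 0) || (v2 != 0).
  rewrite -negb_and; apply/negP => /andP[/eqP v10 /eqP v20].
  have := free 1 1; rewrite v10 v20 !scaler0 addr0 => /(_ erefl)[/eqP].
  by rewrite oner_eq0.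
set g := gcdp v1 v2; have g0 : g != 0 by rewrite gcdp_eq0 negb_and.
have E1 : g * (v1 %/ g) = v1 by rewrite mulrC divpK ?dvdp_gcdl.
have E2 : g * (v2 %/ g) = v2 by rewrite mulrC divpK ?dvdp_gcdr.
have co : coprimep (v1 %/ g) (v2 %/ g) by rewrite coprimep_div_gcd.
move: (v1 %/ g) (v2 %/ g) E1 E2 co => P Q E1 E2 co; clearbody g; subst v1 v2.
exists P, Q; split=> //.
  apply/eqP => /(wron_eq0 co)[/size1_polyC P0 /size1_polyC Q0].
  have [|q0 p0] := free Q`_0 (- P`_0).
    by rewrite {1}P0 {2}Q0 -!mul_polyC polyCN; ring.
  move/eqP: p0; rewrite oppr_eq0 => /eqP p0.
  by move: v0; rewrite P0 Q0 p0 q0 !mulr0 eqxx.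
apply: (mulfI (expf_neq0 4 g0)).
have := gop_schw b0 L1 L2; rewrite wron_scale schw_scale => E.
transitivity (beta s ^+ 2 * (g ^+ 4 * schw P Q)); first by ring.
by rewrite E; ring.
Qed.
End Existence.

Lemma schwarzian_part_b (e : sphere C) :
  (forall p, is_pole phi p -> exists a, laurent (qd_local phi p) (- 2%:Z) a) ->
  (forall p, is_pole phi p -> p <> e -> exists2 d, (2 <= d)%N & star phi p d) ->
  (forall p, is_pole phi p -> exists2 d, (2 <= d)%N & star phi p d) /\
  exists f : sphere C -> sphere C,
    [/\ rational_map f, ~ constant_map f, is_schwarzian phi f,
        (forall p, critical_point f p <-> is_pole phi p)
      & forall p d, (2 <= d)%N -> is_pole phi p -> star phi p d ->
          local_degree f p d].
Proof.
move=> two starE.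
have [s [A [us sP sA phiA]]] :=
  rational_form mero (fun c => @two (Some c)) (two_fin two).
have [P [Q [co W0 E]]] := coprime_solution starE us sP sA phiA.
have [st concl] := schwarzian_from_form sP phiA co W0 E.
by split=> //; exists (ratmap P Q).
Qed.
End Conclusions.

Theorem theorem1p1 (R : realType) (phi : CC R -> CC R) :
  meromorphic_quad_diff phi ->
  (* (a) *)
  (forall f : sphere (CC R) -> sphere (CC R),
    rational_map f -> ~ constant_map f -> is_schwarzian phi f ->
    (forall p k, pole_of_order phi p k -> k = 2%N) /\
    (forall p d, (2 <= d)%N -> local_degree f p d -> star phi p d))
  /\
  (* (b) *)
  ((forall p, is_pole phi p -> exists2 d, (2 <= d)%N & star phi p d) \/
   (exists e, pole_of_order phi e 2 /\
     forall p, is_pole phi p -> p <> e ->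
       exists2 d, (2 <= d)%N & star phi p d) ->
   (forall p, is_pole phi p -> exists2 d, (2 <= d)%N & star phi p d) /\
   exists f : sphere (CC R) -> sphere (CC R),
     [/\ rational_map f, ~ constant_map f, is_schwarzian phi f,
         (forall p, critical_point f p <-> is_pole phi p)
       & forall p d, (2 <= d)%N -> is_pole phi p -> star phi p d ->
           local_degree f p d]).
Proof.
move=> mero; split=> [f|]; first exact: schwarzian_part_a.
case=> [st|[e [[_ [a ga _]] st]]].
  apply: (schwarzian_part_b mero (e := None)) => [p /st[d _ [a [ga _ _]]]|p /st //].
  by exists a.
apply: (schwarzian_part_b mero _ st) => p pp.
have [->|pe] := pselect (p = e); first by exists a.
by have [d _ [b [gb _ _]]] := st p pp pe; exists b.
Qed.
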